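(* Let $0<\nu<1$ and assume $\frac{1}{\lambda_{\min}(\Psi)}\in\left(0,\frac{1-\nu}{2\ell_V}\right)$, where $\lambda_{\min}(\Psi)$ is the smallest eigenvalue of $\Psi$. Let $0<\alpha_k\le\bar\alpha<1$ for all $k$, and let $$\rho_k=\frac{(3-\nu)(1-\bar\alpha)^2}{2(2\alpha_k^2-\alpha_k+1)(1+\ell_{V,\Psi})}.$$ Let $X_k=(\mathbf u_k,\boldsymbol\mu_k,\boldsymbol\lambda_k)$ be generated by the relaxed inertial stochastic forward-backward-forward (RISFBF) iteration $$\begin{aligned} Z_k&=X_k+\alpha_k(X_k-X_{k-1}),\\ Y_k&=\mathrm J_{\Psi^{-1}T}\big(Z_k-\Psi^{-1}\hat V_k(Z_k,\xi_k)\big),\\ X_{k+1}&=(1-\rho_k)Z_k+\rho_k\big[Y_k-\Psi^{-1}\big(\hat V_k(Y_k,\eta_k)-\hat V_k(Z_k,\xi_k)\big)\big],\end{aligned}$$ for $k\ge 0$, with $X_0=(\mathbf u_0,\boldsymbol\mu_0,\boldsymbol\lambda_0)\in\mathbb R^d\times\mathbb R^{mN}\times\mathbb R^{mN}_{\ge 0}$ and $X_{-1}=X_0$. Then the sequence $(\mathbf u_k)_{k\ge 1}$ converges almost surely to a v-GNE of the game.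
   Context: **Game.** Agents $i\in\mathcal I=\{1,\dots,N\}$ choose $u_i\in\mathbb R^{d_i}$; $\mathbf u=\mathrm{col}(u_1,\dots,u_N)\in\mathbb R^d$, $d=\sum_i d_i$, and $\mathbf u_{-i}$ collects the actions of all agents except $i$. Agent $i$ has cost $\mathbb J_i(u_i,\mathbf u_{-i})=f_i(u_i,\mathbf u_{-i})+g_i(u_i)$ with $f_i(\mathbf u)=\mathbb E[\hat f_i(\mathbf u,\xi_i)]$, where $\xi_i$ is a random variable with values in a measurable set $\Xi_i\subset\mathbb R^{q_i}$. Here $g_i:\mathbb R^{d_i}\to\mathbb R\cup\{+\infty\}$ is proper, convex, lower semicontinuous and $\mathrm{dom}(g_i)=\mathsf U_i$ is nonempty, compact and convex; for every $\mathbf u_{-i}$, $f_i(\cdot,\mathbf u_{-i})$ is convex and continuously differentiable. Let $D_i\in\mathbb R^{m\times d_i}$, $b_i\in\mathbb R^m$, $D=[D_1|\dots|D_N]$, $b=\sum_i b_i$, $\mathsf U=\mathsf U_1\times\dots\times\mathsf U_N$. The feasible set $\boldsymbol{\mathcal C}=\{\mathbf u\in\mathsf U\mid D\mathbf u-b\le \mathbf 0_m\}$ satisfies Slater's constraint qualification. Agent $i$ solves $\min_{u_i}\mathbb J_i(u_i,\mathbf u_{-i})$ subject to $u_i\in\mathcal C_i(\mathbf u_{-i})=\{u_i\in\mathsf U_i\mid D_iu_i-b_i\le\sum_{j\ne i}(b_j-D_ju_j)\}$. The pseudogradient $F(\mathbf u)=\mathrm{col}(\nabla_{u_1}f_1(\mathbf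 u),\dots,\nabla_{u_N}f_N(\mathbf u))$ is monotone and $\ell$-Lipschitz on $\mathbb R^d$. **v-GNE.** $\mathbf u^*$ is a variational generalized Nash equilibrium (v-GNE) if there is $\lambda^*\in\mathbb R^m_{\ge0}$ such that $\mathbf 0\in\nabla_{u_i}f_i(\mathbf u^* )+\partial g_i(u_i^* )+D_i^\top\lambda^*$ for all $i\in\mathcal I$ and $\mathbf 0\in \mathrm N_{\mathbb R^m_{\ge0}}(\lambda^* )-(D\mathbf u^*-b)$, where $\mathrm N_C$ is the normal cone operator. **Operators.** $\mathbf W=[w_{i,j}]\in\mathbb R^{N\times N}$ is a nonnegative symmetric irreducible weighted adjacency matrix, $\mathbf L=\mathrm{diag}\{(\mathbf W\mathbf 1_N)_1,\dots,(\mathbf W\mathbf 1_N)_N\}-\mathbf W$ its Laplacian, $\kappa=|\mathbf L|$ its spectral norm, $\bar{\mathbf L}=\mathbf L\otimes \mathbf I_m$, $\mathbf D=\mathrm{diag}\{D_1,\dots,D_N\}$ (block diagonal, with spectral norm $|\mathbf D|$), $\bar b=\mathrm{col}(b_1,\dots,b_N)$. On $\mathsf X=\mathbb R^d\times\mathbb R^{mN}\times\mathbb R^{mN}$ with $\mathbf x=(\mathbf u,\boldsymbol\mu,\boldsymbol\lambda)$ let $$V(\mathbf x)=\begin{bmatrix}F(\mathbf u)+\mathbf D^\top\boldsymbol\lambda\\ \bar{\mathbf L}\boldsymbol\lambda\\ \bar b+\bar{\mathbf L}(\boldsymbol\lambda-\boldsymbol\mu)-\mathbf D\mathbf u\end{bmatrix},\qquad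 T(\mathbf x)=\big(\partial g_1(u_1)\times\dots\times\partial g_N(u_N)\big)\times\{\mathbf 0_{mN}\}\times \mathrm N_{\mathbb R^{mN}_{\ge0}}(\boldsymbol\lambda).$$ $\mathrm J_A=(\mathrm{Id}+A)^{-1}$ is the resolvent. $\Psi=\mathrm{diag}(\boldsymbol\gamma^{-1},\boldsymbol\sigma^{-1},\boldsymbol\tau^{-1})$, where $\boldsymbol\gamma=\mathrm{diag}\{\gamma_1\mathbf I_{d_1},\dots,\gamma_N\mathbf I_{d_N}\}$, $\boldsymbol\sigma=\mathrm{diag}\{\sigma_1\mathbf I_m,\dots,\sigma_N\mathbf I_m\}$, $\boldsymbol\tau=\mathrm{diag}\{\tau_1\mathbf I_m,\dots,\tau_N\mathbf I_m\}$ with step sizes $\gamma_i,\sigma_i,\tau_i>0$. Constants: $\ell_V=\ell+2\kappa+|\mathbf D|$ and $\ell_{V,\Psi}=\ell_V/\lambda_{\min}(\Psi)$. **Sampling.** At iteration $k$ each agent draws two batches $\xi_{i,k}=(\xi_{i,k}^{(t)})_{t=1}^{S_k}$ and $\eta_{i,k}=(\eta_{i,k}^{(t)})_{t=1}^{S_k}$ of i.i.d. copies of $\xi_i$; $\xi_k=(\xi_{i,k})_i$ and $\eta_k=(\eta_{i,k})_i$ are independent of each other and of all samples of other iterations. The batch sizes $S_k\ge1$ are increasing with $\sum_k 1/S_k<\infty$. Put $\hat F_{i,k}(\mathbf u,\xi_{i,k})=\frac1{S_k}\sum_{t=1}^{S_k}\nabla_{u_i}\hat f_i(\mathbf u,\xi_{i,k}^{(t)})$,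 $\hat F_k=\mathrm{col}(\hat F_{1,k},\dots,\hat F_{N,k})$, and let $\hat V_k(\mathbf x,\xi_k)$ be $V(\mathbf x)$ with $F(\mathbf u)$ replaced by $\hat F_k(\mathbf u,\xi_k)$. The error $\varepsilon_k(\mathbf x,\xi_k)=\hat V_k(\mathbf x,\xi_k)-V(\mathbf x)$ satisfies, for some $\sigma>0$ independent of $k$ and $\mathbf x$, $\mathbb E[\varepsilon_k(\mathbf x,\xi_k)\mid\mathbf x]=0$ and $\mathbb E[\|\varepsilon_k(\mathbf x,\xi_k)\|^2\mid\mathbf x]\le\sigma^2/S_k$ almost surely, for all $k$ and $\mathbf x\in\mathsf X$; the same holds with $\eta_k$ in place of $\xi_k$. *)

(* Defs.v *)
From HB Require Import structures.
From mathcomp Require Import all_boot all_order all_algebra all_fingroup.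
From mathcomp Require Import all_classical all_reals all_analysis.

Set Implicit Arguments.
Unset Strict Implicit.
Unset Printing Implicit Defensive.

Import Order.TTheory GRing.Theory Num.Theory.
Import numFieldNormedType.Exports.

Local Open Scope classical_set_scope.
Local Open Scope ring_scope.

(* A vector of R^(p_1 + ... + p_N) is a block column \mxcol_i u_i, whose i-th
   block is [submxcol u i]; R^(mN) is the case of a constant p. *)
Notation blockdim p := (\sum_i p i)%N.
Notation repdim N m := (\sum_(i < N) m)%N.

Section Euclidean.
Context {R : realType}.

Definition dot n (x y : 'cV[R]_n) : R := \sum_i x i 0 * y i 0.

(* The norm of 'cV[R]_n in the library is the sup norm; it is used here only
   through the topology. *)
Definition enorm n (x : 'cV[R]_n) : R := Num.sqrt (dot x x).

Definition spectral_norm m n (A : 'M[R]_(m, n)) : R :=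
  sup [set enorm (A *m x) | x in [set x : 'cV[R]_n | enorm x <= 1]].

Definition min_eigenvalue n (A : 'M[R]_n) : R := inf [set a | eigenvalue A a].

Definition monotone_map n (F : 'cV[R]_n -> 'cV[R]_n) : Prop :=
  forall x y, 0 <= dot (F x - F y) (x - y).

Definition lipschitz_with n (l : R) (F : 'cV[R]_n -> 'cV[R]_n) : Prop :=
  forall x y, enorm (F x - F y) <= l * enorm (x - y).

Definition nonneg n : set 'cV[R]_n := [set x | forall j, 0 <= x j 0].

Definition grad n (h : 'cV[R]_n -> R) (x : 'cV[R]_n) : 'cV[R]_n :=
  \col_j 'D_(delta_mx j 0) h x.

Definition continuously_differentiable n (h : 'cV[R]_n -> R) : Prop :=
  (forall x, differentiable h x) /\ continuous (grad h).

End Euclidean.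

Section ConvexAnalysis.
Context {R : realType} {n : nat}.

Definition edom (g : 'cV[R]_n -> \bar R) : set 'cV[R]_n :=
  [set x | (g x < +oo)%E].

Definition proper_function (g : 'cV[R]_n -> \bar R) : Prop :=
  (forall x, (-oo < g x)%E) /\ edom g !=set0.

Definition econvex_function (g : 'cV[R]_n -> \bar R) : Prop :=
  forall (x y : 'cV[R]_n) (t : R), 0 <= t <= 1 ->
    (g (t *: x + (1 - t) *: y)%R <= t%:E * g x + (1 - t)%:E * g y)%E.

Definition subdiff (g : 'cV[R]_n -> \bar R) (x : 'cV[R]_n) : set 'cV[R]_n :=
  [set p | forall y, (g x + (dot p (y - x))%:E <= g y)%E].

Definition normal_cone (C : set 'cV[R]_n) (x : 'cV[R]_n) : set 'cV[R]_n :=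
  [set p | C x /\ forall y, C y -> dot p (y - x) <= 0].

(* J_A z = (Id + A)^-1 z, as a set *)
Definition resolvent (A : 'cV[R]_n -> set 'cV[R]_n) (z : 'cV[R]_n) :
    set 'cV[R]_n :=
  [set y | exists2 a, A y a & z = y + a].

Definition mxcomp (M : 'M[R]_n) (A : 'cV[R]_n -> set 'cV[R]_n)
    (x : 'cV[R]_n) : set 'cV[R]_n :=
  [set M *m p | p in A x].

End ConvexAnalysis.

Section Game.
Context {R : realType} {N m : nat} {d : 'I_N -> nat}.

Definition replace_block (u : 'cV[R]_(blockdim d)) (i : 'I_N) (v : 'cV[R]_(d i)) :
    'cV[R]_(blockdim d) :=
  \mxcol_j dfwith (submxcol u) i v j.

Definition partial_grad (i : 'I_N) (h : 'cV[R]_(blockdim d) -> R)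
    (u : 'cV[R]_(blockdim d)) : 'cV[R]_(d i) :=
  grad (fun v => h (replace_block u v)) (submxcol u i).

Definition pseudogradient (f : 'I_N -> 'cV[R]_(blockdim d) -> R)
    (u : 'cV[R]_(blockdim d)) : 'cV[R]_(blockdim d) :=
  \mxcol_i partial_grad i (f i) u.

Definition coupling (D : forall i, 'M[R]_(m, d i)) : 'M[R]_(m, blockdim d) :=
  \mxrow_i D i.

Definition Slater (g : forall i, 'cV[R]_(d i) -> \bar R)
    (D : forall i, 'M[R]_(m, d i)) (b : 'I_N -> 'cV[R]_m) : Prop :=
  exists u : 'cV[R]_(blockdim d),
    (forall i, edom (g i) (submxcol u i)) /\
    (forall j, (coupling D *m u - \sum_i b i) j 0 < 0).

Definition vGNE (f : 'I_N -> 'cV[R]_(blockdim d) -> R)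
    (g : forall i, 'cV[R]_(d i) -> \bar R)
    (D : forall i, 'M[R]_(m, d i)) (b : 'I_N -> 'cV[R]_m)
    (u : 'cV[R]_(blockdim d)) : Prop :=
  exists lam : 'cV[R]_m,
    [/\ nonneg lam,
        forall i, exists2 s, subdiff (g i) (submxcol u i) s &
          0 = partial_grad i (f i) u + s + (D i)^T *m lam
      & exists2 p, normal_cone (@nonneg R m) lam p &
          0 = p - (coupling D *m u - \sum_i b i)].

End Game.

Section Network.
Context {R : realType} {N : nat}.

(* A simultaneous permutation of rows and columns brings A to a block upper
   triangular form with two nonempty square diagonal blocks. *)
Definition reducible (A : 'M[R]_N) : Prop :=
  exists (s : 'S_N) (r : nat), (0 < r < N)%N /\
    forall i j : 'I_N, (r <= i)%N -> (j < r)%N -> A (s i) (s j) = 0.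

Definition laplacian (W : 'M[R]_N) : 'M[R]_N :=
  diag_mx (W *m const_mx 1 : 'cV[R]_N)^T - W.

(* the Kronecker product of the Laplacian with I_m *)
Definition laplacian_bar (m : nat) (W : 'M[R]_N) :
    'M[R]_(repdim N m, repdim N m) :=
  \mxblock_(i < N, j < N) ((laplacian W i j)%:M : 'M[R]_m).

Definition coupling_diag (m : nat) (d : 'I_N -> nat)
    (D : forall i, 'M[R]_(m, d i)) : 'M[R]_(repdim N m, blockdim d) :=
  \mxblock_(i < N, j < N) (if i == j then D j else 0).

End Network.

Section Operators.
Context {R : realType} {N m : nat} {d : 'I_N -> nat}.

(* x = (u, mu, lambda) *)
Notation state := 'cV[R]_(blockdim d + (repdim N m + repdim N m)).

Definition actions (x : state) : 'cV[R]_(blockdim d) := usubmx x.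
Definition auxiliaries (x : state) : 'cV[R]_(repdim N m) := usubmx (dsubmx x).
Definition multipliers (x : state) : 'cV[R]_(repdim N m) := dsubmx (dsubmx x).

(* Both V (with F the pseudogradient) and its stochastic estimator (with F a
   sample average). *)
Definition Vop (F : 'cV[R]_(blockdim d) -> 'cV[R]_(blockdim d))
    (D : forall i, 'M[R]_(m, d i)) (b : 'I_N -> 'cV[R]_m) (W : 'M[R]_N)
    (x : state) : state :=
  let u := actions x in
  let mu := auxiliaries x in
  let lam := multipliers x in
  let L := laplacian_bar m W in
  col_mx (F u + (coupling_diag D)^T *m lam)
    (col_mx (L *m lam)
            ((\mxcol_i b i) + L *m (lam - mu) - coupling_diag D *m u)).

Definition Top (g : forall i, 'cV[R]_(d i) -> \bar R) (x : state) : set state :=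
  [set p | [/\ forall i, subdiff (g i) (submxcol (actions x) i)
                                       (submxcol (actions p) i),
               auxiliaries p = 0
             & normal_cone (@nonneg R (repdim N m)) (multipliers x)
                 (multipliers p)]].

Definition stepsize_mx (p : 'I_N -> nat) (c : 'I_N -> R) : 'M[R]_(blockdim p) :=
  \mxdiag_i (c i)%:M.

Definition Psi (gam sig tau : 'I_N -> R) :
    'M[R]_(blockdim d + (repdim N m + repdim N m)) :=
  block_mx (invmx (stepsize_mx d gam)) 0 0
    (block_mx (invmx (stepsize_mx (fun=> m) sig)) 0 0
              (invmx (stepsize_mx (fun=> m) tau))).

End Operators.

(* R^n as a measurable type with its Borel sigma-algebra *)
Notation borel_cV R n := (g_sigma_algebraType (@open 'cV[R]_n)).

Section Sampling.
Context {dO : measure_display} {Omega : measurableType dO} {R : realType}.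
Variable P : probability Omega R.

Definition mutually_independent (I : eqType) (G : I -> set (set Omega)) : Prop :=
  forall (s : seq I) (A : I -> set Omega), uniq s ->
    (forall i, i \in s -> G i (A i)) ->
    P (\big[setI/setT]_(i <- s) A i) = (\prod_(i <- s) P (A i))%E.

Definition rv_sigma (n : nat) (X : Omega -> 'cV[R]_n) : set (set Omega) :=
  preimage_set_system setT X (@measurable _ (borel_cV R n)).

Definition iid_copies (n S : nat) (X : Omega -> 'cV[R]_n)
    (Y : 'I_S -> Omega -> 'cV[R]_n) : Prop :=
  [/\ forall t, measurable_fun setT (Y t : Omega -> borel_cV R n),
      forall t (B : set (borel_cV R n)), measurable B ->
        P (Y t @^-1` B) = P (X @^-1` B)
    & mutually_independent (fun t => rv_sigma (Y t))].

Definition batch_sigma (N S : nat) (q : 'I_N -> nat)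
    (Y : forall i : 'I_N, 'I_S -> Omega -> 'cV[R]_(q i)) : set (set Omega) :=
  <<s \bigcup_(i in [set: 'I_N]) \bigcup_(t in [set: 'I_S]) rv_sigma (Y i t) >>.

Definition batch_pseudogradient (N S : nat) (d q : 'I_N -> nat)
    (fhat : forall i, 'cV[R]_(blockdim d) -> 'cV[R]_(q i) -> R)
    (s : forall i : 'I_N, 'I_S -> 'cV[R]_(q i)) (u : 'cV[R]_(blockdim d)) :
    'cV[R]_(blockdim d) :=
  \mxcol_i (S%:R^-1 *: \sum_(t < S)
    partial_grad i (fun v => fhat i v (s i t)) u).

(* err x w is the error at the point x. The point is frozen, so the conditional
   expectation given x is the integral over w. *)
Definition unbiased_with_variance (n : nat) (err : 'cV[R]_n -> Omega -> 'cV[R]_n)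
    (v : R) : Prop :=
  forall x,
    (forall j, ('E_P[fun w => err x w j ord0] = 0)%E) /\
    ('E_P[fun w => (enorm (err x w) ^+ 2)%R] <= v%:E)%E.

End Sampling.

(* Main.v *)
(* Let |.| be the norm weighted by Psi, L = l_V / lmin <= 1/2, and write the
   iteration as X_{k+1} = Z_k - rho_k H_k with H_k = Z_k - Y_k +
   Psi^-1 (B_k - A_k), where A_k and B_k are the sampled values of V at Z_k and
   Y_k.  Monotonicity gives <H_k, Y_k - p> >= (B_k - V Y_k, Y_k - p) for every
   zero p of V + T, and the Lipschitz bound gives
   (1 + L) <H_k, Z_k - Y_k> >= (1 - eps) |H_k|^2 up to squared sampling errors.
   With s_k the bounded solution of s_k = alpha_k (1 + s_{k+1}) and
   v_k = X_k - X_{k-1}, the energy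
     |X_k - p|^2 + 2 s_k <X_k - p, v_k> + 2 s_k abar / (1 - abar) |v_k|^2
   decreases by a multiple of |H_k|^2 up to the terms
   2 (1 + s_{k+1}) rho_k (B_k - V Y_k, Y_k - p) and squared errors.
   The squared errors have summable expectations.  The other terms are martingale
   differences; they involve only the actions, which lie in a compact set after the
   resolvent, and are affine in p, so finitely many martingales yield one almost sure
   event that serves all p.  On that event a quasi-Fejer argument gives convergence
   to a zero of V + T, whose actions form a v-GNE.  A zero exists because a v-GNE
   does (Tikhonov regularization, the multipliers being bounded by the Slater
   point) and the range of the Laplacian is the orthogonal complement of the
   constants. *)

(* The obstacle is the linear noise term. Its size is of order 1/sqrt(S_k), which need not be
   summable, so it has to be a martingale difference whose series converges without converging
   absolutely. The error of the first batch is correlated with Y_k and would not qualify; it cancels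
   exactly, because the resolvent inclusion turns H_k into Psi^-1 (t_k + B_k) with t_k in T Y_k.
   Only the second batch, drawn once Y_k is known, pairs with Y_k - p; the first one enters through
   squares alone. Martingale convergence needs bounded second moments before any bound on the
   iterates is available, and the compact domains of the g_i supply it. The weights s_k are
   deterministic, so the rest is a pathwise argument in which p may depend on the path. The
   constants leave a fixed margin: the coefficient of |H_k|^2 is at least 1/8 without noise, and
   half of this absorbs the products of H_k with the errors. *)
Require Import Defs.
From HB Require Import structures.
From mathcomp Require Import all_boot all_order all_algebra all_fingroup.
From mathcomp Require Import all_classical all_reals all_analysis.
From mathcomp Require Import measurable_realfun.
From mathcomp Require Import ring lra.

Set Implicit Arguments.
Unset Strict Implicit.
Unset Printing Implicit Defensive.

Import Order.TTheory GRing.Theory Num.Theory.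
Import numFieldNormedType.Exports.

Local Open Scope classical_set_scope.
Local Open Scope ring_scope.

(** * Euclidean vectors and sequences *)

Section WeightedDot.
Context {R : realType} {n : nat}.
Implicit Types (w : 'I_n -> R) (x y z : 'cV[R]_n).

(** Psi is diagonal, so its norm needs only one weight per coordinate; constant weights 1 give back
    the Euclidean product. *)
Definition wdot w x y : R := \sum_i w i * (x i 0 * y i 0).
Definition wnorm w x : R := Num.sqrt (wdot w x x).

Lemma dotE x y : dot x y = wdot (fun=> 1) x y.
Proof. by apply: eq_bigr => i _; rewrite mul1r. Qed.

Lemma enormE x : enorm x = wnorm (fun=> 1) x.
Proof. by rewrite /enorm dotE. Qed.

Lemma wdotC w x y : wdot w x y = wdot w y x.
Proof. by apply: eq_bigr => i _; rewrite [x i 0 * _]mulrC. Qed.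

Lemma wdotDl w x y z : wdot w (x + y) z = wdot w x z + wdot w y z.
Proof. by rewrite -big_split; apply: eq_bigr => i _; rewrite mxE /=; ring. Qed.

Lemma wdotZl w a x z : wdot w (a *: x) z = a * wdot w x z.
Proof. by rewrite mulr_sumr; apply: eq_bigr => i _; rewrite mxE /=; ring. Qed.

Lemma wdotNl w x z : wdot w (- x) z = - wdot w x z.
Proof. by rewrite -scaleN1r wdotZl mulN1r. Qed.

Lemma wdotBl w x y z : wdot w (x - y) z = wdot w x z - wdot w y z.
Proof. by rewrite wdotDl wdotNl. Qed.

Lemma wdotDr w x y z : wdot w z (x + y) = wdot w z x + wdot w z y.
Proof. by rewrite wdotC wdotDl !(wdotC w z). Qed.

Lemma wdotZr w a x z : wdot w z (a *: x) = a * wdot w z x.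
Proof. by rewrite wdotC wdotZl (wdotC w z). Qed.

Lemma wdotNr w x z : wdot w z (- x) = - wdot w z x.
Proof. by rewrite wdotC wdotNl (wdotC w z). Qed.

Lemma wdotBr w x y z : wdot w z (x - y) = wdot w z x - wdot w z y.
Proof. by rewrite wdotDr wdotNr. Qed.

Lemma wdot0l w z : wdot w 0 z = 0.
Proof. by rewrite -(scale0r 0) wdotZl mul0r. Qed.

Lemma wdot0r w z : wdot w z 0 = 0.
Proof. by rewrite wdotC wdot0l. Qed.

Definition wdotE := (wdotDl, wdotDr, wdotNl, wdotNr, wdotZl, wdotZr).

Lemma wdot_shift w w' x y :
  wdot w (\col_i (w' i * x i 0)) y = wdot (fun i => w i * w' i) x y.
Proof. by apply: eq_bigr => i _; rewrite mxE; ring. Qed.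

Section Positive.
Variable w : 'I_n -> R.
Hypothesis w0 : forall i, 0 < w i.

Lemma wdot_ge0 x : 0 <= wdot w x x.
Proof.
by apply: sumr_ge0 => i _; apply: mulr_ge0; [exact: ltW | rewrite -expr2 sqr_ge0].
Qed.

Lemma wnorm_ge0 x : 0 <= wnorm w x.
Proof. exact: sqrtr_ge0. Qed.

Lemma sqr_wnorm x : wnorm w x ^+ 2 = wdot w x x.
Proof. by rewrite sqr_sqrtr ?wdot_ge0. Qed.

Lemma wdot_coord x i : x i 0 ^+ 2 <= (w i)^-1 * wdot w x x.
Proof.
rewrite ler_pdivlMl// /wdot (bigD1 i)//= -expr2 lerDl.
by apply: sumr_ge0 => j _; apply: mulr_ge0; [exact: ltW | rewrite -expr2 sqr_ge0].
Qed.

Lemma wdot_CauchySchwarz x y : wdot w x y ^+ 2 <= wdot w x x * wdot w y y.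
Proof.
have [y0|y0] := eqVneq (wdot w y y) 0.
  have -> : y = 0.
    apply/colP => i; rewrite mxE; apply/eqP; rewrite -sqrf_eq0.
    by rewrite eq_le sqr_ge0 andbT (le_trans (wdot_coord _ _))// y0 mulr0.
  by rewrite !wdot0r expr0n mulr0.
have ypos : 0 < wdot w y y by rewrite lt_neqAle eq_sym y0 wdot_ge0.
have := wdot_ge0 (wdot w y y *: x - wdot w x y *: y).
rewrite !wdotE (wdotC w y x) => h.
rewrite -subr_ge0 -(pmulr_rge0 _ ypos); apply: le_trans h _.
by rewrite le_eqVlt; apply/orP; left; apply/eqP; ring.
Qed.

Lemma wdot_le x y : `|wdot w x y| <= wnorm w x * wnorm w y.
Proof.
rewrite -(@ler_pXn2r _ 2)//= ?nnegrE ?mulr_ge0 ?wnorm_ge0//.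
by rewrite real_normK ?num_real// exprMn !sqr_wnorm wdot_CauchySchwarz.
Qed.

Lemma wdot_le_norm x y : wdot w x y <= wnorm w x * wnorm w y.
Proof. exact: le_trans (ler_norm _) (wdot_le _ _). Qed.

Lemma ler_wnormD x y : wnorm w (x + y) <= wnorm w x + wnorm w y.
Proof.
rewrite -(@ler_pXn2r _ 2)//= ?nnegrE ?addr_ge0 ?wnorm_ge0//.
rewrite sqr_wnorm sqrrD !sqr_wnorm !wdotE (wdotC w y x).
have := wdot_le_norm x y; lra.
Qed.

Lemma wnormN x : wnorm w (- x) = wnorm w x.
Proof. by rewrite /wnorm !wdotE opprK. Qed.

Lemma wnormZ a x : wnorm w (a *: x) = `|a| * wnorm w x.
Proof. by rewrite /wnorm !wdotE mulrA -expr2 sqrtrM ?sqr_ge0// sqrtr_sqr. Qed.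

End Positive.

End WeightedDot.

Section EuclideanNorm.
Context {R : realType}.
Let one_pos n : forall i : 'I_n, 0 < (fun=> 1 : R) i := fun=> ltr01.

Lemma enorm_ge0 n (x : 'cV[R]_n) : 0 <= enorm x.
Proof. exact: sqrtr_ge0. Qed.

Lemma dot_ge0 n (x : 'cV[R]_n) : 0 <= dot x x.
Proof. by rewrite dotE wdot_ge0. Qed.

Lemma sqr_enorm n (x : 'cV[R]_n) : enorm x ^+ 2 = dot x x.
Proof. by rewrite enormE sqr_wnorm// dotE. Qed.

Lemma dot_le n (x y : 'cV[R]_n) : `|dot x y| <= enorm x * enorm y.
Proof. by rewrite !enormE dotE wdot_le. Qed.

Lemma enorm_coord n (x : 'cV[R]_n) i : `|x i 0| <= enorm x.
Proof.
rewrite -(@ler_pXn2r _ 2)//= ?nnegrE ?enorm_ge0//.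
rewrite real_normK ?num_real// sqr_enorm dotE.
by have := @wdot_coord R n _ (@one_pos n) x i; rewrite invr1 mul1r.
Qed.

Lemma enormD n (x y : 'cV[R]_n) : enorm (x + y) <= enorm x + enorm y.
Proof. by rewrite !enormE ler_wnormD. Qed.

Lemma enormN n (x : 'cV[R]_n) : enorm (- x) = enorm x.
Proof. by rewrite !enormE wnormN. Qed.

Lemma enormZ n a (x : 'cV[R]_n) : enorm (a *: x) = `|a| * enorm x.
Proof. by rewrite !enormE wnormZ. Qed.

Lemma dotC n (x y : 'cV[R]_n) : dot x y = dot y x.
Proof. by rewrite !dotE wdotC. Qed.
Lemma dotDl n (x y z : 'cV[R]_n) : dot (x + y) z = dot x z + dot y z.
Proof. by rewrite !dotE wdotDl. Qed.
Lemma dotDr n (x y z : 'cV[R]_n) : dot z (x + y) = dot z x + dot z y.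
Proof. by rewrite !dotE wdotDr. Qed.
Lemma dotNl n (x z : 'cV[R]_n) : dot (- x) z = - dot x z.
Proof. by rewrite !dotE wdotNl. Qed.
Lemma dotNr n (x z : 'cV[R]_n) : dot z (- x) = - dot z x.
Proof. by rewrite !dotE wdotNr. Qed.
Lemma dotZl n a (x z : 'cV[R]_n) : dot (a *: x) z = a * dot x z.
Proof. by rewrite !dotE wdotZl. Qed.
Lemma dotZr n a (x z : 'cV[R]_n) : dot z (a *: x) = a * dot z x.
Proof. by rewrite !dotE wdotZr. Qed.
Lemma dot0l n (z : 'cV[R]_n) : dot 0 z = 0.
Proof. by rewrite dotE wdot0l. Qed.
Lemma dot0r n (z : 'cV[R]_n) : dot z 0 = 0.
Proof. by rewrite dotE wdot0r. Qed.

Lemma dotB_le n (x y : 'cV[R]_n) :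
  dot (x - y) (x - y) <= 2 * dot x x + 2 * dot y y.
Proof.
have := dot_ge0 (x + y); rewrite !dotE !wdotE (wdotC _ y x) -!dotE; lra.
Qed.

Lemma dot_delta n (x : 'cV[R]_n) l : dot x (delta_mx l 0) = x l 0.
Proof.
rewrite /dot [LHS](bigD1 l)//= [X in _ + X]big1 => [|j jl].
  by rewrite mxE !eqxx mulr1 addr0.
by rewrite mxE (negbTE jl) mulr0.
Qed.

Definition dotLE := (dotDl, dotDr, dotNl, dotNr, dotZl, dotZr).

Lemma dot_mulmx m n (A : 'M[R]_(m, n)) x y : dot (A *m x) y = dot x (A^T *m y).
Proof.
rewrite /dot.
under eq_bigr => i _ do rewrite mxE big_distrl /=.
rewrite exchange_big /=; apply: eq_bigr => j _.
rewrite mxE big_distrr /=; apply: eq_bigr => i _; rewrite mxE; ring.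
Qed.

Lemma dot_col_mx m n (x x' : 'cV[R]_m) (y y' : 'cV[R]_n) :
  dot (col_mx x y) (col_mx x' y') = dot x x' + dot y y'.
Proof.
rewrite /dot big_split_ord /=; congr (_ + _); apply: eq_bigr => i _.
  by rewrite !col_mxEu.
by rewrite !col_mxEd.
Qed.

(** Bounds the set whose supremum is the spectral norm; without a bound [sup] would return its
    default value. *)
Lemma enorm_mulmx_bounded m n (A : 'M[R]_(m, n)) (x : 'cV[R]_n) :
  enorm x <= 1 -> enorm (A *m x) <= \sum_i enorm (col i A).
Proof.
move=> x1.
have -> : A *m x = \sum_i x i 0 *: col i A.
  apply/colP => k; rewrite mxE summxE; apply: eq_bigr => i _.
  by rewrite !mxE mulrC.
elim/big_ind2 : _ => [|u u' v v' uu' vv'|i _].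
- by rewrite /enorm dot0l sqrtr0.
- exact: le_trans (enormD _ _) (lerD uu' vv').
- by rewrite enormZ ler_piMl ?enorm_ge0// (le_trans (enorm_coord _ _)).
Qed.

Lemma enorm_eq0 n (x : 'cV[R]_n) : enorm x = 0 -> x = 0.
Proof.
move=> x0; apply/colP => i; rewrite mxE; apply/eqP.
by rewrite -normr_le0 -x0 enorm_coord.
Qed.

Lemma spectral_norm_ge0 m n (A : 'M[R]_(m, n)) : 0 <= spectral_norm A.
Proof.
apply: ub_le_sup; last first.
  by exists 0; rewrite ?mulmx0 /= /enorm dot0l sqrtr0.
by exists (\sum_i enorm (col i A)) => _ [x /= x1 <-]; exact: enorm_mulmx_bounded.
Qed.

Lemma spectral_normP m n (A : 'M[R]_(m, n)) (x : 'cV[R]_n) :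
  enorm (A *m x) <= spectral_norm A * enorm x.
Proof.
have [x0|x0] := eqVneq (enorm x) 0.
  by rewrite (enorm_eq0 x0) mulmx0 /enorm !dot0l sqrtr0 mulr0.
have xpos : 0 < enorm x by rewrite lt_neqAle eq_sym x0 enorm_ge0.
rewrite -ler_pdivrMr// mulrC.
have -> : (enorm x)^-1 * enorm (A *m x) = enorm (A *m ((enorm x)^-1 *: x)).
  by rewrite -scalemxAr enormZ ger0_norm// invr_ge0 ltW.
apply: ub_le_sup.
  by exists (\sum_i enorm (col i A)) => _ [z /= z1 <-]; exact: enorm_mulmx_bounded.
exists ((enorm x)^-1 *: x) => //=.
by rewrite enormZ ger0_norm ?invr_ge0 ?enorm_ge0 // mulVf.
Qed.

(** From |A^T x|^2 = <A A^T x, x> and a division by |A^T x|, so the norm of A serves for its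
    transpose. *)
Lemma spectral_normP_trmx m n (A : 'M[R]_(m, n)) (x : 'cV[R]_m) :
  enorm (A^T *m x) <= spectral_norm A * enorm x.
Proof.
have [x0|x0] := eqVneq (enorm (A^T *m x)) 0.
  by rewrite x0 mulr_ge0 ?spectral_norm_ge0 ?enorm_ge0.
have xpos : 0 < enorm (A^T *m x) by rewrite lt_neqAle eq_sym x0 enorm_ge0.
rewrite -(ler_pM2l xpos) -expr2 sqr_enorm -dot_mulmx.
apply: le_trans (ler_norm _) _; apply: le_trans (dot_le _ _) _.
apply: le_trans (ler_wpM2r (enorm_ge0 _) (spectral_normP _ _)) _.
by rewrite le_eqVlt; apply/orP; left; apply/eqP; ring.
Qed.

End EuclideanNorm.

Section Sequences.
Context {R : realType}.

(** Bridge between the topology of the sup norm and the Euclidean estimates, which are all made on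
    coordinates. *)
Lemma cvg_colP n (T : Type) (F : set_system T) {FF : Filter F}
    (u : T -> 'cV[R]_n) (l : 'cV[R]_n) :
  (forall i, u x i 0 @[x --> F] --> l i 0) <-> u x @[x --> F] --> l.
Proof.
split=> [h|h i]; last exact: (continuous_cvg _ (@coord_continuous R n 1 i 0 l) h).
apply/cvg_ballP => e e0.
have : \forall x \near F, forall i, ball (l i 0) e (u x i 0).
  by apply: filter_forall => i; move/cvg_ballP : (h i); exact.
apply: filterS => x hx; split => // i j; rewrite ord1; exact: hx.
Qed.

Lemma compact_box n (M : R) : compact [set x : 'cV[R]_n | forall i, `|x i 0| <= M].
Proof.
have -> : [set x : 'cV[R]_n | forall i, `|x i 0| <= M] =
    trmx @` [set v : 'rV[R]_n | forall i, `[- M, M]%classic (v ord0 i)].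
  apply/seteqP; split => [x xM|_ [v vM <-] i].
    exists x^T; rewrite ?trmxK// => i /=.
    by rewrite mxE in_itv /= -ler_norml; exact: xM.
  by have := vM i; rewrite /= in_itv /= -ler_norml mxE.
apply: continuous_compact; last first.
  apply: (@rV_compact _ n (fun=> `[- M, M]%classic)) => i; exact: segment_compact.
apply: continuous_subspaceT => v.
apply: (proj1 (@cvg_colP _ _ (nbhs v) _ _ _)) => i.
have -> : (fun x : 'rV[R]_n => x^T i 0) = (fun x => x 0 i).
  by apply/funext => x; rewrite mxE.
by rewrite mxE; exact: (@coord_continuous R 1 n 0 i v).
Qed.

(** The extraction h need not be increasing: k <= h k already makes every limit along the full
    sequence a limit along h. *)
Lemma bounded_cvg_subseq n (M : R) (u : nat -> 'cV[R]_n) :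
  (forall k i, `|u k i 0| <= M) ->
  exists (l : 'cV[R]_n) (h : nat -> nat),
    (forall k, (k <= h k)%N) /\ (u \o h) @ \oo --> l.
Proof.
move=> uM.
have [l [_ cl]] : [set x : 'cV[R]_n | forall i, `|x i 0| <= M] `&`
    cluster (u @ \oo) !=set0.
  by apply: compact_box; exists 0%N => // k _; exact: uM.
have hex k : {m : nat | (k <= m)%N /\ ball l k.+1%:R^-1 (u m)}.
  apply: cid.
  have /cl : (u @ \oo) (u @` [set m | (k <= m)%N]).
    by exists k => // m /= km; exists m.
  move=> /(_ (ball l k.+1%:R^-1)) [|_ [[m km <-] bm]].
    by apply: nbhsx_ballx; rewrite invr_gt0.
  by exists m.
exists l, (fun k => sval (hex k)); split => [k|]; first by case: (hex k) => m [].
apply/cvg_ballP => e e0; near=> k.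
apply: (@le_ball _ _ _ k.+1%:R^-1); last by rewrite /=; case: (hex k) => m [].
rewrite invf_ple ?posrE//.
near: k; exists (Num.truncn e^-1) => // k /= ek.
by rewrite ltW// (lt_le_trans (Num.Theory.truncnS_gt _))// ler_nat ltnS.
Unshelve. all: by end_near.
Qed.

Lemma cvg_subseq (T : topologicalType) (u : nat -> T) (l : T) (h : nat -> nat) :
  (forall k, (k <= h k)%N) -> u @ \oo --> l -> (u \o h) @ \oo --> l.
Proof.
move=> hk ul A /ul [N _ NA]; exists N => // k /= Nk.
exact/NA/(leq_trans Nk).
Qed.

Lemma cvg_sub0P n T (F : set_system T) {FF : Filter F}
    (u : T -> 'cV[R]_n) l :
  (u t - l) @[t --> F] --> (0 : 'cV[R]_n) <-> u @ F --> l.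
Proof.
split=> ul; last by rewrite -(subrr l); apply: cvgB => //; exact: cvg_cst.
have -> : u = (fun t => u t - l) \+ (fun=> l).
  by apply/funext => t /=; rewrite subrK.
by rewrite -[X in _ --> X]add0r; apply: cvgD => //; exact: cvg_cst.
Qed.

Lemma continuous_wdot n (w : 'I_n -> R) T (F : set_system T) {FF : Filter F}
    (x y : T -> 'cV[R]_n) a b :
  x @ F --> a -> y @ F --> b -> wdot w (x t) (y t) @[t --> F] --> wdot w a b.
Proof.
move=> /cvg_colP xa /cvg_colP yb.
rewrite /wdot; apply: cvg_big => [|i _]; first exact: add_continuous.
apply: cvgMl_tmp; by apply: cvgM; [exact: xa|exact: yb].
Qed.

Lemma wdot_cvg0 n (w : 'I_n -> R) T (F : set_system T) {FF : Filter F}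
    (x : T -> 'cV[R]_n) : (forall i, 0 < w i) ->
  wdot w (x t) (x t) @[t --> F] --> 0 -> x @ F --> (0 : 'cV[R]_n).
Proof.
move=> w0 wx; apply/cvg_colP => i; rewrite mxE; apply: (@norm_cvg0 R R^o _ F FF).
have sq : Num.sqrt ((w i)^-1 * wdot w (x t) (x t)) @[t --> F] --> 0.
  rewrite -[X in _ --> X]sqrtr0 -(mulr0 (w i)^-1); apply: continuous_cvg.
    exact: sqrt_continuous.
  exact: cvgMl_tmp.
apply: (@squeeze_cvgr _ _ _ R (fun=> 0) _ (fun t => `|x t i 0|) _ 0 (cvg_cst _) sq).
near=> t; rewrite normr_ge0 /= -sqrtr_sqr ler_wsqrtr//.
exact: wdot_coord.
Unshelve. all: by end_near.
Qed.

Lemma lipschitz_cvg n (ell : R) (F : 'cV[R]_n -> 'cV[R]_n)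
    T (G : set_system T) {FG : Filter G} (u : T -> 'cV[R]_n) l :
  0 <= ell -> lipschitz_with ell F -> u @ G --> l -> F (u t) @[t --> G] --> F l.
Proof.
move=> ell0 F_lip ul; apply/cvg_sub0P.
apply: (@wdot_cvg0 _ (fun=> 1)) => //.
have ul0 : wdot (fun=> 1) (u t - l) (u t - l) @[t --> G] --> 0.
  rewrite -(wdot0l (fun=> 1) (0 : 'cV[R]_n)).
  by apply: continuous_wdot; apply/cvg_sub0P.
have ul1 : ell ^+ 2 * wdot (fun=> 1) (u t - l) (u t - l) @[t --> G] --> 0.
  by rewrite -(mulr0 (ell ^+ 2)); exact: cvgMl_tmp.
apply: (squeeze_cvgr _ (cvg_cst 0) ul1).
near=> t; rewrite wdot_ge0//= -!dotE -!sqr_enorm -exprMn.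
by rewrite ler_pXn2r ?nnegrE ?mulr_ge0 ?enorm_ge0//; exact: F_lip.
Unshelve. all: by end_near. Qed.

End Sequences.

(** * The inertial forward-backward-forward iteration *)

Section InertialCoefficients.
Context {R : realType}.
Implicit Types a al kap s r x : R.

(** The part of the denominator of rho_k that depends on alpha_k. Its bounds 7/8 and 2 keep rho_k
    away from zero and infinity. *)
Definition relax_den al : R := 2 * al ^+ 2 - al + 1.

Lemma relax_den_ge al : 7 / 8 <= relax_den al.
Proof.
have : 0 <= (al - 1 / 4) ^+ 2 by exact: sqr_ge0.
rewrite /relax_den; lra.
Qed.

Lemma relax_den_le al : 0 <= al <= 1 -> relax_den al <= 2.
Proof. rewrite /relax_den => /andP[a0 a1]; nra. Qed.

Lemma inertia_poly a al : 0 <= a <= 1 ->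
  1 / 4 <= 2 * relax_den al - 3 / 2 * ((1 + a ^+ 2) * (1 - a) + al * a * (1 + a)).
Proof.
move=> /andP[a0 a1]; rewrite /relax_den.
(* Completing the square in al, sixteen times the right-hand side of the goal is the square in [hs]
   plus 4 plus a times this cubic. *)
have h : 0 <= 18 - (129 / 4) * a + (39 / 2) * a ^+ 2 - (9 / 4) * a ^+ 3.
  have h2 : 0 <= (a - 4 / 5) ^+ 2 by exact: sqr_ge0.
  have h3 : 0 <= a ^+ 2 * (1 - a) by rewrite mulr_ge0 ?sqr_ge0 ?subr_ge0.
  nra.
have hs : 0 <= (8 * al - (2 + 3 / 2 * a * (1 + a))) ^+ 2 by exact: sqr_ge0.
have ha : 0 <= a * (18 - (129 / 4) * a + (39 / 2) * a ^+ 2 - (9 / 4) * a ^+ 3).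
  exact: mulr_ge0.
nra.
Qed.

(* The left-hand side is concave in s, so only s = 0 and s = a / (1 - a)
   matter. *)
Lemma inertia_coeff a al kap s sb r :
  0 < a < 1 -> 0 < al <= a -> 0 <= kap <= 3 / 2 ->
  sb = a / (1 - a) -> 0 <= s <= sb ->
  r = kap * (1 - a) ^+ 2 / relax_den al ->
  1 / 8 <= 2 * (1 + s)
    - r * (1 + 2 * s * (1 + sb) + al / a * s ^+ 2 * (1 + 2 * sb)).
Proof.
move=> /andP[a0 a1] /andP[al0 ala] /andP[k0 k1] sbE /andP[s0 ssb] rE.
have d0 : 0 < 1 - a by lra.
have g78 := relax_den_ge al.
have g2 : relax_den al <= 2 by apply: relax_den_le; lra.
have g0 : 0 < relax_den al by lra.
have sb0 : 0 < sb by rewrite sbE divr_gt0.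
have r0 : 0 <= r by rewrite rE divr_ge0 ?mulr_ge0 ?sqr_ge0// ltW.
have r1 : r <= 12 / 7.
  rewrite rE ler_pdivrMr//.
  have : (1 - a) ^+ 2 <= 1 by rewrite expr_le1//; lra.
  have := sqr_ge0 (1 - a); nra.
(* The endpoint s = sb: the numerator is at least 1/4 by [inertia_poly] and kap <= 3/2, the
   denominator at most 2. *)
have hb : 1 / 8 <= 2 * (1 + sb)
    - r * (1 + 2 * sb * (1 + sb) + al / a * sb ^+ 2 * (1 + 2 * sb)).
  have -> : 2 * (1 + sb)
    - r * (1 + 2 * sb * (1 + sb) + al / a * sb ^+ 2 * (1 + 2 * sb)) =
    (2 * relax_den al - kap * ((1 + a ^+ 2) * (1 - a) + al * a * (1 + a)))
     / (relax_den al * (1 - a)).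
    by rewrite rE sbE; field; rewrite ?gt_eqF //=; lra.
  rewrite ler_pdivlMr ?mulr_gt0//.
  have := @inertia_poly a al; rewrite ltW//= ltW// => /(_ isT) hp.
  have hq : 0 <= (1 + a ^+ 2) * (1 - a) + al * a * (1 + a).
    have := sqr_ge0 a; nra.
  nra.
have t0 : 0 <= s / sb by rewrite divr_ge0// ltW.
have t1 : s / sb <= 1 by rewrite ler_pdivrMr// mul1r.
have sE : s = s / sb * sb by rewrite divfK// gt_eqF.
set t := s / sb in t0 t1 sE.
have q0 : 0 <= r * (al / a * (1 + 2 * sb)).
  rewrite mulr_ge0// mulr_ge0 ?divr_ge0//; lra.
have tt : t ^+ 2 <= t by rewrite expr2; nra.
(* Concavity made explicit: the value at s = t sb is the interpolation of the endpoint values plus a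
   nonnegative multiple of t - t^2. At s = 0 the value 2 - r is at least 2/7. *)
have -> : 2 * (1 + s)
    - r * (1 + 2 * s * (1 + sb) + al / a * s ^+ 2 * (1 + 2 * sb)) =
   (1 - t) * (2 - r) + t * (2 * (1 + sb)
    - r * (1 + 2 * sb * (1 + sb) + al / a * sb ^+ 2 * (1 + 2 * sb)))
   + (t - t ^+ 2) * sb ^+ 2 * (r * (al / a * (1 + 2 * sb))).
  by rewrite sE; ring.
have : 0 <= (t - t ^+ 2) * sb ^+ 2 * (r * (al / a * (1 + 2 * sb))).
  by rewrite mulr_ge0// mulr_ge0 ?sqr_ge0// subr_ge0.
nra.
Qed.

End InertialCoefficients.

Section InertialWeights.
Context {R : realType} (a : R) (al : nat -> R).
Hypotheses (a01 : 0 < a < 1) (ala : forall k, 0 < al k <= a).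

Fixpoint inertia_approx (n k : nat) : R :=
  if n is n'.+1 then al k * (1 + inertia_approx n' k.+1) else 0.

(* The bounded solution of the backward recursion s_k = al_k (1 + s_{k+1}) is the
   limit of its truncations; with these weights the energy estimate needs no
   monotonicity of the inertia. *)
Lemma inertia_weights : exists s : nat -> R,
  (forall k, 0 <= s k <= a / (1 - a)) /\ (forall k, s k = al k * (1 + s k.+1)).
Proof.
have /andP[a0 a1] := a01.
have bnd n : forall k, 0 <= inertia_approx n k <= a / (1 - a).
  elim: n => [|n ih] k /=; first by rewrite lexx divr_ge0//; lra.
  have /andP[i0 i1] := ih k.+1; have /andP[l0 l1] := ala k.
  rewrite mulr_ge0 ?addr_ge0//; last exact: ltW.
  (* The bound is the fixed point of x -> a (1 + x), hence invariant under the recursion. *)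
  have -> : a / (1 - a) = a * (1 + a / (1 - a)) by field; lra.
  by rewrite ler_pM ?addr_ge0 ?lerD2l// ltW.
have nd n : forall k, inertia_approx n k <= inertia_approx n.+1 k.
  elim: n => [|n ih] k; first by have /andP[] := bnd 1%N k.
  by rewrite /= ler_wpM2l ?lerD2l//; have /andP[/ltW] := ala k.
have cv k : cvgn (inertia_approx^~ k).
  apply: nondecreasing_is_cvgn; first by apply/nondecreasing_seqP => n; exact: nd.
  by exists (a / (1 - a)) => _ [n _ <-]; have /andP[] := bnd n k.
exists (fun k => limn (inertia_approx^~ k)); split => k.
  apply/andP; split.
    by apply: limr_ge => //; apply: nearW => n; have /andP[] := bnd n k.
  by apply: limr_le => //; apply: nearW => n; have /andP[] := bnd n k.
apply/cvg_lim => //; rewrite -cvg_shiftS /=.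
by apply: cvgMl_tmp; apply: cvgD; [exact: cvg_cst|exact: cv].
Qed.

End InertialWeights.

(** * Real sequences: perturbed decrease and geometric forgetting *)

Section QuasiFejer.
Context {R : realType}.

Lemma cvgn_bounded (u : nat -> R) : cvgn u -> exists M, forall k, `|u k| <= M.
Proof. by move=> /cvg_has_ub[M hM]; exists M => k; apply: hM; exists k. Qed.

Lemma nonneg_series_le (u : nat -> R) (M : R) : (forall k, 0 <= u k) ->
  (forall k, series u k <= M) -> cvgn (series u).
Proof.
move=> u0 uM; apply: nondecreasing_is_cvgn.
  by apply: nondecreasing_series => k _ _; exact: u0.
by exists M => _ [k _ <-].
Qed.

(** The perturbations need no sign: adding their partial sums to E gives a nonincreasing sequence
    that is bounded below, because convergent series have bounded partial sums. *)
Lemma quasi_fejer (E h b n : nat -> R) (c : R) : 0 < c ->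
  (forall k, 0 <= E k) -> (forall k, 0 <= h k) ->
  (forall k, E k.+1 <= E k - n k - c * h k + b k) ->
  cvgn (series b) -> cvgn (series n) ->
  cvgn E /\ cvgn (series h).
Proof.
move=> c0 E0 h0 step cb cn.
have [Mb hMb] := cvgn_bounded cb; have [Mn hMn] := cvgn_bounded cn.
pose S := fun k => E k + c * series h k - series b k + series n k.
have Sdec : nonincreasing_seq S.
  apply/nonincreasing_seqP => k; rewrite /S !seriesSr.
  have := step k; lra.
have h0s k : 0 <= series h k.
  by rewrite seriesEnat /=; apply: sumr_ge0 => i _; exact: h0.
have bS k : - Mb - Mn <= S k.
  have := hMb k; have := hMn k; rewrite !ler_norml => /andP[? ?] /andP[? ?].
  have := E0 k; have := mulr_ge0 (ltW c0) (h0s k); rewrite /S; lra.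
have cS : cvgn S.
  by apply: nonincreasing_is_cvgn => //; exists (- Mb - Mn) => _ [k _ <-].
have ch : cvgn (series h).
  apply: (@nonneg_series_le _ (c^-1 * (S 0%N + Mb + Mn))) => // k.
  rewrite ler_pdivlMl//.
  have /= := Sdec 0%N k isT.
  have := hMb k; have := hMn k; rewrite !ler_norml => /andP[? ?] /andP[? ?].
  have := E0 k; rewrite {1}/S; lra.
split => //.
have -> : E = S - c *: series h + series b - series n.
  apply/funext => k; rewrite /S.
  change (E k = E k + c * series h k - series b k + series n k
    - c * series h k + series b k - series n k); ring.
by apply: is_cvgB => //; apply: is_cvgD => //; apply: is_cvgB => //; exact: is_cvgZl_tmp.
Qed.

(** Meant for the velocities, where |v_{k+1}| <= abar |v_k| + 2 |H_k|. Once h is below (1 - a) e /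
    2, the recursion contracts towards e / 2. *)
Lemma geometric_forget (a : R) (u h : nat -> R) : 0 <= a < 1 ->
  (forall k, 0 <= u k) -> (forall k, u k.+1 <= a * u k + h k) ->
  h @ \oo --> 0 -> u @ \oo --> 0.
Proof.
move=> /andP[a0 a1] u0 uh h0.
apply/cvgr0Pnorm_le => e e0.
have d0 : 0 < 1 - a by lra.
have [N _ hN] : \forall k \near \oo, `|h k| <= (1 - a) * (e / 2).
  by move/cvgr0Pnorm_le : h0; apply; rewrite mulr_gt0 ?divr_gt0.
have ind m : u (N + m)%N <= a ^+ m * u N + e / 2.
  elim: m => [|m ih]; first by rewrite addn0 expr0; lra.
  rewrite addnS; apply: le_trans (uh _) _.
  have := hN (N + m)%N (leq_addr _ _); rewrite ler_norml => /andP[_ ?].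
  have : a * u (N + m)%N <= a * (a ^+ m * u N + e / 2) by exact: ler_wpM2l.
  rewrite exprS; lra.
have gN : (fun m => a ^+ m * u N) @ \oo --> 0.
  rewrite -(mul0r (u N)); apply: cvgMr_tmp.
  by apply: cvg_expr; rewrite ger0_norm.
have [K _ hK] : \forall k \near \oo, `|a ^+ k * u N| <= e / 2.
  by move/cvgr0Pnorm_le : gN; apply; rewrite divr_gt0.
exists (N + K)%N => // k /= Nk.
have -> : k = (N + (k - N))%N by rewrite subnKC// (leq_trans _ Nk)// leq_addr.
rewrite ger0_norm//; apply: le_trans (ind _) _.
have := hK (k - N)%N; rewrite /= leq_subRL ?(leq_trans _ Nk)// ?leq_addr//.
move=> /(_ isT); rewrite ler_norml => /andP[_]; lra.
Qed.

End QuasiFejer.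

(** * One step of the iteration in scalar form *)

Lemma wdotBB (R : realType) n (w : 'I_n -> R) x y :
  wdot w (x - y) (x - y) = wdot w x x - 2 * wdot w y x + wdot w y y.
Proof. by rewrite !wdotBl !wdotBr (wdotC w x y); ring. Qed.

Lemma cocoercive_scalar (R : realType) (L y q h e c eps : R) :
  0 <= L <= 1 / 2 -> 0 <= y -> 0 <= q -> 0 <= h -> 0 <= e -> 0 < eps ->
  q <= L * y + e -> y <= 2 * (h + e) -> - (q * y) <= c ->
  h ^+ 2 = y ^+ 2 - 2 * c + q ^+ 2 ->
  (1 - eps) * h ^+ 2 - (4 + 9 / (4 * eps)) * e ^+ 2 <= (1 + L) * (y ^+ 2 - c).
Proof.
move=> /andP[L0 L1] y0 q0 h0 e0 eps0 qLy yh cqy hE.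
have h1 : - e * (3 * (h + e) + e) <= (L * y - q) * (y + q).
  have h2 : - e * ((1 + L) * y + e) <= (L * y - q) * (y + q).
    have : 0 <= (L * y + e - q) * (y + q + e) by apply: mulr_ge0; lra.
    lra.
  apply: le_trans h2; rewrite ler_wnM2l ?oppr_le0//.
  have : L * y <= 1 / 2 * y by rewrite ler_wpM2r.
  lra.
have h3 : 0 <= (1 - L) * (c + q * y) by apply: mulr_ge0; lra.
have h4 : 0 <= (2 * eps * h - 3 * e) ^+ 2 / (4 * eps).
  by rewrite divr_ge0 ?sqr_ge0// mulr_ge0// ltW.
have h5 : (2 * eps * h - 3 * e) ^+ 2 / (4 * eps) =
    eps * h ^+ 2 - 3 * e * h + 9 / (4 * eps) * e ^+ 2.
  by field; rewrite gt_eqF.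
rewrite h5 in h4; move: (9 / (4 * eps)) h4 => z h4; lra.
Qed.

Definition energy (R : realType) n (w : 'I_n -> R) (sb s : R) x v : R :=
  wdot w x x + 2 * s * wdot w x v + 2 * s * sb * wdot w v v.

(** The difference is s (2 sb - s) |v|^2. The bound makes the energy nonnegative and later keeps the
    iterates bounded. *)
Lemma energy_ge (R : realType) n (w : 'I_n -> R) (sb s : R) x v :
  (forall i, 0 < w i) -> 0 <= s <= sb ->
  wdot w (x + s *: v) (x + s *: v) <= energy w sb s x v.
Proof.
move=> w0 /andP[s0 ssb]; rewrite /energy !wdotE (wdotC w v x).
have : 0 <= s * (2 * sb - s) * wdot w v v.
  by rewrite !mulr_ge0 ?wdot_ge0//; lra.
lra.
Qed.

(* The defect in this inequality is
   al (1 + 2 sb) / a * |a v + rho s H|^2 + al (1 + 2 s (1 + sb)) (a - al) |v|^2. *)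
Lemma energy_step (R : realType) n (w : 'I_n -> R) (a al s sb rho : R) x v v' H :
  (forall i, 0 < w i) -> 0 < a < 1 -> 0 < al <= a -> 0 <= s ->
  sb = a / (1 - a) ->
  v' = al *: v - rho *: H ->
  energy w sb s (x + v') v' <= energy w sb (al * (1 + s)) x v
    - 2 * (1 + s) * rho * wdot w H (x + al *: v)
    + rho ^+ 2 * (1 + 2 * s * (1 + sb) + al / a * s ^+ 2 * (1 + 2 * sb))
      * wdot w H H.
Proof.
move=> w0 /andP[a0 a1] /andP[l0 la] s0 sbE ->.
have sb0 : 0 < sb by rewrite sbE divr_gt0//; lra.
have h1 : 0 <= al * (1 + 2 * sb) / a
    * wdot w (a *: v + (rho * s) *: H) (a *: v + (rho * s) *: H).
  apply: mulr_ge0; last exact: wdot_ge0.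
  by apply: divr_ge0; [apply: mulr_ge0; lra | lra].
have h2 : 0 <= al * (1 + 2 * s * (1 + sb)) * (a - al) * wdot w v v.
  apply: mulr_ge0; last exact: wdot_ge0.
  apply: mulr_ge0; last lra.
  apply: mulr_ge0; first lra.
  by rewrite addr_ge0// !mulr_ge0//; lra.
rewrite -subr_ge0; apply: le_trans (addr_ge0 h1 h2) _.
rewrite le_eqVlt; apply/orP; left; apply/eqP.
rewrite /energy !wdotE (wdotC w v x) (wdotC w H x) (wdotC w H v) sbE.
by field; rewrite gt_eqF//=; lra.
Qed.

(** Here C = 1 + s_{k+1}, d = 1 - abar, r = (1 + L) rho_k, and n is the noise pairing. Of the margin
    1/8, the choice eps = d / 32 spends 2 C d / 32 <= 1/16; the other 1/16, times r / (1 + L)^2 >=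
    4/9 rmin, is the coefficient rmin / 36. *)
Lemma relaxation_scalar (R : realType) (C d r rmin Kh L hh e2 n zh yh E E' : R) :
  0 < d -> 1 <= C <= d^-1 -> 0 <= L <= 1 / 2 -> 0 < rmin <= r -> r <= 12 / 7 ->
  1 / 8 <= 2 * C - r * Kh -> 0 <= hh -> 0 <= e2 ->
  n + yh <= zh ->
  (1 - d / 32) * hh - (4 + 9 / (4 * (d / 32))) * e2 <= (1 + L) * yh ->
  E' <= E - 2 * C * (r / (1 + L)) * zh + (r / (1 + L)) ^+ 2 * Kh * hh ->
  E' <= E - 2 * C * (r / (1 + L)) * n - rmin / 36 * hh
    + 4 / d * (4 + 9 / (4 * (d / 32))) * e2.
Proof.
move=> d0 /andP[C1 Cd] /andP[L0 L1] /andP[rm0 rmr] r127 coef hh0 e20 zhE yhE EE.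
set Me := 4 + _ in yhE *.
have Me0 : 0 <= Me.
  by rewrite addr_ge0// divr_ge0// mulr_ge0// ltW// divr_gt0.
have L10 : 0 < 1 + L by lra.
set q := r / (1 + L) in EE *.
have q0 : 0 < q by rewrite divr_gt0//; lra.
have q2 : q <= 12 / 7 by rewrite ler_pdivrMr//; nra.
have Cq0 : 0 <= 2 * C * q by apply: mulr_ge0; [lra | exact: ltW].
have h1 : 2 * C * q * (n + yh) <= 2 * C * q * zh by rewrite ler_wpM2l.
pose z := (1 + L)^-1.
have z0 : 0 < z by rewrite invr_gt0.
have zL : z * (1 + L) = 1 by rewrite mulVf// gt_eqF.
have z1 : z <= 1 by have := mulr_ge0 (ltW z0) L0; lra.
have z23 : 2 / 3 <= z by have := ler_wpM2l (ltW z0) L1; lra.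
have yh1 : z * ((1 - d / 32) * hh - Me * e2) <= yh.
  by rewrite ler_pdivrMl.
have h2 : 2 * C * q * (z * ((1 - d / 32) * hh - Me * e2)) <= 2 * C * q * yh.
  by rewrite ler_wpM2l.
have qz : q = r * z by [].
have Cd1 : C * d <= 1 by rewrite -ler_pdivlMr// mul1r.
have h3 : 1 / 16 <= 2 * C * (1 - d / 32) - r * Kh by lra.
have h4 : 4 / 9 * rmin <= q * z.
  rewrite qz -mulrA.
  have : 4 / 9 <= z * z by nra.
  nra.
have h5 : rmin / 36 * hh <= q * z * (2 * C * (1 - d / 32) - r * Kh) * hh.
  rewrite ler_wpM2r//; nra.
have h6 : 2 * C * q * z * (Me * e2) <= 4 / d * (Me * e2).
  rewrite ler_wpM2r ?mulr_ge0//.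
  have qz2 : q * z <= 2 by nra.
  have : C * (q * z) <= d^-1 * 2.
    by apply: ler_pM => //; first [lra|by apply: mulr_ge0; exact: ltW].
  lra.
have h7 : q ^+ 2 * Kh * hh = q * z * (r * Kh) * hh by rewrite qz; ring.
rewrite h7 in EE; lra.
Qed.

Lemma cvg_sqr0 (R : realType) (u : nat -> R) :
  u @ \oo --> 0 -> (fun k => u k ^+ 2) @ \oo --> 0.
Proof.
move=> u0; rewrite -(mulr0 (0 : R)).
have -> : (fun k => u k ^+ 2) = u \* u by apply/funext => k; rewrite expr2.
exact: cvgM.
Qed.

(** * Convergence along a single sample path *)

Section ForwardBackwardForward.
Context {R : realType} {n : nat} (w : 'I_n -> R) (lmin ell : R).
Context (V : 'cV[R]_n -> 'cV[R]_n) (T : 'cV[R]_n -> set 'cV[R]_n).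
Hypotheses (lmin0 : 0 < lmin) (lminw : forall i, lmin <= w i).
Hypotheses (V_mono : monotone_map V) (ell0 : 0 <= ell)
  (V_lip : lipschitz_with ell V).
Hypothesis T_mono : forall y y' a a', T y a -> T y' a' ->
  0 <= dot (a - a') (y - y').
Hypothesis T_closed : forall (y a : nat -> 'cV[R]_n) y0 a0,
  (forall k, T (y k) (a k)) -> y @ \oo --> y0 -> a @ \oo --> a0 -> T y0 a0.

Let L := ell / lmin.
Hypothesis L_lt : L <= 1 / 2.

Let w0 i : 0 < w i. Proof. exact: lt_le_trans (lminw i). Qed.
Let L0 : 0 <= L. Proof. by rewrite divr_ge0// ltW. Qed.

(** This is Psi^-1 x. Pairing it in the weighted product gives the Euclidean product, in which V and
    T are monotone. *)
Definition unweight (x : 'cV[R]_n) : 'cV[R]_n := \col_i ((w i)^-1 * x i 0).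

Lemma unweightD x y : unweight (x + y) = unweight x + unweight y.
Proof. by apply/colP => i; rewrite !mxE mulrDr. Qed.

Lemma unweightN x : unweight (- x) = - unweight x.
Proof. by apply/colP => i; rewrite !mxE mulrN. Qed.

Lemma wdot_unweight x y : wdot w (unweight x) y = dot x y.
Proof.
by rewrite wdot_shift dotE; apply: eq_bigr => i _; rewrite mulfV// gt_eqF.
Qed.

Lemma wdot_unweight_le x : wdot w (unweight x) (unweight x) <= lmin^-1 * dot x x.
Proof.
rewrite wdot_unweight dotC /dot mulr_sumr; apply: ler_sum => i _.
rewrite mxE -mulrA; apply: ler_wpM2r; first by rewrite -expr2 sqr_ge0.
by rewrite lef_pV2 ?posrE.
Qed.

Lemma dot_le_wdot x : dot x x <= lmin^-1 * wdot w x x.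
Proof.
rewrite dotE /wdot mulr_sumr; apply: ler_sum => i _.
rewrite [leRHS]mulrA; apply: ler_wpM2r; first by rewrite -expr2 sqr_ge0.
by rewrite ler_pdivlMl// mulr1.
Qed.

(** Passing between the Euclidean and the weighted norm costs 1 / sqrt(lmin) on either side, hence L
    = ell / lmin. *)
Lemma wnorm_unweight_V x y :
  wnorm w (unweight (V x - V y)) <= L * wnorm w (x - y).
Proof.
rewrite -(@ler_pXn2r _ 2)//= ?nnegrE ?mulr_ge0 ?wnorm_ge0//.
rewrite exprMn !(sqr_wnorm w0); apply: le_trans (wdot_unweight_le _) _.
have : enorm (V x - V y) ^+ 2 <= (ell * enorm (x - y)) ^+ 2.
  by rewrite ler_pXn2r ?nnegrE ?mulr_ge0 ?enorm_ge0.
rewrite exprMn !sqr_enorm => h1.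
have -> : L ^+ 2 * wdot w (x - y) (x - y) =
    lmin^-1 * (ell ^+ 2 * (lmin^-1 * wdot w (x - y) (x - y))).
  by rewrite /L; field; rewrite gt_eqF.
apply: ler_wpM2l; first by rewrite invr_ge0 ltW.
apply: le_trans h1 _; apply: ler_wpM2l; first exact: sqr_ge0.
exact: dot_le_wdot.
by rewrite invr_ge0 ltW.
Qed.

Definition zero_of (p : 'cV[R]_n) : Prop := T p (- V p).

Section OneStep.
Variables Z Y A B a p : 'cV[R]_n.
Hypotheses (Ya : T Y a) (ZY : Z - unweight A = Y + unweight a) (p0 : zero_of p).
Let H := Z - (Y - unweight (B - A)).
Let W := B - V Y.
Let e := wnorm w (unweight ((A - V Z) - W)).

(** The inclusion for Y rewrites H as Psi^-1 (a + B): the sample A drops out, and monotonicity of V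
    and T leaves only the error of B. *)
Lemma fbf_monotone : dot W (Y - p) <= wdot w H (Y - p).
Proof.
have -> : H = unweight (a + B).
  rewrite /H !unweightD unweightN.
  have -> : Z = Y + unweight a + unweight A by rewrite -ZY subrK.
  by apply/colP => i; rewrite !mxE; ring.
rewrite wdot_unweight.
have := T_mono Ya p0; have := V_mono Y p.
rewrite /W !dotLE; lra.
Qed.

(** H differs from Z - Y by a term of norm at most L |Z - Y| + e, and L <= 1/2 allows its
    absorption; this is the factor 2. *)
Lemma fbf_residual : wnorm w (Z - Y) <= 2 * (wnorm w H + e).
Proof.
have HE : Z - Y = H + unweight (V Z - V Y) + unweight ((A - V Z) - W).
  rewrite /H /W -!addrA -!unweightD.
  by apply/colP => i; rewrite !mxE; ring.
have h1 : wnorm w (Z - Y) <= wnorm w H + L * wnorm w (Z - Y) + e.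
  rewrite {1}HE; apply: le_trans (ler_wnormD w0 _ _) _; rewrite lerD2r.
  apply: le_trans (ler_wnormD w0 _ _) _; rewrite lerD2l.
  exact: wnorm_unweight_V.
have : L * wnorm w (Z - Y) <= 1 / 2 * wnorm w (Z - Y).
  by rewrite ler_wpM2r// wnorm_ge0.
lra.
Qed.

Lemma fbf_cocoercive (eps : R) : 0 < eps ->
  (1 - eps) * wdot w H H - (4 + 9 / (4 * eps)) * e ^+ 2
  <= (1 + L) * wdot w H (Z - Y).
Proof.
move=> eps0.
pose Q := unweight (A - B).
have HE : H = (Z - Y) - Q.
  by rewrite /H /Q; apply/colP => i; rewrite !mxE; ring.
have q1 : wnorm w Q <= L * wnorm w (Z - Y) + e.
  have -> : Q = unweight (V Z - V Y) + unweight ((A - V Z) - W).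
    by rewrite -unweightD; congr unweight; rewrite /W; apply/colP => i; rewrite !mxE; ring.
  apply: le_trans (ler_wnormD w0 _ _) _; rewrite lerD2r.
  exact: wnorm_unweight_V.
have Qy := wdot_le w0 Q (Z - Y).
have yH := fbf_residual.
have := sqr_wnorm w0 H; have := sqr_wnorm w0 Q; have := sqr_wnorm w0 (Z - Y).
have e0 : 0 <= e by exact: wnorm_ge0.
have y0 := wnorm_ge0 w (Z - Y); have H0 := wnorm_ge0 w H.
have q0 := wnorm_ge0 w Q.
have -> : wdot w H (Z - Y) = wdot w (Z - Y) (Z - Y) - wdot w Q (Z - Y).
  by rewrite {1}HE wdotBl.
have -> : wdot w H H = wdot w (Z - Y) (Z - Y) - 2 * wdot w Q (Z - Y) + wdot w Q Q.
  by rewrite HE wdotBB.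
move: Qy; rewrite ler_norml => /andP[Qy _].
set y := wnorm w (Z - Y) in q1 Qy yH y0 *; set q := wnorm w Q in q1 Qy q0 *.
set hh := wnorm w H in yH H0 *.
move=> yy qq HH.
have HH2 : hh ^+ 2 = y ^+ 2 - 2 * wdot w Q (Z - Y) + q ^+ 2.
  by rewrite HH yy qq.
rewrite -yy -qq -HH2; apply: (cocoercive_scalar _ y0 q0 H0 e0 eps0 q1 yH Qy HH2).
by rewrite L0.
Qed.

End OneStep.

Section Iteration.
Variables (kap a : R) (al s : nat -> R) (X Y Z A B : nat -> 'cV[R]_n).
Hypotheses (a01 : 0 < a < 1) (ala : forall k, 0 < al k <= a).
Hypotheses (kap01 : 0 < kap <= 3 / 2).
Hypotheses (s_bnd : forall k, 0 <= s k <= a / (1 - a))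
  (s_rec : forall k, s k = al k * (1 + s k.+1)).
Let r k := kap * (1 - a) ^+ 2 / relax_den (al k).
Let rho k := r k / (1 + L).
Hypothesis Zk : forall k, Z k = X k + al k *: (X k - X k.-1).
Hypothesis Yk : forall k, exists2 t, T (Y k) t &
  Z k - unweight (A k) = Y k + unweight t.
Hypothesis Xk : forall k, X k.+1 =
  (1 - rho k) *: Z k + rho k *: (Y k - unweight (B k - A k)).
Let U k := A k - V (Z k).
Let W k := B k - V (Y k).
Hypotheses (U_sum : cvgn (series (fun k => dot (U k) (U k))))
  (W_sum : cvgn (series (fun k => dot (W k) (W k)))).
Hypothesis zero_ex : exists p, zero_of p.
Hypothesis noise_sum : forall p, zero_of p ->
  cvgn (series (fun k => 2 * (1 + s k.+1) * rho k * dot (W k) (Y k - p))).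

Let sb := a / (1 - a).
Let H k := Z k - (Y k - unweight (B k - A k)).
Let v k := X k - X k.-1.
Let E p k := energy w sb (s k) (X k - p) (v k).
Let e2 k := wdot w (unweight (U k - W k)) (unweight (U k - W k)).

Lemma fbf_energy_decrease p k : zero_of p ->
  E p k.+1 <= E p k - 2 * (1 + s k.+1) * rho k * dot (W k) (Y k - p)
    - kap * (1 - a) ^+ 2 / 2 / 36 * wdot w (H k) (H k)
    + 4 / (1 - a) * (4 + 9 / (4 * ((1 - a) / 32))) * e2 k.
Proof.
move=> p0.
have /andP[a0 a1] := a01; have /andP[k0 k1] := kap01.
have /andP[l0 la] := ala k; have /andP[s0 s1] := s_bnd k.+1.
have d0 : 0 < 1 - a by lra.
have g78 := relax_den_ge (al k).
have g2 : relax_den (al k) <= 2 by apply: relax_den_le; lra.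
have g0 : 0 < relax_den (al k) by lra.
have n0 : 0 < kap * (1 - a) ^+ 2 by rewrite mulr_gt0// exprn_gt0.
have [t Tt tE] := Yk k.
have X1E : X k.+1 - p = (X k - p) + v k.+1.
  by rewrite /v /=; apply/colP => i; rewrite !mxE; ring.
have vE : v k.+1 = al k *: v k - rho k *: H k.
  by rewrite /v /= Xk /H Zk; apply/colP => i; rewrite !mxE; ring.
have ZE : Z k - p = (X k - p) + al k *: v k.
  by rewrite Zk /v; apply/colP => i; rewrite !mxE; ring.
have hst := energy_step (X k - p) w0 a01 (ala k) s0 (erefl sb) vE.
rewrite -X1E -ZE -s_rec in hst.
(* [rmin] is the value of r at the upper bound 2 of [relax_den], and 1 + s k.+1 is at most 1 + a /
   (1 - a) = 1 / (1 - a). *)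
apply: (relaxation_scalar (zh := wdot w (H k) (Z k - p))
   (yh := wdot w (H k) (Z k - Y k)) (rmin := kap * (1 - a) ^+ 2 / 2)
   d0 _ _ _ _ _ _ _ _ _ hst).
- apply/andP; split; first lra.
  have -> : (1 - a)^-1 = 1 + a / (1 - a) by field; lra.
  by rewrite lerD2l.
- by rewrite L0.
- apply/andP; split; first by rewrite divr_gt0.
  by rewrite /r ler_pM2l// lef_pV2 ?posrE.
- rewrite /r ler_pdivrMr//.
  have : (1 - a) ^+ 2 <= 1 by rewrite expr_le1//; lra.
  have := sqr_ge0 (1 - a); nra.
- by apply: (@inertia_coeff _ a (al k) kap (s k.+1) sb (r k)) => //; lra.
- exact: wdot_ge0.
- exact: wdot_ge0.
- have -> : Z k - p = (Y k - p) + (Z k - Y k).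
    by apply/colP => i; rewrite !mxE; ring.
  rewrite [leRHS]wdotDr lerD2r; exact: fbf_monotone Tt tE p0.
- have := @fbf_cocoercive (Z k) (Y k) (A k) (B k) ((1 - a) / 32).
  by rewrite sqr_wnorm//; apply; rewrite divr_gt0.
Qed.

Lemma cvg_series_dot0 (u : nat -> 'cV[R]_n) :
  cvgn (series (fun k => dot (u k) (u k))) -> u @ \oo --> (0 : 'cV[R]_n).
Proof.
move=> /cvg_series_cvg_0; under eq_cvg do rewrite dotE.
exact: wdot_cvg0.
Qed.

Let c := kap * (1 - a) ^+ 2 / 2 / 36.
Let c0 : 0 < c.
Proof.
have /andP[a0 a1] := a01; have /andP[k0 k1] := kap01.
by rewrite !divr_gt0// mulr_gt0// exprn_gt0// subr_gt0.
Qed.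

Let e2_sum : cvgn (series e2).
Proof.
have : cvgn (series (lmin^-1 *: (2 *: (fun k => dot (U k) (U k)) +
    2 *: (fun k => dot (W k) (W k))))).
  by apply: is_cvg_seriesZ; apply: is_cvg_seriesD; exact: is_cvg_seriesZ.
apply: series_le_cvg => k.
- exact: wdot_ge0.
- by rewrite mulr_ge0 ?invr_ge0 ?(ltW lmin0)// addr_ge0// mulr_ge0// dot_ge0.
- apply: le_trans (wdot_unweight_le _) _; apply: ler_wpM2l.
    by rewrite invr_ge0 ltW.
  exact: dotB_le.
Qed.

Let energy_cvg p : zero_of p ->
  cvgn (E p) /\ cvgn (series (fun k => wdot w (H k) (H k))).
Proof.
move=> p0; have /andP[a0 a1] := a01.
apply: (quasi_fejer c0 _ _ _ _ (noise_sum p0)) => [k|k|k|].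
- apply: le_trans (energy_ge _ _ w0 (s_bnd k)); exact: wdot_ge0.
- exact: wdot_ge0.
- exact: (fbf_energy_decrease k p0).
- set K := 4 / (1 - a) * _; change (cvgn (series (K *: e2))).
  exact: is_cvg_seriesZ e2_sum.
Qed.

Let H_cvg0 : (fun k => wnorm w (H k)) @ \oo --> 0.
Proof.
have [p /energy_cvg[_ H_sum]] := zero_ex.
rewrite -[X in _ --> X]sqrtr0; apply: continuous_cvg; first exact: sqrt_continuous.
exact: cvg_series_cvg_0.
Qed.

Let residual_cvg0 : (fun k => Z k - Y k) @ \oo --> (0 : 'cV[R]_n).
Proof.
have ne0 : (fun k => wnorm w (unweight (U k - W k))) @ \oo --> 0.
  rewrite -[X in _ --> X]sqrtr0; apply: continuous_cvg; first exact: sqrt_continuous.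
  exact: cvg_series_cvg_0.
have b0 : (fun k => 2 * (wnorm w (H k) + wnorm w (unweight (U k - W k)))) @ \oo --> 0.
  rewrite -(mulr0 2) -[X in _ * X](addr0 0); apply: cvgMl_tmp.
  exact: cvgD.
have ny0 : (fun k => wnorm w (Z k - Y k)) @ \oo --> 0.
  apply: (squeeze_cvgr _ (cvg_cst 0) b0).
  by apply: nearW => k; rewrite wnorm_ge0 fbf_residual.
apply: (wdot_cvg0 w0); under eq_cvg do rewrite -(sqr_wnorm w0).
exact: cvg_sqr0.
Qed.

Let v_cvg0 : (fun k => wnorm w (v k)) @ \oo --> 0.
Proof.
have /andP[a0 a1] := a01; have /andP[k0 k1] := kap01.
apply: (@geometric_forget _ a _ (fun k => 2 * wnorm w (H k))) => [|k|k|].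
- by rewrite (ltW a0).
- exact: wnorm_ge0.
- have -> : v k.+1 = al k *: v k + (- rho k) *: H k.
    by rewrite /v /= Xk /H Zk; apply/colP => i; rewrite !mxE; ring.
  apply: le_trans (ler_wnormD w0 _ _) _; rewrite !wnormZ//.
  have /andP[l0 la] := ala k.
  have g78 := relax_den_ge (al k).
  have r0 : 0 <= r k.
    by rewrite divr_ge0 ?mulr_ge0 ?sqr_ge0// ?(ltW k0)//; lra.
  have r2 : r k <= 2.
    rewrite /r ler_pdivrMr; last lra.
    have : (1 - a) ^+ 2 <= 1 by rewrite expr_le1//; lra.
    have := sqr_ge0 (1 - a); nra.
  apply: lerD; apply: ler_wpM2r; rewrite ?wnorm_ge0//.
    by rewrite gtr0_norm.
  have L10 : 0 < 1 + L by rewrite ltr_pwDl.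
  rewrite normrN ger0_norm; last by rewrite divr_ge0// ltW.
  by rewrite /rho ler_pdivrMr// (le_trans r2)// ler_peMr// lerDl.
- by rewrite -(mulr0 2); exact: cvgMl_tmp.
Qed.

(** The energy exceeds the squared distance by terms D that contain the velocity. They vanish in the
    limit once X k - p is bounded, which [energy_ge] yields after moving s k v k to the other
    side. *)
Let dist_cvg p : zero_of p -> cvgn (fun k => wdot w (X k - p) (X k - p)).
Proof.
move=> /energy_cvg[Ecv _].
have [M EM] := cvgn_bounded Ecv; have [Mv vM] := cvgn_bounded (cvgP _ v_cvg0).
have sb0 : 0 <= sb by have /andP[h1 h2] := s_bnd 0%N; exact: le_trans h1 h2.
have xb k : wnorm w (X k - p) <= Num.sqrt M + sb * Mv.
  have -> : X k - p = (X k - p + s k *: v k) + (- s k) *: v k.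
    by apply/colP => i; rewrite !mxE; ring.
  apply: le_trans (ler_wnormD w0 _ _) _; apply: lerD.
    apply: ler_wsqrtr; apply: le_trans (energy_ge _ _ w0 (s_bnd k)) _.
    exact: le_trans (ler_norm _) (EM k).
  have /andP[s0 s1] := s_bnd k; rewrite wnormZ// normrN ger0_norm//.
  apply: ler_pM => //; first exact: wnorm_ge0.
  exact: le_trans (ler_norm _) (vM k).
pose D k := 2 * s k * wdot w (X k - p) (v k) + 2 * s k * sb * wdot w (v k) (v k).
have bD k : `|D k| <= (2 * sb * (Num.sqrt M + sb * Mv) + 2 * sb * sb * Mv) * wnorm w (v k).
  have /andP[s0 s1] := s_bnd k.
  have vv := wnorm_ge0 w (v k); have xx := wnorm_ge0 w (X k - p).
  have vMk := le_trans (ler_norm _) (vM k).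
  rewrite mulrDl; apply: le_trans (ler_normD _ _) _; apply: lerD.
    rewrite normrM ger0_norm ?mulr_ge0// -mulrA; apply: ler_pM => //.
    - by rewrite mulr_ge0.
    - by rewrite ler_wpM2l.
    - apply: le_trans (wdot_le w0 _ _) _; exact: ler_wpM2r.
  have t0 : 0 <= 2 * s k * sb by apply: mulr_ge0 => //; exact: mulr_ge0.
  rewrite ger0_norm; last by apply: mulr_ge0 => //; exact: wdot_ge0.
  rewrite -(sqr_wnorm w0 (v k)) expr2 mulrA.
  apply: ler_wpM2r => //; apply: ler_pM => //.
  by apply: ler_wpM2r => //; rewrite ler_wpM2l.
have D0 : D @ \oo --> 0.
  apply: (@norm_cvg0 R R^o _ \oo).
  set K := 2 * sb * _ + _ in bD.
  have b0 : (fun k => K * wnorm w (v k)) @ \oo --> 0.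
    by rewrite -(mulr0 K); exact: cvgMl_tmp.
  apply: (@squeeze_cvgr _ _ _ R (fun=> 0) _ (fun k => `|D k|) _ 0 (cvg_cst _) b0).
  by apply: nearW => k; rewrite normr_ge0 bD.
have -> : (fun k => wdot w (X k - p) (X k - p)) = E p - D.
  apply/funext => k; rewrite /E /energy /D.
  change (wdot w (X k - p) (X k - p) = E p k - D k).
  by rewrite /E /energy /D; ring.
by apply: is_cvgB => //; exact: cvgP D0.
Qed.

(** Opial's argument: every cluster point is a zero, and the distance to a zero converges. *)
Theorem fbf_converges : exists2 x, zero_of x & X @ \oo --> x.
Proof.
have [p p0] := zero_ex.
have [M dM] := cvgn_bounded (dist_cvg p0).
have XM k i : `|X k i 0| <= Num.sqrt (lmin^-1 * M) + enorm p.
  have -> : X k i 0 = (X k - p) i 0 + p i 0 by rewrite !mxE subrK.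
  apply: le_trans (ler_normD _ _) _; apply: lerD; last exact: enorm_coord.
  apply: le_trans (enorm_coord _ _) _; apply: ler_wsqrtr.
  apply: le_trans (dot_le_wdot _) _; apply: ler_wpM2l.
    by rewrite invr_ge0 ltW.
  exact: le_trans (ler_norm _) (dM k).
have [l [h [hk Xl]]] := bounded_cvg_subseq XM.
have v0 : v @ \oo --> (0 : 'cV[R]_n).
  apply: (wdot_cvg0 w0); under eq_cvg do rewrite -(sqr_wnorm w0).
  exact: cvg_sqr0.
have ZX0 : (fun k => Z k - X k) @ \oo --> (0 : 'cV[R]_n).
  apply/cvg_colP => i; rewrite mxE; apply: (@norm_cvg0 R R^o _ \oo).
  have /cvg_norm : (fun k => v k i 0) @ \oo --> 0.
    by move/cvg_colP : v0 => /(_ i); rewrite mxE.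
  rewrite normr0 => nv.
  apply: (@squeeze_cvgr _ _ _ R (fun=> 0) _ _ _ 0 (cvg_cst _) nv).
  apply: nearW => k; rewrite normr_ge0 /= Zk addrC addKr mxE normrM.
  have /andP[l0 la] := ala k; have /andP[a0 a1] := a01.
  by rewrite ler_piMl ?normr_ge0// gtr0_norm// (le_trans la)// ltW.
have Zl : (Z \o h) @ \oo --> l.
  have -> : Z \o h = ((fun k => Z k - X k) \o h) \+ (X \o h).
    by apply/funext => k /=; rewrite subrK.
  by rewrite -[l]add0r; apply: cvgD => //; exact: cvg_subseq.
have Yl : (Y \o h) @ \oo --> l.
  have -> : Y \o h = (Z \o h) \- ((fun k => Z k - Y k) \o h).
    by apply/funext => k /=; rewrite subKr.
  by rewrite -[l]subr0; apply: cvgB => //; exact: cvg_subseq.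
have Ul : (A \o h) @ \oo --> V l.
  have -> : A \o h = (U \o h) \+ (V \o (Z \o h)).
    by apply/funext => k /=; rewrite /U subrK.
  rewrite -[V l]add0r; apply: cvgD; last exact: (lipschitz_cvg ell0 V_lip Zl).
  by apply: (cvg_subseq hk); exact: cvg_series_dot0.
have l0 : zero_of l.
  (* The element of T (Y k) that the resolvent provides, solved for explicitly so that it has the
     visible limit - V l. *)
  pose t k := \col_i (w i * (Z k - Y k) i 0) - A k.
  apply: (@T_closed (Y \o h) (t \o h)) => //.
    move=> k /=; have [b Tb ZY] := Yk (h k).
    suff -> : t (h k) = b by [].
    rewrite /t.
    have -> : Z (h k) = Y (h k) + unweight b + unweight (A (h k)).
      by rewrite -ZY subrK.
    apply/colP => i; rewrite !mxE.
    by field; rewrite gt_eqF.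
  have -> : t \o h = (fun k => \col_i (w i * (Z (h k) - Y (h k)) i 0)) \- (A \o h) by [].
  rewrite -[- V l]add0r; apply: cvgB => //.
  apply/cvg_colP => i; rewrite mxE.
  have q0 : (fun k => (Z (h k) - Y (h k)) i 0) @ \oo --> 0.
    by have /cvg_colP/(_ i) := cvg_subseq hk residual_cvg0; rewrite mxE.
  have q1 : (fun k => w i * (Z (h k) - Y (h k)) i 0) @ \oo --> 0.
    by rewrite -(mulr0 (w i)); exact: cvgMl_tmp.
  by under eq_cvg do rewrite mxE; exact: q1.
(* The zero p is now the cluster point itself: the distance to it converges along the whole sequence
   and tends to 0 along h. *)
exists l => //; apply/cvg_sub0P; apply: (wdot_cvg0 w0).
have /cvg_ex[/= g gl] := dist_cvg l0.
have g1 := cvg_subseq hk gl.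
have g2 : (fun k => wdot w (X k - l) (X k - l)) \o h @ \oo --> 0.
  rewrite -(wdot0l w (0 : 'cV[R]_n)).
  by apply: continuous_wdot; apply/cvg_sub0P.
by rewrite -(cvg_unique _ g1 g2).
Qed.

End Iteration.

End ForwardBackwardForward.

(** * Square-integrable martingale differences *)

Section IndependentFubini.
Context {dO : measure_display} {Omega : measurableType dO} {R : realType}.
Variable P : probability Omega R.
Context {d1 d2 : measure_display} {T1 : measurableType d1} {T2 : measurableType d2}.
Variables (X1 : Omega -> T1) (X2 : Omega -> T2).
Hypotheses (mX1 : measurable_fun setT X1) (mX2 : measurable_fun setT X2).
Hypothesis indep : forall A B, measurable A -> measurable B ->
  P (X1 @^-1` A `&` X2 @^-1` B) = (P (X1 @^-1` A) * P (X2 @^-1` B))%E.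

Let f1 : {mfun Omega >-> T1} := HB.pack X1 (isMeasurableFun.Build _ _ _ _ _ mX1).
Let f2 : {mfun Omega >-> T2} := HB.pack X2 (isMeasurableFun.Build _ _ _ _ _ mX2).
Let mpair : measurable_fun setT (fun w => (X1 w, X2 w)).
Proof. exact: measurable_fun_pair. Qed.
Let f12 : {mfun Omega >-> (T1 * T2)%type} :=
  HB.pack (fun w => (X1 w, X2 w)) (isMeasurableFun.Build _ _ _ _ _ mpair).

Let m12E (A : set (T1 * T2)) : measurable A ->
  (distribution P f1 \x distribution P f2)%E A = distribution P f12 A.
Proof.
apply: (@product_measure_unique _ _ _ _ _ (distribution P f1) (distribution P f2)
  (distribution P f12)) => A1 A2 mA1 mA2.
by rewrite /distribution /pushforward/= -indep.
Qed.

Let mm (h : T1 * T2 -> \bar R) :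
  (\int[distribution P f1 \x distribution P f2]_z h z =
   \int[distribution P f12]_z h z)%E.
Proof. by apply: eq_measure_integral => A mA _; exact: m12E. Qed.

(** Freezing: the law of the pair is the product of the laws, so Tonelli allows the first argument
    to be held fixed. This transfers assumptions on the error at a fixed point to a random point
    independent of the sample. *)
Lemma ge0_integral_indep (Phi : T1 * T2 -> \bar R) :
  measurable_fun [set: (T1 * T2)%type] Phi -> (forall z, 0 <= Phi z)%E ->
  (\int[P]_w Phi (X1 w, X2 w) =
   \int[P]_w \int[P]_w' Phi (X1 w, X2 w'))%E.
Proof.
move=> mPhi Phi0.
transitivity (\int[distribution P f12]_z Phi z)%E.
  by rewrite ge0_integral_distribution.
rewrite -mm.
rewrite fubini_tonelli1// ge0_integral_distribution//=.
- apply: eq_integral => w _.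
  rewrite /fubini_F ge0_integral_distribution//.
  exact: measurableT_comp.
- exact: measurable_fun_fubini_tonelli_F.
- by move=> x; apply: integral_ge0.
Qed.

Lemma measurable_integral_indep (Phi : T1 * T2 -> \bar R) :
  measurable_fun [set: (T1 * T2)%type] Phi -> (forall z, 0 <= Phi z)%E ->
  measurable_fun setT (fun w => \int[P]_w' Phi (X1 w, X2 w'))%E.
Proof.
move=> mPhi Phi0.
have -> : (fun w => \int[P]_w' Phi (X1 w, X2 w'))%E =
    fubini_F (distribution P f2) Phi \o X1.
  apply/funext => w; rewrite /= /fubini_F ge0_integral_distribution//.
  exact: measurableT_comp.
apply: measurableT_comp => //.
exact: measurable_fun_fubini_tonelli_F.
Qed.

Lemma integral_indep (Phi : T1 * T2 -> R) :
  measurable_fun [set: (T1 * T2)%type] Phi ->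
  P.-integrable setT (fun w => (Phi (X1 w, X2 w))%:E) ->
  (forall w, P.-integrable setT (fun w' => (Phi (X1 w, X2 w'))%:E)) ->
  (forall w, \int[P]_w' (Phi (X1 w, X2 w'))%:E = 0)%E ->
  (\int[P]_w (Phi (X1 w, X2 w))%:E = 0)%E.
Proof.
move=> mPhi iPhi iPhi2 Phi0.
have mE : measurable_fun setT (EFin \o Phi) by exact/measurable_EFinP.
have i12 : (distribution P f12).-integrable setT (EFin \o Phi).
  exact: (integrable_pushforward mpair).
have ip : (distribution P f1 \x distribution P f2)%E.-integrable setT (EFin \o Phi).
  by apply/integrableP; split => //; rewrite mm; have /integrableP[] := i12.
transitivity (\int[distribution P f12]_z (EFin \o Phi) z)%E.
  by rewrite (integral_pushforward mpair).
rewrite -mm -integral12_prod_meas1//.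
(* The inner integral is known to vanish at the values of [X1] only, so the outer integral is pulled
   back to [Omega]. *)
have F0 w : fubini_F (distribution P f2) (EFin \o Phi) (X1 w) = 0%E.
  rewrite -[RHS](Phi0 w) /fubini_F integral_distribution//.
    exact: measurableT_comp.
  exact: iPhi2.
rewrite (@integral_distribution _ _ _ _ _ P f1 _ (measurable_fubini_F ip)).
  by apply: integral0_eq => w _; exact: F0.
apply: eq_integrable (integrable0 P setT) => // w _.
exact/esym/F0.
Qed.

End IndependentFubini.

Lemma measurable_ge d (T : measurableType d) (R : realType) (f : T -> R) lam :
  measurable_fun setT f -> measurable [set w | lam <= f w].
Proof.
move=> mf; have -> : [set w | lam <= f w] = setT `&` f @^-1` `[lam, +oo[%classic.
  by apply/seteqP; split => w /=; rewrite in_itv /= andbT // => -[].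
exact: mf.
Qed.

Lemma measurable_lt d (T : measurableType d) (R : realType) (f : T -> R) lam :
  measurable_fun setT f -> measurable [set w | f w < lam].
Proof.
move=> mf; have -> : [set w | f w < lam] = setT `&` f @^-1` `]-oo, lam[%classic.
  by apply/seteqP; split => w /=; rewrite in_itv // => -[].
exact: mf.
Qed.

Section MartingaleDifferences.
Context {dO : measure_display} {Omega : measurableType dO} {R : realType}.
Variable P : probability Omega R.
Implicit Types (G : nat -> set (set Omega)) (D : nat -> Omega -> R) (c : nat -> R).

Definition adapted (G : set (set Omega)) (f : Omega -> R) : Prop :=
  measurable_fun setT (f : g_sigma_algebraType G -> R).

Definition filtration G : Prop :=
  (forall k, <<s G k >> `<=` measurable) /\
  (forall j k, (j <= k)%N -> G j `<=` G k).

(* Orthogonality to the adapted functions stands for E[D_k | G_k] = 0. *)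
Definition martingale_difference G D c : Prop :=
  [/\ forall k, measurable_fun setT (D k),
      forall k, (\int[P]_w (D k w ^+ 2)%:E <= (c k)%:E)%E,
      forall j k, (j < k)%N -> adapted (G k) (D j)
    & forall k psi, adapted (G k) psi ->
        P.-integrable setT (fun w => (psi w * D k w)%:E) ->
        (\int[P]_w (psi w * D k w)%:E = 0)%E].

Lemma adapted_measurable G f : filtration G ->
  forall k, adapted (G k) f -> measurable_fun setT f.
Proof. by move=> [sG _] k af _ B mB; apply: (sG k); exact: af. Qed.

Lemma adapted_le G f j k : filtration G -> (j <= k)%N ->
  adapted (G j) f -> adapted (G k) f.
Proof.
move=> [_ mG] jk af _ B mB.
have sub : <<s G j >> `<=` <<s G k >>.
  by apply: sub_sigma_algebra2; exact: mG.
by apply: sub; exact: af.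
Qed.

Lemma sqr_integrable (f : Omega -> R) (M : R) : measurable_fun setT f ->
  (\int[P]_w (f w ^+ 2)%:E <= M%:E)%E ->
  P.-integrable setT (fun w => (f w ^+ 2)%:E).
Proof.
move=> mf fM; apply/integrableP; split.
  by apply/measurable_EFinP; exact: measurable_funX.
apply: le_lt_trans (ltry M); apply: le_trans fM.
rewrite le_eqVlt; apply/orP; left; apply/eqP.
by apply: eq_integral => w _; rewrite gee0_abs// lee_fin sqr_ge0.
Qed.

Lemma integrable_mul (f g : Omega -> R) :
  measurable_fun setT f -> measurable_fun setT g ->
  P.-integrable setT (fun w => (f w ^+ 2)%:E) ->
  P.-integrable setT (fun w => (g w ^+ 2)%:E) ->
  P.-integrable setT (fun w => (f w * g w)%:E).
Proof.
move=> mf mg fi gi.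
apply: (le_integrable _ _ _ (integrableD _ fi gi)) => //.
  by apply/measurable_EFinP; exact: measurable_funM.
move=> w _; rewrite -EFinD !abse_EFin lee_fin normrM.
rewrite [leRHS]ger0_norm ?addr_ge0 ?sqr_ge0//.
have := sqr_ge0 (`|f w| - `|g w|); have := sqr_ge0 (`|f w| + `|g w|).
rewrite -(real_normK (num_real (f w))) -(real_normK (num_real (g w))); lra.
Qed.

Section Sums.
Variables (G : nat -> set (set Omega)) (D : nat -> Omega -> R) (c : nat -> R).
Hypotheses (fG : filtration G) (md : martingale_difference G D c).

Lemma adapted_sum n k : (n <= k)%N -> adapted (G k) (fun w => \sum_(i < n) D i w).
Proof.
move=> nk; have [_ _ aD _] := md.
apply: measurable_sum => i; apply: aD; exact: leq_trans nk.
Qed.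

(** Increments are orthogonal: the partial sum is an admissible test function for the next
    difference. *)
Lemma martingale_sum_sqr n :
  (\int[P]_w ((\sum_(i < n) D i w) ^+ 2)%:E <= (\sum_(i < n) c i)%:E)%E.
Proof.
have [mD cD aD oD] := md.
elim: n => [|n ih].
  rewrite big_ord0 integral0_eq// => w _; by rewrite big_ord0 expr0n.
set S := (fun w => \sum_(i < n) D i w) in ih.
have mS : measurable_fun setT S by apply: measurable_sum.
have iS := sqr_integrable mS ih.
have iD := sqr_integrable (mD n) (cD n).
have iSD := integrable_mul mS (mD n) iS iD.
have oSD : (\int[P]_w (S w * D n w)%:E = 0)%E by apply: oD => //; exact: adapted_sum.
have -> : (\int[P]_w ((\sum_(i < n.+1) D i w) ^+ 2)%:E =
    \int[P]_w ((S w ^+ 2)%:E + 2%:E * (S w * D n w)%:E + (D n w ^+ 2)%:E))%E.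
  apply: eq_integral => w _; rewrite big_ord_recr -/(S w) /= -EFinM -!EFinD.
  by congr EFin; ring.
have i2 : P.-integrable setT (fun w => 2%:E * (S w * D n w)%:E)%E.
  exact: integrableZl.
rewrite integralD//=; last exact: integrableD.
rewrite integralD//= integralZl//= oSD mule0 adde0 big_ord_recr EFinD.
exact: leeD.
Qed.

(** A factor known from the history can be moved into the test function psi. With stopping
    indicators as factors this leads to the maximal inequality. *)
Lemma martingale_stopped (I : nat -> Omega -> R) :
  (forall k, adapted (G k) (I k)) -> (forall k w, 0 <= I k w <= 1) ->
  martingale_difference G (fun k w => I k w * D k w) c.
Proof.
move=> aI I01; have [mD cD aD oD] := md; split => [k|k|j k jk|k psi apsi].
- by apply: measurable_funM => //; exact: adapted_measurable (aI k).
- apply: le_trans (cD k); apply: ge0_le_integral => //.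
  + by move=> w _; rewrite lee_fin sqr_ge0.
  + apply/measurable_EFinP; apply: measurable_funX; apply: measurable_funM => //.
    exact: adapted_measurable (aI k).
  + by apply/measurable_EFinP; exact: measurable_funX.
  + move=> w _; rewrite lee_fin exprMn ler_piMl ?sqr_ge0//.
    by have /andP[h0 h1] := I01 k w; rewrite expr_le1.
- apply: measurable_funM; last exact: aD.
  exact: adapted_le (ltnW jk) (aI j).
- under [X in _.-integrable _ X -> _]eq_fun do rewrite mulrA.
  under eq_integral do rewrite mulrA.
  apply: oD.
  exact: (@measurable_funM _ (g_sigma_algebraType (G k)) R setT psi (I k) apsi (aI k)).
Qed.

End Sums.

(* The factor I i stops the sums at their first exit from ]-lam, lam[. *)
Lemma stopped_sum (d : nat -> R) (lam : R) (n : nat) : 0 < lam ->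
  let s j := \sum_(i < j) d i in
  let I i := [forall l : 'I_i.+1, `|s l| < lam] in
  (exists2 j, (j <= n)%N & lam <= `|s j|) ->
  lam <= `|\sum_(i < n) (I i)%:R * d i|.
Proof.
move=> lam0 s I.
suff [[h _] [j jn]|[_ ->]//] :
  ((forall j, (j <= n)%N -> `|s j| < lam) /\ \sum_(i < n) (I i)%:R * d i = s n)
  \/ ((exists2 j, (j <= n)%N & lam <= `|s j|) /\
      lam <= `|\sum_(i < n) (I i)%:R * d i|).
  by rewrite leNgt h.
elim: n => [|n [[ih1 ih2]|[[l ln ih1] ih2]]].
- left; split; last by rewrite /s !big_ord0.
  by move=> j; rewrite leqn0 => /eqP ->; rewrite /s big_ord0 normr0.
- have I1 : I n by apply/forallP => l; apply: ih1; rewrite -ltnS.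
  have E : \sum_(i < n.+1) (I i)%:R * d i = s n.+1.
    by rewrite big_ord_recr /= ih2 I1 mul1r /s big_ord_recr.
  have [h|h] := ltP `|s n.+1| lam; last by right; rewrite E; split => //; exists n.+1.
  left; split => // j; rewrite leq_eqVlt => /predU1P[->//|]; exact: ih1.
- right; split; first by exists l => //; exact: ltnW.
  have I0 : I n = false.
    apply/negbTE/forallPn; exists (Ordinal (ln : (l < n.+1)%N)).
    by rewrite -leNgt.
  by rewrite big_ord_recr /= I0 mul0r addr0.
Qed.

Lemma martingale_shift N G D c : filtration G -> martingale_difference G D c ->
  filtration (fun k => G (N + k)%N) /\
  martingale_difference (fun k => G (N + k)%N) (fun k => D (N + k)%N)
    (fun k => c (N + k)%N).
Proof.
move=> [sG mG] [mD cD aD oD]; split; first split => [k|j k jk]; first exact: sG.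
  by apply: mG; rewrite leq_add2l.
by split => // [j k jk|k psi]; [apply: aD; rewrite ltn_add2l|exact: oD].
Qed.

Section Maximal.
Variables (G : nat -> set (set Omega)) (D : nat -> Omega -> R) (c : nat -> R).
Hypotheses (fG : filtration G) (md : martingale_difference G D c).

Let mD k : measurable_fun setT (D k). Proof. by have [] := md. Qed.

Let exceed (lam : R) n :=
  [set w | exists2 j, (j <= n)%N & lam <= `|\sum_(i < j) D i w|].

Let measurable_exceed lam n : measurable (exceed lam n).
Proof.
have -> : exceed lam n =
    \bigcup_(j in [set j | (j <= n)%N]) [set w | lam <= `|\sum_(i < j) D i w|].
  by apply/seteqP; split => [w [j jn h]|w [j jn h]]; exists j.
apply: bigcup_measurable => j _.
apply: measurable_ge; apply: measurableT_comp => //; exact: measurable_sum.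
Qed.

(** Kolmogorov's inequality: once a partial sum has reached lam in absolute value the stopped sum
    stays there, so Chebyshev applied to the stopped sum at time n suffices. *)
Lemma maximal_inequality (lam : R) n : 0 < lam ->
  (P (exceed lam n) <= (lam ^- 2 * \sum_(i < n) c i)%:E)%E.
Proof.
move=> lam0.
(* The sums up to index k involve only differences before k, so [I k] is known before [D k]. *)
pose I k w : R := ([forall l : 'I_k.+1, `|\sum_(i < l) D i w| < lam])%:R.
have aI k : adapted (G k) (I k).
  pose A := \bigcap_(l in [set l | (l <= k)%N])
    [set w : g_sigma_algebraType (G k) | `|\sum_(i < l) D i w| < lam].
  have -> : I k = \1_A.
    apply/funext => w; rewrite /I indicE; congr (nat_of_bool _)%:R.
    apply/forallP/idP => [h|]; last first.
      by rewrite inE => Aw l; apply: Aw; rewrite /= -ltnS.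
    by rewrite inE => l /= lk; exact: (h (Ordinal (lk : (l < k.+1)%N))).
  apply: measurable_indic; apply: bigcap_measurable => [|l /= lk]; first by exists 0%N.
  apply: measurable_lt; apply: measurableT_comp => //; exact: (adapted_sum md).
have I01 k w : 0 <= I k w <= 1 by rewrite /I; case: [forall _, _]; rewrite ?lexx ?ler01.
have mst := martingale_stopped fG md aI I01.
have h := martingale_sum_sqr mst n.
have [mID _ _ _] := mst.
set S := (fun w => \sum_(i < n) I i w * D i w) in h.
have mS : measurable_fun setT S by exact: measurable_sum.
have l2 : 0 < lam ^+ 2 by rewrite exprn_gt0.
have key : ((lam ^+ 2)%:E * P (exceed lam n) <= (\sum_(i < n) c i)%:E)%E.
  apply: le_trans h.
  have -> : ((lam ^+ 2)%:E * P (exceed lam n) =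
      \int[P]_w (lam ^+ 2 * \1_(exceed lam n) w)%:E)%E.
    under eq_integral do rewrite EFinM.
    rewrite integralZl//; first by rewrite integral_indic// setIT.
    by apply: integrable_indic => //; rewrite (le_lt_trans (probability_le1 _ _))// ltry.
  apply: ge0_le_integral => //.
  - by move=> w _; rewrite lee_fin mulr_ge0// ltW.
  - by apply/measurable_EFinP; apply: measurable_funM => //; exact: measurable_indic.
  - by apply/measurable_EFinP; exact: measurable_funX.
  move=> w _; rewrite lee_fin indicE.
  have [|_] := boolP (w \in _); last by rewrite mulr0 sqr_ge0.
  rewrite inE => hw; rewrite mulr1 -[leRHS]real_normK ?num_real//.
  rewrite ler_pXn2r ?nnegrE// ?(ltW lam0)//.
  exact: (stopped_sum (d := fun i => D i w)).
rewrite -(@lee_pmul2l _ (lam ^+ 2)%:E)// ?lte_fin//.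
by rewrite -EFinM mulrA mulfV ?mul1r// gt_eqF.
Qed.

Lemma maximal_inequality_sup (lam M : R) : 0 < lam ->
  (forall n, \sum_(i < n) c i <= M) ->
  measurable [set w | exists j, lam <= `|\sum_(i < j) D i w|] /\
  (P [set w | exists j, (lam <= `|\sum_(i < j) D i w|)%R] <= (lam ^- 2 * M)%:E)%E.
Proof.
move=> lam0 cM.
have -> : [set w | exists j, lam <= `|\sum_(i < j) D i w|] =
    \bigcup_n exceed lam n.
  apply/seteqP; split => [w [j h]|w [n _ [j jn h]]]; last by exists j.
  by exists j => //; exists j.
have mU : measurable (\bigcup_n exceed lam n) by exact: bigcup_measurable.
split => //.
have nd : nondecreasing_seq (exceed lam).
  move=> n k nk; apply/subsetPset => w [j jn h]; exists j => //.
  exact: leq_trans nk.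
have cv := nondecreasing_cvg_mu (mu := P) (measurable_exceed lam) mU nd.
rewrite -(cvg_lim _ cv)//; apply: lime_le; first exact: cvgP cv.
apply: nearW => n /=; apply: le_trans (maximal_inequality n lam0) _.
by rewrite lee_fin ler_wpM2l// invr_ge0 sqr_ge0.
Qed.

End Maximal.

Theorem martingale_difference_cvg G D c : filtration G ->
  martingale_difference G D c -> cvgn (series c) ->
  {ae P, forall w, cvgn (series (D^~ w))}.
Proof.
move=> fG md cc.
have c0 k : 0 <= c k.
  have [_ cD _ _] := md; rewrite -lee_fin; apply: le_trans (cD k).
  by apply: integral_ge0 => w _; rewrite lee_fin sqr_ge0.
pose lc := limn (series c).
have rN N n : \sum_(i < n) c (N + i)%N <= lc - series c N.
  rewrite lerBrDr addrC.
  have -> : series c N + \sum_(i < n) c (N + i)%N = series c (N + n)%N.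
    by rewrite !seriesEord /= big_split_ord.
  apply: nondecreasing_cvgn_le => //.
  by apply: nondecreasing_series => k _ _; exact: c0.
(* Oscillation of at least 1/(m+1) after N. Its probability is controlled by the remainder of the
   series c, so for fixed m the intersection over N is null; off these null sets the series is
   Cauchy. *)
pose B N (m : nat) := [set w | exists j, m.+1%:R^-1 <= `|\sum_(i < j) D (N + i)%N w|].
have hB N m : measurable (B N m) /\
    (P (B N m) <= (m.+1%:R ^+ 2 * (lc - series c N))%:E)%E.
  have [fG' md'] := martingale_shift N fG md.
  have [] := maximal_inequality_sup fG' md' (lam := m.+1%:R^-1) _ (rN N).
    by rewrite invr_gt0.
  by rewrite exprVn invrK.
have mC m : measurable (\bigcap_N B N m) by apply: bigcapT_measurable => N; exact: (hB N m).1.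
have C0 m : P (\bigcap_N B N m) = 0%E.
  apply/eqP; rewrite eq_le measure_ge0 andbT.
  have lim0 : (m.+1%:R ^+ 2 * (lc - series c N))%:E @[N --> \oo] --> 0%:E.
    apply: cvg_EFin; first exact: nearW.
    rewrite /= -(mulr0 (m.+1%:R ^+ 2)) -(subrr lc); apply: cvgMl_tmp.
    by apply: cvgB => //; exact: cvg_cst.
  apply: (cvge_to_ge lim0) => //; apply: nearW => N.
  apply: le_trans (hB N m).2; apply: le_measure; rewrite ?inE//.
    exact: (hB N m).1.
  by move=> w; apply.
have neg : P.-negligible (\bigcup_m \bigcap_N B N m).
  apply: negligible_bigcup => m.
  by apply/negligibleP; [exact: mC|exact: C0].
apply: negligibleS neg.
move=> w /=; apply: contra_notP => hw; apply/cauchy_cvgP/cauchy_exP => e e0.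
 have [m me] : exists m : nat, m.+1%:R^-1 < e.
    exists (Num.truncn e^-1); rewrite invf_plt ?posrE//.
    exact: Num.Theory.truncnS_gt.
  have [N hN] : exists N, ~ B N m w.
    by apply: contra_notP hw => /forallNP hB'; exists m => // N _; apply: contrapT.
  exists (series (D^~ w) N); exists N => // n /= Nn.
  rewrite -ball_normE /= distrC; apply: lt_trans me; rewrite ltNge; apply/negP => h.
  apply: hN; exists (n - N)%N; apply: le_trans h _.
  have -> : series (D^~ w) n = series (D^~ w) N + \sum_(i < n - N) D (N + i)%N w.
    by rewrite -{1}(subnKC Nn) !seriesEord /= big_split_ord.
  by rewrite addrC addKr.
Qed.

End MartingaleDifferences.

(** * Independence of a batch from the earlier batches *)

Section PastIndependence.
Context {dO : measure_display} {Omega : measurableType dO} {R : realType}.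
Variables (P : probability Omega R) (I : eqType) (H : I -> set (set Omega)).
Hypotheses (H_indep : mutually_independent P H)
  (H_sigma : forall c, sigma_algebra setT (H c))
  (H_meas : forall c, H c `<=` measurable).

Definition past (s : seq I) : set (set Omega) :=
  [set A | exists2 c, c \in s & H c A].

Let H_setT c : H c setT.
Proof. by have [h0 hC _] := H_sigma c; rewrite -(setD0 setT); exact: hC. Qed.

Let H_setI c A B : H c A -> H c B -> H c (A `&` B).
Proof.
have <- : <<s (H c) >> = H c by exact: sigma_algebra_id.
exact: (@measurableI _ (g_sigma_algebraType (H c))).
Qed.

Lemma past_measurable s : <<s past s >> `<=` measurable.
Proof.
apply: smallest_sub; first exact: sigma_algebra_measurable.
by move=> A [c _]; exact: H_meas.
Qed.

Lemma past_sub s s' : {subset s <= s'} -> past s `<=` past s'.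
Proof. by move=> ss A [c cs HA]; exists c => //; exact: ss. Qed.

(** Dynkin's argument for fixed B: the finite measures P (A [&] B) and P A * P B agree on the finite
    intersections of past events, a pi-system generating the past. *)
Lemma indep_past (s : seq I) c0 A B : uniq s -> c0 \notin s ->
  <<s past s >> A -> H c0 B -> P (A `&` B) = (P A * P B)%E.
Proof.
move=> us c0s sA HB.
pose Pi : set (set Omega) :=
  [set \big[setI/setT]_(c <- s) F c | F in [set F | forall c, H c (F c)]].
have sPi : past s `<=` Pi.
  move=> E [c cs HE]; exists (fun c' => if c' == c then E else setT).
    by move=> c' /=; case: eqP => [->|_].
  rewrite (bigD1_seq c)//= eqxx big1 ?setIT// => c' /negbTE ->//.
have PiI : setI_closed Pi.
  move=> _ _ [F hF <-] [F' hF' <-]; exists (fun c => F c `&` F' c).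
    by move=> c; exact: H_setI.
  by rewrite big_split.
have Pim : Pi `<=` measurable.
  move=> _ [F hF <-]; elim: s {us c0s sA sPi PiI Pi} => [|c s ih].
    by rewrite big_nil.
  by rewrite big_cons; apply: measurableI => //; exact: H_meas.
have mB := H_meas HB.
have PB : P B = (fine (P B))%:E by rewrite fineK// fin_num_measure.
have PB0 : 0 <= fine (P B) by rewrite fine_ge0.
have mPi : <<s past s >> `<=` <<s Pi >> by exact: sub_sigma_algebra2.
have key E : Pi E -> mrestr P mB E = mscale (NngNum PB0) P E.
  move=> [F hF <-]; rewrite /mrestr /mscale /= -PB.
  have Fs c : c \in s -> (if c == c0 then B else F c) = F c.
    by case: eqP => [->|//]; rewrite (negbTE c0s).
  have h : P (\big[setI/setT]_(c <- c0 :: s) (if c == c0 then B else F c)) =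
      (\prod_(c <- c0 :: s) P (if c == c0 then B else F c))%E.
    apply: (H_indep (A := fun c => if c == c0 then B else F c)).
      by rewrite /= c0s.
    by move=> c _; case: eqP => [->|].
  move: h; rewrite !big_cons eqxx (eq_big_seq _ Fs).
  rewrite (@eq_big_seq _ _ _ _ s _ (P \o F)) => [|c cs]; last by rewrite /= Fs.
  by rewrite setIC => ->; rewrite (H_indep (s := s) (A := F) us).
have -> : P (A `&` B) = mscale (NngNum PB0) P A; last first.
  by rewrite /mscale /= -PB muleC.
apply: (@g_sigma_algebra_measure_unique _ R Omega Pi Pim (fun=> setT) _ _
  (mrestr P mB) (mscale (NngNum PB0) P) PiI key).
- by move=> _; exists (fun=> setT) => //; rewrite big1.
- by rewrite bigcup_const.
- move=> k; apply: le_lt_trans (ltry 1).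
  exact: (probability_le1 P (measurableI _ _ measurableT mB)).
- exact: (mPi _ sA).
Qed.

End PastIndependence.

(** * Measurability of the iterates *)

Section BorelVectors.
Context {R : realType}.

(** The form that vector operations preserve; [measurable_borel_cV] recovers Borel measurability
    from it. *)
Definition coord_measurable d (T : measurableType d) n (u : T -> 'cV[R]_n) : Prop :=
  forall i, measurable_fun setT (fun t => u t i 0).

(** Rational centres and radii 1/(k+1) keep the union countable, so preimages of open sets are
    measurable as soon as those of boxes are. *)
Lemma open_bigcup_box n (U : set 'cV[R]_n) : open U ->
  U = \bigcup_(p in [set p : {ffun 'I_n -> rat} * nat |
        [set y : 'cV[R]_n | forall i, `|y i 0 - ratr (p.1 i)| < p.2.+1%:R^-1] `<=` U])
      [set y | forall i, `|y i 0 - ratr (p.1 i)| < p.2.+1%:R^-1].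
Proof.
move=> oU; apply/seteqP; split => [x Ux|x [p /= pU px]]; last exact: pU.
have /nbhs_ballP[e /= e0 eU] : nbhs x U by exact: open_nbhs_nbhs.
have [k ke] : exists k : nat, k.+1%:R^-1 < e / 2.
  have e20 : 0 < e / 2 by rewrite divr_gt0.
  exists (Num.truncn (e / 2)^-1); rewrite invf_plt ?posrE//.
  exact: Num.Theory.truncnS_gt.
have qex i : exists q : rat, `|x i 0 - ratr q| < k.+1%:R^-1.
  have : x i 0 - k.+1%:R^-1 < x i 0 + k.+1%:R^-1.
    by rewrite ltrD2l gtrN// invr_gt0.
  move=> /rat_in_itvoo[q]; rewrite in_itv /= => /andP[h1 h2]; exists q.
  by rewrite ltr_distlC h1 h2.
have [q hq] := choice qex.
exists ([ffun i => q i], k) => /= [y hy|i]; last by rewrite ffunE.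
apply: eU; split => // i j; rewrite ord1 -ball_normE /=.
have := hy i; rewrite ffunE /= distrC => hyi.
apply: le_lt_trans (ler_distD (ratr (q i)) _ _) _.
by rewrite (splitr e) ltrD// (lt_trans _ ke).
Qed.

Lemma measurable_borel_cV d (T : measurableType d) n (u : T -> 'cV[R]_n) :
  coord_measurable u -> measurable_fun setT (u : T -> borel_cV R n).
Proof.
move=> mu; apply: (@measurability _ _ T (borel_cV R n) setT u (@open 'cV[R]_n)) => //.
move=> _ [U oU <-]; rewrite setTI.
rewrite (open_bigcup_box oU) preimage_bigcup.
set I := [set p | _]; set box := (fun p : {ffun 'I_n -> rat} * nat => _).
have -> : \bigcup_(p in I) box p =
    \bigcup_k (if unpickle k is Some p then
                 if `[< I p >] then box p else set0 else set0).
  apply/seteqP; split => [t [p Ip tp]|t [k _]].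
    by exists (pickle p) => //; rewrite pickleK; case: asboolP.
  case: unpickle => // p; case: asboolP => // Ip tp; by exists p.
apply: bigcupT_measurable => k; case: unpickle => // p; case: ifP => // _.
have -> : box p = \big[setI/setT]_(i < n)
    [set t | `|u t i 0 - ratr (p.1 i)| < p.2.+1%:R^-1].
  apply/seteqP; split => t /=.
    by move=> h; elim/big_ind : _ => // i _; exact: h.
  move=> h i; move: h; rewrite (bigD1 i)//= => -[].
  exact.
apply: bigsetI_measurable => i _; apply: measurable_lt.
apply: measurableT_comp => //; apply: measurable_funB => //; exact: mu.
Qed.

Lemma continuous_borel_measurable n (f : 'cV[R]_n -> R) :
  continuous f -> measurable_fun setT (f : borel_cV R n -> R).
Proof.
move=> /continuousP cf; apply: (measurability _ (RGenOpens.measurableE R)).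
move=> _ [_ [a [b ->] <-]]; rewrite setTI.
by apply: sub_sigma_algebra; exact/cf/interval_open.
Qed.

Lemma continuous_coord_measurable d (T : measurableType d) n
    (f : 'cV[R]_n -> R) (u : T -> 'cV[R]_n) :
  continuous f -> coord_measurable u -> measurable_fun setT (f \o u).
Proof.
move=> cf mu; apply: (@measurableT_comp _ _ _ _ (borel_cV R n)).
  exact: continuous_borel_measurable.
exact: measurable_borel_cV.
Qed.

Lemma continuous_wnorm n (w : 'I_n -> R) : continuous (wnorm w).
Proof.
move=> x; have h : wdot w y y @[y --> x] --> wdot w x x.
  exact: (@continuous_wdot R n w 'cV[R]_n (nbhs x) _ id id x x cvg_id cvg_id).
exact: (continuous_cvg (h := @Num.sqrt R) _ (@sqrt_continuous R _) h).
Qed.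

(* McShane extension: a function whose graph lies in a Lipschitz relation is the
   restriction of a continuous function. *)
Lemma lipschitz_graph_measurable d (T : measurableType d) n (w : 'I_n -> R) (K : R)
    (Gr : 'cV[R]_n -> 'cV[R]_n -> Prop) (z y : T -> 'cV[R]_n) :
  (forall i, 0 < w i) -> 0 <= K ->
  (forall a a' b b' i, Gr a b -> Gr a' b' ->
     `|b i 0 - b' i 0| <= K * wnorm w (a - a')) ->
  (forall t, Gr (z t) (y t)) -> coord_measurable z -> coord_measurable y.
Proof.
move=> w0 K0 GrL Gzy mz i.
pose A x := [set b i 0 + K * wnorm w (x - a) | a in setT & b in setT] : set R.
pose S x := [set r | exists a b, Gr a b /\ r = b i 0 + K * wnorm w (x - a)].
pose phi x := inf (S x).
have tri x x' a : wnorm w (x - a) <= wnorm w (x - x') + wnorm w (x' - a).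
  have -> : x - a = (x - x') + (x' - a) by rewrite addrA subrK.
  exact: ler_wnormD.
have lb x a b : Gr a b -> lbound (S x) (b i 0 - K * wnorm w (x - a)).
  move=> ab _ [a' [b' [ab' ->]]].
  have := GrL _ _ _ _ i ab ab'; rewrite ler_norml => /andP[_ h].
  have := ler_wpM2l K0 (tri a x a').
  have -> : wnorm w (a - x) = wnorm w (x - a) by rewrite -wnormN opprB.
  lra.
(* A point of T makes the graph nonempty, so the infimum defining [phi] is taken over a nonempty
   set. *)
have t0 : T := point.
have Sn x : S x !=set0.
  by exists (y t0 i 0 + K * wnorm w (x - z t0)); exists (z t0), (y t0).
have Sl x : has_lbound (S x).
  by exists (y t0 i 0 - K * wnorm w (x - z t0)); apply: lb.
have phiE t : phi (z t) = y t i 0.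
  apply/eqP; rewrite eq_le; apply/andP; split.
    apply: ge_inf => //; exists (z t), (y t); split => //.
    by rewrite subrr /wnorm wdot0l sqrtr0 mulr0 addr0.
  apply: lb_le_inf => //.
  have := lb (z t) _ _ (Gzy t).
  by rewrite subrr /wnorm wdot0l sqrtr0 mulr0 subr0.
have phiL x x' : phi x <= phi x' + K * wnorm w (x - x').
  rewrite -lerBlDr; apply: lb_le_inf => // _ [a [b [ab ->]]].
  rewrite lerBlDr; apply: le_trans (_ : b i 0 + K * wnorm w (x - a) <= _).
    by apply: ge_inf => //; exists a, b.
  have := ler_wpM2l K0 (tri x x' a); lra.
have cphi : continuous phi.
  move=> x; apply: (proj2 (@cvgrPdist_le _ _ _ (nbhs x) _ _ _)) => e e0.
  have hx : (fun x' => x - x') @ x --> x - x.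
    exact: (@cvgB R 'cV[R]_n 'cV[R]_n (nbhs x) _ (fun=> x) id x x (cvg_cst x) cvg_id).
  have hn := continuous_cvg (h := wnorm w) _ (@continuous_wnorm _ w _) hx.
  have hn0 : wnorm w (x - x') @[x' --> x] --> 0.
    rewrite [X in _ --> X](_ : 0 = wnorm w (x - x)); first exact: hn.
    by rewrite subrr /wnorm wdot0l sqrtr0.
  have : K * wnorm w (x - x') @[x' --> x] --> 0.
    by rewrite -(mulr0 K); exact: (@cvgMl_tmp _ _ (nbhs x)).
  move=> /(proj1 (@cvgr0Pnorm_le _ _ _ (nbhs x) _ _)) /(_ e e0).
  apply: filterS => x' h.
  have n0 : 0 <= K * wnorm w (x - x') by rewrite mulr_ge0// wnorm_ge0.
  rewrite ger0_norm// in h.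
  have h1 := phiL x x'; have h2 := phiL x' x.
  have E : wnorm w (x' - x) = wnorm w (x - x') by rewrite -wnormN opprB.
  rewrite E in h2; rewrite ler_norml; apply/andP; split; lra.
have -> : (fun t => y t i 0) = phi \o z by apply/funext => t /=; rewrite phiE.
exact: continuous_coord_measurable.
Qed.

End BorelVectors.

Section GradientMeasurability.
Context {R : realType} {N : nat} {d : 'I_N -> nat}.

Lemma mxcolE m (B : forall i, 'M[R]_(d i, m)) l j :
  (\mxcol_i B i) l j = B (tagnat.sig1 l) (tagnat.sig2 l) j.
Proof. by rewrite mxE. Qed.

Lemma replace_block_id (u : 'cV[R]_(blockdim d)) i :
  replace_block u (submxcol u i) = u.
Proof.
rewrite -[RHS]submxcolK; apply/eq_mxcol => j.
have [<-|ij] := eqVneq i j; first by rewrite dfwithin.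
by rewrite dfwithout.
Qed.

Lemma replace_block_shift (u : 'cV[R]_(blockdim d)) i (h : R) (e : 'cV[R]_(d i)) :
  replace_block u (h *: e + submxcol u i) = u + h *: replace_block 0 e.
Proof.
rewrite -[X in _ = X + _]submxcolK; apply/colP => l.
rewrite !mxE; have [E|il] := eqVneq i (tagnat.sig1 l).
  by case: _ / E (tagnat.sig2 l) => l'; rewrite !dfwithin !mxE addrC.
by rewrite !dfwithout// !mxE mulr0 addr0.
Qed.

Lemma harmonic_dnbhs : (fun n : nat => n.+1%:R^-1 : R) @ \oo --> 0^'.
Proof.
move=> A hA; have [K _ hK] := @cvg_harmonic R _ hA.
by exists K => // n Kn; apply: (hK n Kn); rewrite /= gt_eqF ?harmonic_gt0.
Qed.

(** Difference quotients along 1/(n+1) exhibit the partial gradient as a pointwise limit of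
    expressions in the function itself. Joint measurability of the sampled cost thereby passes to
    its gradient. *)
Lemma partial_grad_cvg i (h : 'cV[R]_(blockdim d) -> R) u j :
  (forall v, differentiable (fun v' : 'cV[R]_(d i) => h (replace_block u v')) v) ->
  (fun n : nat => n.+1%:R * (h (u + n.+1%:R^-1 *: replace_block 0 (delta_mx j 0)) - h u))
    @ \oo --> partial_grad i h u j 0.
Proof.
move=> dh; rewrite /partial_grad /grad mxE.
have := diff_derivable (v := delta_mx j 0) (dh (submxcol u i)).
rewrite /derivable => /(cvg_comp _ _ harmonic_dnbhs).
rewrite -/('D_(delta_mx j 0) _ _) => H.
apply: cvg_trans H; apply: near_eq_cvg; apply: nearW => n /=.
rewrite invrK replace_block_shift replace_block_id.
by [].
Qed.

Lemma partial_grad_measurable dT (T : measurableType dT) q (Xi : set (borel_cV R q))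
    i (fh : 'cV[R]_(blockdim d) -> 'cV[R]_q -> R)
    (u : T -> 'cV[R]_(blockdim d)) (s : T -> borel_cV R q) :
  measurable Xi ->
  measurable_fun (setT `*` Xi : set (borel_cV R (blockdim d) * borel_cV R q)%type)
    (fun p : borel_cV R (blockdim d) * borel_cV R q => fh p.1 p.2) ->
  (forall u s v, Xi s ->
    differentiable (fun v' : 'cV[R]_(d i) => fh (replace_block u v') s) v) ->
  coord_measurable u -> measurable_fun setT s -> (forall t, Xi (s t)) ->
  coord_measurable (fun t => partial_grad i (fun v => fh v (s t)) (u t)).
Proof.
move=> mXi mfh dfh mu ms Xs j.
have mc (c : 'cV[R]_(blockdim d)) : measurable_fun setT (fun t => fh (u t + c) (s t)).
  have muc : measurable_fun setT (fun t => u t + c : borel_cV R (blockdim d)).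
    apply: measurable_borel_cV => l; under eq_fun do rewrite mxE.
    by apply: measurable_funD => //; exact: mu.
  apply: (@measurable_comp _ _ _ _ _ _ (setT `*` Xi)
    (fun p : borel_cV R (blockdim d) * borel_cV R q => fh p.1 p.2) setT
    (fun t => (u t + c, s t))) => //.
  - exact: measurableX.
  - by move=> _ [t _ <-]; split => //=; exact: Xs.
  - exact: measurable_fun_pair.
apply: (@measurable_fun_cvg _ _ _ _ (fun n t => n.+1%:R *
  (fh (u t + n.+1%:R^-1 *: replace_block 0 (delta_mx j 0)) (s t) - fh (u t) (s t)))).
  move=> n; apply: measurable_funM => //; apply: measurable_funB; first exact: mc.
  by have := mc 0; under eq_fun do rewrite addr0.
by move=> t _; apply: partial_grad_cvg => v; exact: dfh.
Qed.

End GradientMeasurability.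

Section SummableExpectations.
Context {dO : measure_display} {Omega : measurableType dO} {R : realType}.
Variable P : probability Omega R.

(** The sum of the series has a finite integral by monotone convergence, hence is finite almost
    everywhere. *)
Lemma ae_cvg_series (f : nat -> Omega -> R) (c : nat -> R) :
  (forall k, measurable_fun setT (f k)) -> (forall k w, 0 <= f k w) ->
  (forall k, \int[P]_w (f k w)%:E <= (c k)%:E)%E -> cvgn (series c) ->
  {ae P, forall w, cvgn (series (f^~ w))}.
Proof.
move=> mf f0 fc cc.
have c0 k : 0 <= c k.
  rewrite -lee_fin; apply: le_trans (fc k).
  by apply: integral_ge0 => w _; rewrite lee_fin.
pose g w := (\sum_(0 <= k <oo) (f k w)%:E)%E.
have mg : measurable_fun setT g.
  by apply: ge0_emeasurable_sum => [k w _ _|k _]; [rewrite lee_fin|exact/measurable_EFinP].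
have g0 w : (0 <= g w)%E by apply: nneseries_ge0 => k _ _; rewrite lee_fin.
have ig : P.-integrable setT g.
  apply/integrableP; split => //.
  under eq_integral do rewrite gee0_abs//.
  rewrite /g integral_nneseries//; last 2 first.
  - by move=> k; exact/measurable_EFinP.
  - by move=> k w _; rewrite lee_fin.
  apply: (@le_lt_trans _ _ (\sum_(0 <= k <oo) (c k)%:E)%E).
    apply: lee_nneseries => [k _|k _]; last exact: fc.
    by move=> _; apply: integral_ge0 => w _; rewrite lee_fin.
  have -> : (\sum_(0 <= k <oo) (c k)%:E)%E = (limn (series c))%:E.
    rewrite -EFin_lim//; congr (limn _); apply/funext => n /=.
    by rewrite sumEFin.
  exact: ltry.
have := integrable_ae measurableT ig; apply: filterS => w /(_ I) gw.
apply: (@nonneg_series_le _ _ (fine (g w))) => // k.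
rewrite -lee_fin fineK// -sumEFin.
by apply: nneseries_lim_ge => i _ _; rewrite lee_fin.
Qed.

End SummableExpectations.

Section CoordMeasurable.
Context {R : realType} {d : measure_display} {T : measurableType d}.

Lemma coord_measurable_cst n (c : 'cV[R]_n) : coord_measurable (fun _ : T => c).
Proof. by move=> i; exact: measurable_cst. Qed.

Lemma coord_measurableD n (u v : T -> 'cV[R]_n) :
  coord_measurable u -> coord_measurable v -> coord_measurable (fun t => u t + v t).
Proof.
by move=> mu mv i; under eq_fun do rewrite mxE; exact: measurable_funD.
Qed.

Lemma coord_measurableN n (u : T -> 'cV[R]_n) :
  coord_measurable u -> coord_measurable (fun t => - u t).
Proof.
by move=> mu i; under eq_fun do rewrite mxE; exact: measurableT_comp.
Qed.

Lemma coord_measurableB n (u v : T -> 'cV[R]_n) :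
  coord_measurable u -> coord_measurable v -> coord_measurable (fun t => u t - v t).
Proof. by move=> mu mv; apply: coord_measurableD => //; exact: coord_measurableN. Qed.

Lemma coord_measurableM m n (A : 'M[R]_(m, n)) (u : T -> 'cV[R]_n) :
  coord_measurable u -> coord_measurable (fun t => A *m u t).
Proof.
move=> mu i; under eq_fun do rewrite mxE.
by apply: measurable_sum => j; apply: measurable_funM.
Qed.

Lemma coord_measurableZ n (a : R) (u : T -> 'cV[R]_n) :
  coord_measurable u -> coord_measurable (fun t => a *: u t).
Proof.
by move=> mu i; under eq_fun do rewrite mxE; exact: measurable_funM.
Qed.

Lemma coord_measurable_col_mx m n (u : T -> 'cV[R]_m) (v : T -> 'cV[R]_n) :
  coord_measurable u -> coord_measurable v ->
  coord_measurable (fun t => col_mx (u t) (v t)).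
Proof.
move=> mu mv i; rewrite -(splitK i); case: (fintype.split i) => j /=.
  by under eq_fun do rewrite col_mxEu; exact: mu.
by under eq_fun do rewrite col_mxEd; exact: mv.
Qed.

Lemma coord_measurable_usubmx m n (u : T -> 'cV[R]_(m + n)) :
  coord_measurable u -> coord_measurable (fun t => usubmx (u t)).
Proof. by move=> mu i; under eq_fun do rewrite mxE; exact: mu. Qed.

Lemma coord_measurable_dsubmx m n (u : T -> 'cV[R]_(m + n)) :
  coord_measurable u -> coord_measurable (fun t => dsubmx (u t)).
Proof. by move=> mu i; under eq_fun do rewrite mxE; exact: mu. Qed.

Lemma measurable_dot n (u v : T -> 'cV[R]_n) :
  coord_measurable u -> coord_measurable v ->
  measurable_fun setT (fun t => dot (u t) (v t)).
Proof.
by move=> mu mv; apply: measurable_sum => i; exact: measurable_funM.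
Qed.

Lemma batch_pseudogradient_measurable (N S : nat) (dd q : 'I_N -> nat)
    (Xi : forall i, set (borel_cV R (q i)))
    (fhat : forall i, 'cV[R]_(blockdim dd) -> 'cV[R]_(q i) -> R)
    (u : T -> 'cV[R]_(blockdim dd)) (s : T -> forall i : 'I_N, 'I_S -> 'cV[R]_(q i)) :
  (forall i, measurable (Xi i)) ->
  (forall i, measurable_fun
     (setT `*` Xi i : set (borel_cV R (blockdim dd) * borel_cV R (q i))%type)
     (fun p : borel_cV R (blockdim dd) * borel_cV R (q i) => fhat i p.1 p.2)) ->
  (forall i u s v, Xi i s ->
     differentiable (fun v' : 'cV[R]_(dd i) => fhat i (replace_block u v') s) v) ->
  coord_measurable u ->
  (forall i t, measurable_fun setT (fun w => s w i t : borel_cV R (q i))) ->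
  (forall i t w, Xi i (s w i t)) ->
  coord_measurable (fun w => batch_pseudogradient fhat (s w) (u w)).
Proof.
move=> mXi mf df mu ms Xs l.
under eq_fun do rewrite mxE mxE summxE.
apply: measurable_funM => //; apply: measurable_sum => t.
exact: (partial_grad_measurable (mXi _) (mf _) (df _) mu (ms _ t) (Xs _ t)).
Qed.

Lemma Vop_measurable (N m : nat) (dd : 'I_N -> nat)
    (F : T -> 'cV[R]_(blockdim dd) -> 'cV[R]_(blockdim dd))
    (D : forall i, 'M[R]_(m, dd i)) b (W : 'M[R]_N)
    (x : T -> 'cV[R]_(blockdim dd + (repdim N m + repdim N m))) :
  coord_measurable x -> coord_measurable (fun t => F t (actions (x t))) ->
  coord_measurable (fun t => Vop (F t) D b W (x t)).
Proof.
move=> mx mF.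
have ma : coord_measurable (fun t => actions (x t)) by exact: coord_measurable_usubmx.
have md := coord_measurable_dsubmx mx.
have mmu : coord_measurable (fun t => auxiliaries (x t)) by exact: coord_measurable_usubmx.
have ml : coord_measurable (fun t => multipliers (x t)) by exact: coord_measurable_dsubmx.
apply: coord_measurable_col_mx; last apply: coord_measurable_col_mx.
- by apply: coord_measurableD => //; exact: coord_measurableM.
- exact: coord_measurableM.
- apply: coord_measurableB; last exact: coord_measurableM.
  apply: coord_measurableD; first exact: coord_measurable_cst.
  by apply: coord_measurableM; exact: coord_measurableB.
Qed.

End CoordMeasurable.

(** * Errors at a random point that is independent of the sample *)

Section Noise.
Context {dO : measure_display} {Omega : measurableType dO} {R : realType}.
Variables (P : probability Omega R) (Ga Gb : set (set Omega)).
Hypotheses (mGa : <<s Ga >> `<=` measurable) (mGb : <<s Gb >> `<=` measurable).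
Hypothesis indep : forall A B, <<s Ga >> A -> <<s Gb >> B ->
  P (A `&` B) = (P A * P B)%E.
Notation Ta := (g_sigma_algebraType Ga).
Notation Tb := (g_sigma_algebraType Gb).
Variables (n : nat) (err : Omega -> Omega -> 'cV[R]_n) (v : R).
Hypothesis merr : coord_measurable (fun p : Ta * Tb => err p.1 p.2).
Hypothesis err0 : forall w j, (\int[P]_w' (err w w' j 0)%:E = 0)%E.
Hypothesis err2 : forall w, (\int[P]_w' (dot (err w w') (err w w'))%:E <= v%:E)%E.

(** Both independent variables are the identity of [Omega], read with two sigma-algebras on the
    target; independence of the sigma-algebras is then independence of variables. In [err w w'] the
    history is w and the fresh sample is w'. *)
Let ida : Omega -> Ta := id.
Let idb : Omega -> Tb := id.
Let mida : measurable_fun setT ida.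
Proof. by move=> _ A mA; rewrite setTI; exact: mGa. Qed.
Let midb : measurable_fun setT idb.
Proof. by move=> _ A mA; rewrite setTI; exact: mGb. Qed.
Let indep_id (A : set Ta) (B : set Tb) : measurable A -> measurable B ->
  P (ida @^-1` A `&` idb @^-1` B) = (P (ida @^-1` A) * P (idb @^-1` B))%E.
Proof. exact: indep. Qed.

Lemma noise_coord_measurable : coord_measurable (fun w => err w w).
Proof.
move=> j; have := merr j => mj.
exact: (measurableT_comp mj (measurable_fun_pair mida midb)).
Qed.

Lemma noise_section_measurable w : coord_measurable (fun w' => err w w').
Proof.
move=> j; have mw := measurableT_comp (merr j) (@measurable_pair1 _ _ Ta Tb w).
exact: (measurableT_comp mw midb).
Qed.

Lemma noise_dot_le : (\int[P]_w (dot (err w w) (err w w))%:E <= v%:E)%E.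
Proof.
pose Phi (p : Ta * Tb) := (dot (err p.1 p.2) (err p.1 p.2))%:E.
have mPhi : measurable_fun setT Phi.
  by apply/measurable_EFinP; exact: measurable_dot.
have Phi0 p : (0 <= Phi p)%E by rewrite lee_fin dot_ge0.
have := ge0_integral_indep mida midb indep_id mPhi Phi0.
rewrite /Phi /= => ->.
apply: (@le_trans _ _ (\int[P]_w v%:E)%E).
  apply: ge0_le_integral => //.
  - by move=> w _; apply: integral_ge0 => w' _; rewrite lee_fin dot_ge0.
  - exact: (measurable_integral_indep P mida midb mPhi Phi0).
by rewrite integral_cst// -[X in (_ * X)%E]/(P setT) probability_setT mule1.
Qed.

Lemma noise_sqr_le (c : Omega -> 'cV[R]_n) (M : R) :
  coord_measurable c -> (forall w, dot (c w) (c w) <= M) ->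
  (\int[P]_w ((dot (err w w) (c w)) ^+ 2)%:E <= (M * v)%:E)%E.
Proof.
move=> mc cM.
have M0 : 0 <= M by exact: le_trans (dot_ge0 _) (cM point).
have me := noise_coord_measurable.
have md : measurable_fun setT (fun w => dot (err w w) (err w w)) by exact: measurable_dot.
apply: (@le_trans _ _ (\int[P]_w (M%:E * (dot (err w w) (err w w))%:E))%E).
  apply: ge0_le_integral => //.
  - by move=> w _; rewrite lee_fin sqr_ge0.
  - by apply/measurable_EFinP; apply: measurable_funX; exact: measurable_dot.
  - by under eq_fun do rewrite -EFinM; apply/measurable_EFinP; exact: measurable_funM.
  - move=> w _; rewrite -EFinM lee_fin.
    apply: (@le_trans _ _ (dot (err w w) (err w w) * dot (c w) (c w))).
      by rewrite !dotE; apply: (wdot_CauchySchwarz (w := fun=> 1)) => i; exact: ltr01.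
    by rewrite mulrC ler_wpM2r// dot_ge0.
rewrite ge0_integralZl//.
- by rewrite EFinM; apply: lee_wpmul2l => //; exact: noise_dot_le.
- exact/measurable_EFinP.
- by move=> w _; rewrite lee_fin dot_ge0.
Qed.

(** With the history frozen, psi and c are constants and the integral is a linear combination of the
    vanishing means of the coordinates. *)
Lemma noise_orth (c : Ta -> 'cV[R]_n) (psi : Omega -> R) :
  coord_measurable c -> adapted Ga psi ->
  P.-integrable setT (fun w => (psi w * dot (err w w) (c w))%:E) ->
  (\int[P]_w (psi w * dot (err w w) (c w))%:E = 0)%E.
Proof.
move=> mc apsi ipsi.
pose Phi (p : Ta * Tb) := psi p.1 * dot (err p.1 p.2) (c p.1).
have mPhi : measurable_fun setT Phi.
  apply: measurable_funM.
    exact: (measurableT_comp apsi (@measurable_fst _ _ Ta Tb)).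
  apply: measurable_dot => // j.
  exact: (measurableT_comp (mc j) (@measurable_fst _ _ Ta Tb)).
(* Integrability of a coordinate comes from the second moment, through |x| <= 1 + |x|^2. *)
have ierr w j : P.-integrable setT (fun w' => (err w w' j 0)%:E).
  have me := noise_section_measurable w.
  have i2 : P.-integrable setT (fun w' => (dot (err w w') (err w w'))%:E).
    apply/integrableP; split; first by apply/measurable_EFinP; exact: measurable_dot.
    apply: le_lt_trans (ltry v); apply: le_trans (err2 w).
    rewrite le_eqVlt; apply/orP; left; apply/eqP; apply: eq_integral => w' _.
    by rewrite gee0_abs// lee_fin dot_ge0.
  have i1 : P.-integrable setT (EFin \o cst (1 : R)).
    exact: finite_measure_integrable_cst.
  apply: (le_integrable _ _ _ (integrableD _ i1 i2)) => //.
    exact/measurable_EFinP.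
  move=> w' _; change (`|(err w w' j 0)%:E| <= `|(1 + dot (err w w') (err w w'))%:E|)%E.
  rewrite !abse_EFin lee_fin.
  rewrite [leRHS]ger0_norm ?addr_ge0 ?dot_ge0//.
  apply: le_trans (enorm_coord _ _) _.
  rewrite -sqr_enorm; have := sqr_ge0 (enorm (err w w') - 1).
  have := sqr_ge0 (enorm (err w w')); lra.
have split_dot w : (fun w' => (psi w * dot (err w w') (c w))%:E) =
    (fun w' => \sum_(j < n) ((psi w * c w j 0)%:E * (err w w' j 0)%:E))%E.
  apply/funext => w'; rewrite /dot mulr_sumr -sumEFin; apply: eq_bigr => j _.
  by rewrite -EFinM; congr EFin; ring.
have iterm w j : P.-integrable setT (fun w' => (psi w * c w j 0)%:E * (err w w' j 0)%:E)%E.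
  exact: integrableZl.
apply: (integral_indep mida midb indep_id mPhi ipsi) => w; rewrite /Phi /=.
  by rewrite split_dot; apply: integrable_sum => // j _; exact: iterm.
rewrite split_dot integral_sum//; apply: big1 => j _.
by rewrite integralZl// err0 mule0.
Qed.

End Noise.

(** * Subdifferentials and existence of equilibria *)

Section Subdifferential.
Context {R : realType} {n : nat} (g : 'cV[R]_n -> \bar R).
Hypotheses (g_prop : proper_function g) (g_conv : econvex_function g)
  (g_lsc : lower_semicontinuous g) (g_comp : compact (edom g)).

Lemma ereal_between (r : R) (z : \bar R) : (r%:E < z)%E ->
  exists2 c : R, r < c & (c%:E < z)%E.
Proof.
case: z => [s| |]//; rewrite ?lte_fin.
  by move=> rs; exists ((r + s) / 2); rewrite ?lte_fin midf_lt.
by exists (r + 1); rewrite ?ltry// ltrDl.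
Qed.

Lemma lsc_limit (y : nat -> 'cV[R]_n) (r : nat -> R) l r0 :
  y @ \oo --> l -> r @ \oo --> r0 ->
  (\forall k \near \oo, (g (y k) <= (r k)%:E)%E) -> (g l <= r0%:E)%E.
Proof.
move=> yl rl gr; rewrite leNgt; apply/negP => /ereal_between[c rc cg].
have [V lV Vc] := g_lsc cg.
have h1 : \forall k \near \oo, V (y k) by exact: yl.
have h2 : \forall k \near \oo, r k < c by exact: (cvgr_lt _ rl).
have [k [[h3 h4] h5]] : exists k, (V (y k) /\ r k < c) /\ (g (y k) <= (r k)%:E)%E.
  by apply: (@filter_ex _ \oo); near=> k; split; [split|]; near: k.
have := lt_le_trans (Vc _ h3) h5; rewrite lte_fin => h6.
by have := lt_trans h4 h6; rewrite ltxx.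
Unshelve. all: by end_near. Qed.

Lemma mx_norm_coord (x : 'cV[R]_n) i : `|x i 0| <= `|x|.
Proof.
rewrite [leRHS]/Num.norm /= mx_normrE.
exact: (le_bigmax _ (fun ij => `|x ij.1 ij.2|) (i, 0)).
Qed.

Lemma edom_bounded : exists2 M : R, 0 <= M & forall x, edom g x -> forall i, `|x i 0| <= M.
Proof.
have [M [Mr MA]] := compact_bounded g_comp.
exists (`|M| + 1); first by rewrite addr_ge0.
move=> x gx i; apply: le_trans (mx_norm_coord _ _) _.
by apply: MA => //; rewrite (le_lt_trans (ler_norm _))// ltrDl.
Qed.

Lemma edom_fine x : edom g x -> g x = (fine (g x))%:E.
Proof. by move=> gx; rewrite fineK// fin_numElt gx andbT; exact: g_prop.1. Qed.

Lemma subdiff_edom x p : subdiff g x p -> edom g x.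
Proof.
have [y gy] := g_prop.2; move=> /(_ y) h.
rewrite /edom /= ltNge leye_eq; apply/negP => /eqP gx; move: h.
by rewrite gx addye// leye_eq => /eqP gyy; move: gy; rewrite /edom /= gyy ltxx.
Qed.

Lemma subdiff_fine x p y : subdiff g x p -> edom g y ->
  fine (g x) + dot p (y - x) <= fine (g y).
Proof.
move=> sx gy; have := sx y; rewrite (edom_fine (subdiff_edom sx)) (edom_fine gy).
by rewrite -EFinD lee_fin.
Qed.

Lemma subdiff_monotone x y p q : subdiff g x p -> subdiff g y q ->
  0 <= dot (p - q) (x - y).
Proof.
move=> sx sy.
have := subdiff_fine sx (subdiff_edom sy); have := subdiff_fine sy (subdiff_edom sx).
rewrite !dotLE; lra.
Qed.

Lemma subdiff_closed (y a : nat -> 'cV[R]_n) y0 a0 :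
  (forall k, subdiff g (y k) (a k)) -> y @ \oo --> y0 -> a @ \oo --> a0 ->
  subdiff g y0 a0.
Proof.
move=> sy yl al z; have [gz|gz] := boolP (g z < +oo)%E; last first.
  by move: gz; rewrite -leNgt leye_eq => /eqP ->; rewrite leey.
have gzE : g z = (fine (g z))%:E by exact: edom_fine.
have cv : (fun k => fine (g z) - dot (a k) (z - y k)) @ \oo -->
    fine (g z) - dot a0 (z - y0).
  apply: cvgB; first exact: cvg_cst.
  under eq_cvg do rewrite dotE; rewrite dotE.
  by apply: continuous_wdot => //; apply: cvgB => //; exact: cvg_cst.
have := lsc_limit yl cv; rewrite gzE EFinB leeBrDr//; apply.
apply: nearW => k; have := sy k z; rewrite gzE => h.
by rewrite EFinB leeBrDr.
Qed.

(** Weierstrass for g + q, by subsequences: the domain is bounded, and [lsc_limit] passes sublevel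
    bounds to the limit. *)
Lemma penalized_min (q : 'cV[R]_n -> R) :
  (forall (y : nat -> 'cV[R]_n) l, y @ \oo --> l -> q \o y @ \oo --> q l) ->
  exists2 l, edom g l & forall y, edom g y -> fine (g l) + q l <= fine (g y) + q y.
Proof.
move=> qc.
have [M M0 gM] := edom_bounded.
have [x0 gx0] := g_prop.2.
pose S := [set fine (g y) + q y | y in edom g].
have Sn : S !=set0 by exists (fine (g x0) + q x0), x0.
have lim_mem (y : nat -> 'cV[R]_n) : (forall k, edom g (y k)) ->
    exists (l : 'cV[R]_n) (h : nat -> nat), (forall k, (k <= h k)%N) /\ (y \o h) @ \oo --> l.
  by move=> gy; apply: (@bounded_cvg_subseq R n M) => k; exact: gM.
(* Without a lower bound, a cluster point l of points with values below - k would satisfy g l <= c -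
   q l for every real c, which properness excludes. *)
have Slb : has_lbound S.
  apply: contrapT => /forallNP noS.
  have ex k : exists2 y, edom g y & fine (g y) + q y < - k%:R.
    apply: contrapT => h; apply: (noS (- k%:R)) => _ [y gy <-].
    by rewrite leNgt; apply/negP => hy; apply: h; exists y.
  have ex' k : exists y, edom g y /\ fine (g y) + q y < - k%:R.
    by have [y] := ex k; exists y.
  have [y hy] := choice ex'.
  have [l [h [hk yl]]] := lim_mem y (fun k => (hy k).1).
  have ql := qc _ _ yl.
  have all c : (g l <= (c - q l)%:E)%E.
    have cv : (fun k => c - q (y (h k))) @ \oo --> c - q l.
      by apply: cvgB => //; exact: cvg_cst.
    apply: lsc_limit yl cv _.
    exists (Num.truncn `|c|).+1 => // k /= ck.
    rewrite (edom_fine (hy (h k)).1) lee_fin lerBrDr ltW//.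
    apply: lt_le_trans (hy (h k)).2 _; rewrite lerNl.
    apply: le_trans (ler_norm _) _; rewrite normrN.
    apply: (@le_trans _ _ (Num.truncn `|c|).+1%:R).
      by rewrite ltW// Num.Theory.truncnS_gt.
    by rewrite ler_nat (leq_trans ck).
  have gl : edom g l by apply: le_lt_trans (all 0) (ltry _).
  by have := all (fine (g l) + q l - 1); rewrite (edom_fine gl) lee_fin; lra.
have ex k : exists2 y, edom g y & fine (g y) + q y < inf S + k.+1%:R^-1.
  have e0 : 0 < k.+1%:R^-1 :> R by rewrite invr_gt0.
  by have [_ [y gy <-] h] := inf_adherent e0 (conj Sn Slb); exists y.
have ex' k : exists y, edom g y /\ fine (g y) + q y < inf S + k.+1%:R^-1.
  by have [y] := ex k; exists y.
have [y hy] := choice ex'.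
have [l [h [hk yl]]] := lim_mem y (fun k => (hy k).1).
have ql := qc _ _ yl.
have gl : (g l <= (inf S - q l)%:E)%E.
  have cv : (fun k => inf S + (h k).+1%:R^-1 - q (y (h k))) @ \oo --> inf S - q l.
    apply: cvgB => //; rewrite -[X in _ --> X]addr0; apply: cvgD; first exact: cvg_cst.
    exact: (cvg_subseq hk (@cvg_harmonic R)).
  apply: lsc_limit yl cv _; apply: nearW => k.
  by rewrite (edom_fine (hy (h k)).1) lee_fin lerBrDr ltW// (hy (h k)).2.
have el : edom g l by exact: le_lt_trans gl (ltry _).
exists l => // x gx; apply: (@le_trans _ _ (inf S)).
  by move: gl; rewrite (edom_fine el) lee_fin lerBrDr.
by apply: ge_inf => //; exists x.
Qed.

(** The minimizer y of g + |. - z|^2 / (2 gam) works, with subgradient (z - y) / gam. *)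
Lemma prox_exists (gam : R) (z : 'cV[R]_n) : 0 < gam ->
  exists y a, subdiff g y a /\ z = y + gam *: a.
Proof.
move=> g0.
pose q (y : 'cV[R]_n) := (2 * gam)^-1 * dot (y - z) (y - z).
have [y gy ymin] : exists2 l, edom g l &
    forall y, edom g y -> fine (g l) + q l <= fine (g y) + q y.
  apply: penalized_min => y l yl; apply: cvgMl_tmp.
  under eq_cvg do rewrite dotE; rewrite dotE.
  by apply: continuous_wdot; apply: cvgB => //; exact: cvg_cst.
exists y, (gam^-1 *: (z - y)); split; last first.
  by rewrite scalerA mulfV ?gt_eqF// scale1r addrC subrK.
move=> y'; have [gy'|gy'] := boolP (g y' < +oo)%E; last first.
  by move: gy'; rewrite -leNgt leye_eq => /eqP ->; rewrite leey.
rewrite (edom_fine gy) (edom_fine gy') -EFinD lee_fin.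
pose K := (2 * gam)^-1 * dot (y' - y) (y' - y).
have K0 : 0 <= K by rewrite mulr_ge0 ?dot_ge0// invr_ge0 mulr_ge0// ltW.
(* The minimizer is compared with points of the segment to y'. Convexity gives the subgradient
   inequality up to t K, removed by small t. *)
have step t : 0 < t <= 1 ->
    dot (gam^-1 *: (z - y)) (y' - y) <= fine (g y') - fine (g y) + t * K.
  move=> /andP[t0 t1].
  have t01 : 0 <= t <= 1 by rewrite ltW.
  have := g_conv y' y t01; rewrite (edom_fine gy) (edom_fine gy') -!EFinM -EFinD.
  set yt := t *: y' + (1 - t) *: y => ct.
  have gyt : edom g yt by exact: le_lt_trans ct (ltry _).
  rewrite (edom_fine gyt) lee_fin in ct.
  have := ymin _ gyt.
  have -> : q yt = q y - t * dot (gam^-1 *: (z - y)) (y' - y) + t ^+ 2 * K.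
    rewrite /q /K /yt.
    have -> : t *: y' + (1 - t) *: y - z = (y - z) + t *: (y' - y).
      by apply/colP => i; rewrite !mxE; ring.
    move: (y' - y) => e; rewrite -(opprB y z); move: (y - z) => f.
    rewrite !dotLE (dotC e f); field; rewrite gt_eqF//.
  move=> h.
  rewrite -(ler_pM2l t0) mulrDr.
  move: h ct; rewrite expr2; lra.
apply/ler_addgt0Pr => e e0.
have e1 : 0 < Num.min 1 (e / (K + 1)).
  by rewrite lt_min ltr01 divr_gt0// ltr_pwDr.
have := step (Num.min 1 (e / (K + 1))); rewrite e1 ge_min lexx => /(_ isT) h.
have : Num.min 1 (e / (K + 1)) * K <= e.
  apply: (@le_trans _ _ (e / (K + 1) * K)).
    by rewrite ler_wpM2r// ge_min lexx orbT.
  rewrite mulrAC ler_pdivrMr ?ltr_pwDr//; nra.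
lra.
Qed.

End Subdifferential.

Section NormalCone.
Context {R : realType} {n : nat}.

Lemma normal_cone_monotone (C : set 'cV[R]_n) x y p q :
  normal_cone C x p -> normal_cone C y q -> 0 <= dot (p - q) (x - y).
Proof.
move=> [Cx hx] [Cy hy]; have := hx _ Cy; have := hy _ Cx.
rewrite !dotLE; lra.
Qed.

Lemma normal_cone_nonneg_closed (y a : nat -> 'cV[R]_n) y0 a0 :
  (forall k, normal_cone (@nonneg R n) (y k) (a k)) ->
  y @ \oo --> y0 -> a @ \oo --> a0 -> normal_cone (@nonneg R n) y0 a0.
Proof.
move=> h yl al; split.
  move=> j; move/cvg_colP : (yl) => /(_ j) yj.
  by apply: (cvgr_to_ge yj); apply: nearW => k; exact: (h k).1.
move=> z z0.
have cv : (fun k => dot (a k) (z - y k)) @ \oo --> dot a0 (z - y0).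
  under eq_cvg do rewrite dotE; rewrite dotE.
  by apply: continuous_wdot => //; apply: cvgB => //; exact: cvg_cst.
by apply: (cvgr_to_le cv); apply: nearW => k; exact: (h k).2.
Qed.

Lemma nonneg_resolvent (gam : R) (z : 'cV[R]_n) : 0 < gam ->
  exists y a, normal_cone (@nonneg R n) y a /\ z = y + gam *: a.
Proof.
move=> g0; exists (\col_i Num.max (z i 0) 0), (gam^-1 *: (\col_i Num.min (z i 0) 0)).
split; last first.
  rewrite scalerA mulfV ?gt_eqF// scale1r; apply/colP => i; rewrite !mxE.
  by rewrite addr_max_min addr0.
split=> [i|x x0]; first by rewrite mxE le_max lexx orbT.
rewrite dotZl mulr_ge0_le0 ?invr_ge0 ?(ltW g0)//.
apply: sumr_le0 => i _; rewrite !mxE; have := x0 i.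
by case: (leP (z i 0) 0) => zi xi; rewrite ?mul0r ?subr0// mulr_le0_ge0.
Qed.

End NormalCone.

(** * Zeros of strongly monotone inclusions *)

Section StronglyMonotone.
Context {R : realType} {n : nat}.

Lemma geometric_cvg (x : nat -> 'cV[R]_n) (q C : R) : 0 <= q < 1 ->
  (forall k, enorm (x k.+1 - x k) <= C * q ^+ k) -> exists l : 'cV[R]_n, x @ \oo --> l.
Proof.
move=> /andP[q0 q1] xC.
have cv i : cvgn (fun k => x k i 0).
  pose u k := x k.+1 i 0 - x k i 0.
  have C0 : 0 <= C.
    by have := xC 0%N; rewrite expr0 mulr1; apply: le_trans; exact: enorm_ge0.
  have su : cvgn (series u).
    apply: normed_cvg.
    apply: (@series_le_cvg _ _ (fun k => C * q ^+ k)) => [k|k|k|].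
    - exact: normr_ge0.
    - by rewrite mulr_ge0// exprn_ge0.
    - apply: le_trans (xC k); apply: le_trans (enorm_coord _ i).
      by rewrite !mxE.
    - by apply: is_cvg_geometric_series; rewrite ger0_norm.
  have -> : (fun k => x k i 0) = series u + cst (x 0%N i 0).
    apply/funext => k; change (x k i 0 = series u k + x 0%N i 0).
    have -> : series u k = x k i 0 - x 0%N i 0.
      exact: (telescope_sumr (fun k => x k i 0) (leq0n k)).
    by ring.
  by apply: is_cvgD => //; exact: is_cvg_cst.
exists (\col_i limn (fun k => x k i 0)); apply/cvg_colP => i; rewrite mxE.
exact: cv.
Qed.

(** The resolvent J is nonexpansive and the forward step contracts, so Banach iteration of x -> J (x
    - gam Phi x) converges; its fixed point solves the inclusion. *)
Lemma strongly_monotone_zero (T : 'cV[R]_n -> set 'cV[R]_n)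
    (Phi : 'cV[R]_n -> 'cV[R]_n) (eps M : R) :
  (forall y y' a a', T y a -> T y' a' -> 0 <= dot (a - a') (y - y')) ->
  (forall gam z, 0 < gam -> exists y a, T y a /\ z = y + gam *: a) ->
  0 < eps <= M ->
  (forall x y, eps * dot (x - y) (x - y) <= dot (Phi x - Phi y) (x - y)) ->
  lipschitz_with M Phi ->
  exists x, T x (- Phi x).
Proof.
move=> Tm Tr /andP[e0 eM] Ps Pl.
have M0 : 0 < M by exact: lt_le_trans eM.
(* Minimizes 1 - 2 gam eps + gam^2 M^2, with minimum 1 - (eps / M)^2; eps <= M keeps it
   nonnegative. *)
pose gam := eps / M ^+ 2.
have g0 : 0 < gam by rewrite divr_gt0// exprn_gt0.
have [J hJ] := choice (fun z => Tr gam z g0).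
have J1 z z' : dot (J z - J z') (J z - J z') <= dot (z - z') (z - z').
  have [a [Ta zE]] := hJ z; have [a' [Ta' zE']] := hJ z'.
  have -> : z - z' = (J z - J z') + gam *: (a - a').
    by rewrite {1}zE {1}zE'; apply/colP => i; rewrite !mxE; ring.
  have h := Tm _ _ _ _ Ta Ta'.
  move: (J z - J z') (a - a') h => y b h.
  rewrite !dotLE (dotC y b); have := dot_ge0 b.
  have := mulr_ge0 (ltW g0) h; nra.
pose kap := 1 - (eps / M) ^+ 2.
have r1 : eps / M <= 1 by rewrite ler_pdivrMr// mul1r.
have r0 : 0 < eps / M by rewrite divr_gt0.
have k0 : 0 <= kap by rewrite subr_ge0 expr_le1// ltW.
have k1 : kap < 1 by rewrite ltrBlDr ltrDl exprn_gt0.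
pose S x := J (x - gam *: Phi x).
have S1 x y : dot (S x - S y) (S x - S y) <= kap * dot (x - y) (x - y).
  apply: le_trans (J1 _ _) _.
  have -> : x - gam *: Phi x - (y - gam *: Phi y) =
      (x - y) - gam *: (Phi x - Phi y).
    by apply/colP => i; rewrite !mxE; ring.
  have h1 := Ps x y.
  have h2 : dot (Phi x - Phi y) (Phi x - Phi y) <= M ^+ 2 * dot (x - y) (x - y).
    rewrite -!sqr_enorm -exprMn; apply: lerXn2r; last exact: Pl.
      by rewrite nnegrE enorm_ge0.
    by rewrite nnegrE mulr_ge0 ?enorm_ge0// ltW.
  move: (x - y) (Phi x - Phi y) h1 h2 => f e h1 h2.
  rewrite !dotLE (dotC f e).
  have h3 := ler_wpM2l (ltW g0) h1.
  have h4 := ler_wpM2l (sqr_ge0 gam) h2.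
  have E1 : gam * eps = (eps / M) ^+ 2 by rewrite /gam; field; rewrite gt_eqF.
  have E2 : gam ^+ 2 * M ^+ 2 = (eps / M) ^+ 2 by rewrite /gam; field; rewrite gt_eqF.
  rewrite !mulrA E1 in h3; rewrite mulrA E2 in h4.
  rewrite /kap; move: h4; rewrite expr2; lra.
pose q := Num.sqrt kap.
have q0 : 0 <= q by exact: sqrtr_ge0.
have q1 : q < 1 by rewrite -sqrtr1 ltr_sqrt.
have S2 x y : enorm (S x - S y) <= q * enorm (x - y).
  by rewrite /enorm -sqrtrM//; apply: ler_wsqrtr; exact: S1.
pose x k := iter k S 0.
have [l xl] : exists l : 'cV[R]_n, x @ \oo --> l.
  apply: (@geometric_cvg x q (enorm (x 1%N - x 0%N))); first by rewrite q0.
  elim=> [|k ih]; first by rewrite expr0 mulr1.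
  apply: le_trans (S2 _ _) _; rewrite exprS mulrCA; exact: ler_wpM2l.
have Sl : S l = l.
  apply/eqP; rewrite -subr_eq0; apply/eqP; apply: (@enorm_eq0 R n).
  have xS : (fun k => S l - x k.+1) @ \oo --> S l - l.
    by apply: cvgB; [exact: cvg_cst|rewrite cvg_shiftS].
  have x0 : (fun k => l - x k) @ \oo --> l - l.
    by apply: cvgB => //; exact: cvg_cst.
  have nc (y : nat -> 'cV[R]_n) a : y @ \oo --> a -> enorm (y k) @[k --> \oo] --> enorm a.
    move=> ya; rewrite enormE; under eq_cvg do rewrite enormE.
    apply: (continuous_cvg (h := @Num.sqrt R) _ (@sqrt_continuous R _)).
    exact: continuous_wdot.
  have h1 := nc _ _ xS; have h2 := nc _ _ x0.
  rewrite subrr in h2; rewrite /enorm dot0l sqrtr0 in h2.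
  have h3 : q * enorm (l - x k) @[k --> \oo] --> q * 0 by exact: cvgMl_tmp.
  apply/eqP; rewrite eq_le enorm_ge0 andbT -(mulr0 q).
  rewrite -(cvg_lim _ h1)// -(cvg_lim _ h3)//.
  apply: ler_lim; [exact: cvgP h1|exact: cvgP h3|].
  by apply: nearW => k; exact: S2.
have [a [Ta lE]] := hJ (l - gam *: Phi l).
rewrite -/(S l) Sl in Ta lE.
exists l; suff -> : - Phi l = a by [].
have : gam *: (- Phi l) = gam *: a.
  by rewrite scalerN; apply: (addrI l); rewrite -lE.
by move=> /(scalerI (lt0r_neq0 g0)).
Qed.

End StronglyMonotone.

Section Blocks.
Context {R : realType} {N : nat} {d : 'I_N -> nat}.
Implicit Types x y : 'cV[R]_(blockdim d).

Lemma dot_blocks x y : dot x y = \sum_i dot (submxcol x i) (submxcol y i).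
Proof.
have dM n (a c : 'cV[R]_n) : dot a c = (a^T *m c) 0 0.
  by rewrite mxE; apply: eq_bigr => i _; rewrite mxE.
rewrite dM -{1}(submxcolK x) -{1}(submxcolK y) tr_mxcol mul_mxrow_mxcol summxE.
by apply: eq_bigr => i _; rewrite dM.
Qed.

Lemma submxcolE x i j : submxcol x i j 0 = x (tagnat.Rank i j) 0.
Proof. by rewrite mxE. Qed.

Lemma blockE x l : x l 0 = submxcol x (tagnat.sig1 l) (tagnat.sig2 l) 0.
Proof. by rewrite -{1}(submxcolK x) mxcolE. Qed.

Lemma submxcolD' x y i : submxcol (x + y) i = submxcol x i + submxcol y i.
Proof. by apply/colP => j; rewrite !mxE. Qed.

Lemma submxcolN' x i : submxcol (- x) i = - submxcol x i.
Proof. by apply/colP => j; rewrite !mxE. Qed.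

Lemma submxcolB' x y i : submxcol (x - y) i = submxcol x i - submxcol y i.
Proof. by rewrite submxcolD' submxcolN'. Qed.

Lemma submxcol_cvg T (F : set_system T) {FF : Filter F}
    (x : T -> 'cV[R]_(blockdim d)) x0 i :
  x @ F --> x0 -> submxcol (x t) i @[t --> F] --> submxcol x0 i.
Proof.
move=> /cvg_colP xc; apply/cvg_colP => j; rewrite submxcolE.
by under eq_cvg do rewrite submxcolE; exact: xc.
Qed.

Variable g : forall i, 'cV[R]_(d i) -> \bar R.
Arguments g : clear implicits.
Hypotheses (g_prop : forall i, proper_function (g i))
  (g_conv : forall i, econvex_function (g i))
  (g_lsc : forall i, lower_semicontinuous (g i))
  (g_comp : forall i, compact (edom (g i))).

Definition subdiff_blocks x : set 'cV[R]_(blockdim d) :=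
  [set a | forall i, subdiff (g i) (submxcol x i) (submxcol a i)].

Lemma subdiff_blocks_monotone x y a c : subdiff_blocks x a -> subdiff_blocks y c ->
  0 <= dot (a - c) (x - y).
Proof.
move=> xa yc; rewrite dot_blocks; apply: sumr_ge0 => i _.
by rewrite !submxcolB'; exact: subdiff_monotone (xa i) (yc i).
Qed.

Lemma subdiff_blocks_closed (y a : nat -> 'cV[R]_(blockdim d)) y0 a0 :
  (forall k, subdiff_blocks (y k) (a k)) -> y @ \oo --> y0 -> a @ \oo --> a0 ->
  subdiff_blocks y0 a0.
Proof.
move=> ya yc ac i.
apply: (subdiff_closed (g_prop i) (@g_lsc i) (y := fun k => submxcol (y k) i)
  (a := fun k => submxcol (a k) i)).
- by move=> k; exact: ya.
- exact: submxcol_cvg.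
- exact: submxcol_cvg.
Qed.

Lemma subdiff_blocks_bounded : exists2 M : R, 0 <= M &
  forall x a, subdiff_blocks x a -> forall l, `|x l 0| <= M.
Proof.
pose Mi i := sval (cid2 (edom_bounded (@g_comp i))).
have Mi0 i : 0 <= Mi i by rewrite /Mi; case: cid2.
exists (\sum_i Mi i); first exact: sumr_ge0.
move=> x a xa l; rewrite blockE (bigD1 (tagnat.sig1 l))//=.
apply: (@le_trans _ _ (Mi (tagnat.sig1 l))); last by rewrite lerDl sumr_ge0.
rewrite /Mi; case: cid2 => M M0 /= h.
by apply: h; exact: subdiff_edom (xa _).
Qed.

Lemma subdiff_blocks_resolvent gam z : 0 < gam ->
  exists y a, subdiff_blocks y a /\ z = y + gam *: a.
Proof.
move=> g0.
have P i := cid (prox_exists (g_prop i) (@g_conv i) (@g_lsc i) (@g_comp i)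
  (submxcol z i) g0).
pose Q i := cid (svalP (P i)).
exists (\mxcol_i sval (P i)), (\mxcol_i sval (Q i)); split.
  by move=> i; rewrite !mxcolK; have [] := svalP (Q i).
apply/colP => l; rewrite blockE; have [_ ->] := svalP (Q (tagnat.sig1 l)).
by rewrite !mxE.
Qed.

End Blocks.

Lemma usubmxB (R : realType) n1 n2 (x y : 'cV[R]_(n1 + n2)) :
  usubmx (x - y) = usubmx x - usubmx y.
Proof. by apply/colP => i; rewrite !mxE. Qed.

Lemma dsubmxB (R : realType) n1 n2 (x y : 'cV[R]_(n1 + n2)) :
  dsubmx (x - y) = dsubmx x - dsubmx y.
Proof. by apply/colP => i; rewrite !mxE. Qed.

Lemma usubmx_cvg (R : realType) n1 n2 (T : Type) (G : set_system T) {FG : Filter G}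
    (x : T -> 'cV[R]_(n1 + n2)) (l : 'cV[R]_(n1 + n2)) :
  x @ G --> l -> usubmx (x t) @[t --> G] --> usubmx l.
Proof.
move=> /cvg_colP xl; apply/cvg_colP => i; rewrite mxE.
by under eq_cvg do rewrite mxE; exact: xl.
Qed.

Lemma dsubmx_cvg (R : realType) n1 n2 (T : Type) (G : set_system T) {FG : Filter G}
    (x : T -> 'cV[R]_(n1 + n2)) (l : 'cV[R]_(n1 + n2)) :
  x @ G --> l -> dsubmx (x t) @[t --> G] --> dsubmx l.
Proof.
move=> /cvg_colP xl; apply/cvg_colP => i; rewrite mxE.
by under eq_cvg do rewrite mxE; exact: xl.
Qed.

Lemma coupling_trmx (R : realType) N m (d : 'I_N -> nat)
    (D : forall i, 'M[R]_(m, d i)) (lam : 'cV[R]_m) i :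
  submxcol ((coupling D)^T *m lam) i = (D i)^T *m lam.
Proof.
rewrite /coupling tr_mxrow; apply/colP => j.
rewrite submxcolE 2!mxE; apply: eq_bigr => k _; congr (_ * _).
by rewrite -[in RHS](mxcolK (fun i => (D i)^T) i) [in RHS]mxE.
Qed.

(** * Existence of a v-GNE *)

Section Existence.
Context {R : realType} {N m : nat} {d : 'I_N -> nat}.
Variables (f : 'I_N -> 'cV[R]_(blockdim d) -> R) (g : forall i, 'cV[R]_(d i) -> \bar R)
  (D : forall i, 'M[R]_(m, d i)) (b : 'I_N -> 'cV[R]_m) (ell : R).
Arguments g : clear implicits.
Hypotheses (g_prop : forall i, proper_function (g i))
  (g_conv : forall i, econvex_function (g i))
  (g_lsc : forall i, lower_semicontinuous (g i))
  (g_comp : forall i, compact (edom (g i))).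
Hypotheses (slater : Slater g D b) (F_mono : monotone_map (pseudogradient f))
  (ell0 : 0 <= ell) (F_lip : lipschitz_with ell (pseudogradient f)).
Let F := pseudogradient f.
Let B := coupling D.
Let bs := \sum_i b i.
Notation st := 'cV[R]_(blockdim d + m).

(** The KKT operator with one multiplier shared by all agents, plus eps times the identity. The
    multiplier terms are skew and F is merely monotone, so eps supplies the strong monotonicity. *)
Let Phi (eps : R) (z : st) : st :=
  col_mx (F (usubmx z) + B^T *m dsubmx z) (bs - B *m usubmx z) + eps *: z.
Let T2 (z : st) : set st := [set a | subdiff_blocks g (usubmx z) (usubmx a) /\
   normal_cone (@nonneg R m) (dsubmx z) (dsubmx a)].

Lemma dot_submx n1 n2 (x y : 'cV[R]_(n1 + n2)) :
  dot x y = dot (usubmx x) (usubmx y) + dot (dsubmx x) (dsubmx y).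
Proof. by rewrite -{1}(vsubmxK x) -{1}(vsubmxK y) dot_col_mx. Qed.

Lemma enorm_usubmx n1 n2 (x : 'cV[R]_(n1 + n2)) : enorm (usubmx x) <= enorm x.
Proof. by rewrite /enorm; apply: ler_wsqrtr; rewrite [leRHS]dot_submx lerDl dot_ge0. Qed.

Lemma enorm_dsubmx n1 n2 (x : 'cV[R]_(n1 + n2)) : enorm (dsubmx x) <= enorm x.
Proof. by rewrite /enorm; apply: ler_wsqrtr; rewrite [leRHS]dot_submx lerDr dot_ge0. Qed.

Lemma enorm_col_mx n1 n2 (x : 'cV[R]_n1) (y : 'cV[R]_n2) :
  enorm (col_mx x y) <= enorm x + enorm y.
Proof.
have -> : col_mx x y = col_mx x 0 + col_mx 0 y by rewrite add_col_mx addr0 add0r.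
apply: le_trans (enormD _ _) _; rewrite /enorm !dot_col_mx !dot0l addr0 add0r.
exact: lexx.
Qed.

Let PhiB eps x y : Phi eps x - Phi eps y =
  col_mx ((F (usubmx x) - F (usubmx y)) + B^T *m dsubmx (x - y))
         (- (B *m usubmx (x - y))) + eps *: (x - y).
Proof.
rewrite /Phi opprD addrACA scalerBr opp_col_mx add_col_mx.
rewrite dsubmxB usubmxB !mulmxBr opprD addrACA.
congr (col_mx _ _ + _); rewrite !opprB addrC addrA subrK //.
Qed.

Let Phi_mono eps x y : 0 < eps ->
  eps * dot (x - y) (x - y) <= dot (Phi eps x - Phi eps y) (x - y).
Proof.
move=> e0.
have -> : Phi eps x - Phi eps y =
    col_mx ((F (usubmx x) - F (usubmx y)) + B^T *m dsubmx (x - y))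
           (- (B *m usubmx (x - y))) + eps *: (x - y).
  exact: PhiB.
rewrite dotDl dotZl lerDr dot_submx col_mxKu col_mxKd dotDl dotNl.
rewrite (dot_mulmx B^T) trmxK (dotC (B *m _)).
have := F_mono (usubmx x) (usubmx y); rewrite -usubmxB -/F.
lra.
Qed.

Let Phi_lip eps : 0 < eps ->
  lipschitz_with (ell + 2 * spectral_norm B + eps) (Phi eps).
Proof.
move=> e0 x y.
have -> : Phi eps x - Phi eps y =
    col_mx ((F (usubmx x) - F (usubmx y)) + B^T *m dsubmx (x - y))
           (- (B *m usubmx (x - y))) + eps *: (x - y).
  exact: PhiB.
apply: le_trans (enormD _ _) _; rewrite enormZ gtr0_norm// mulrDl lerD2r.
apply: le_trans (enorm_col_mx _ _) _; rewrite enormN.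
have h1 := F_lip (usubmx x) (usubmx y).
have h2 := spectral_normP_trmx B (dsubmx (x - y)).
have h3 := spectral_normP B (usubmx (x - y)).
have h4 := enormD (F (usubmx x) - F (usubmx y)) (B^T *m dsubmx (x - y)).
have h5 := ler_wpM2l ell0 (enorm_usubmx (x - y)).
have h6 := ler_wpM2l (spectral_norm_ge0 B) (enorm_usubmx (x - y)).
have h7 := ler_wpM2l (spectral_norm_ge0 B) (enorm_dsubmx (x - y)).
rewrite -usubmxB -/F in h1; lra.
Qed.

Let regular eps : 0 < eps -> exists z, T2 z (- Phi eps z).
Proof.
move=> e0.
apply: (@strongly_monotone_zero _ _ T2 (Phi eps) eps (ell + 2 * spectral_norm B + eps)).
- move=> y y' a a' [h1 h2] [h3 h4]; rewrite dot_submx !usubmxB !dsubmxB.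
  apply: addr_ge0; first exact: subdiff_blocks_monotone h1 h3.
  exact: normal_cone_monotone h2 h4.
- move=> gam z g0.
  have [y1 [a1 [h1 z1]]] :=
    subdiff_blocks_resolvent g_prop g_conv g_lsc g_comp (usubmx z) g0.
  have [y2 [a2 [h2 z2]]] := nonneg_resolvent (dsubmx z) g0.
  exists (col_mx y1 y2), (col_mx a1 a2); split.
    by rewrite /T2 /= !col_mxKu !col_mxKd.
  by rewrite scale_col_mx add_col_mx -z1 -z2 vsubmxK.
- by rewrite e0 lerDr addr_ge0// mulr_ge0// spectral_norm_ge0.
- by move=> x y; exact: Phi_mono.
- exact: Phi_lip.
Qed.

(* The Slater point bounds the multipliers uniformly in the regularization. *)
Let multiplier_bound : exists M : R, forall eps z, 0 < eps <= 1 ->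
  T2 z (- Phi eps z) -> forall i, `|z i 0| <= M.
Proof.
have [us [gus sl]] := slater.
have [M1 M10 uM] := subdiff_blocks_bounded g_prop g_comp.
(* Any point with a subgradient serves: it gives an affine minorant of the sum of the g_i, hence a
   lower bound on the bounded domain. *)
have [y0 [a0 [h0 _]]] := subdiff_blocks_resolvent g_prop g_conv g_lsc g_comp 0 ltr01.
pose E := \sum_(l < blockdim d) M1.
have E0 : 0 <= E by apply: sumr_ge0.
have enE (u : 'cV[R]_(blockdim d)) : (forall l, `|u l 0| <= M1) -> enorm u <= E.
  move=> uM1.
  have uE0 : u = \sum_l u l 0 *: delta_mx l 0.
    apply/colP => l; rewrite summxE [RHS](bigD1 l)//= [X in _ + X]big1 => [|k kl].
      by rewrite !mxE !eqxx mulr1 addr0.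
    by rewrite !mxE eq_sym (negbTE kl) mulr0.
  rewrite {1}uE0.
  apply: (@le_trans _ _ (\sum_l enorm (u l 0 *: (delta_mx l 0 : 'cV[R]_(blockdim d))))).
    apply: (big_ind2 (fun (x : 'cV[R]_(blockdim d)) (y : R) => enorm x <= y))
        => [|x1 x2 y1 y2 h1 h2|//].
      by rewrite /enorm dot0l sqrtr0.
    by apply: le_trans (enormD _ _) _; exact: lerD.
  apply: ler_sum => l _; rewrite enormZ.
  have -> : enorm (delta_mx l 0 : 'cV[R]_(blockdim d)) = 1.
    by rewrite /enorm dot_delta mxE !eqxx sqrtr1.
  by rewrite mulr1.
have uE u a : subdiff_blocks g u a -> enorm u <= E.
  by move=> ua; apply: enE => l; exact: uM ua l.
pose G u := \sum_i fine (g i (submxcol u i)).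
(* From the subgradient inequality at u tested at the Slater point: the first three terms bound G us
   - G u, the product bounds <F u + eps u, us - u>. *)
pose C0 := G us - G y0 + enorm a0 * (2 * E)
  + (enorm (F us) + ell * (E + enorm us) + E) * (enorm us + E).
pose s j := - (B *m us - bs) j 0.
have s0 j : 0 < s j by rewrite oppr_gt0; exact: sl.
pose C := \sum_j (s j)^-1 * C0.
have key eps z : 0 < eps <= 1 -> T2 z (- Phi eps z) ->
    \sum_j s j * dsubmx z j 0 <= C0.
  move=> /andP[e0 e1] [hu [hl0 hl]].
  set u := usubmx z in hu *; set lam := dsubmx z in hl0 hl *.
  have au : usubmx (- Phi eps z) = - (F u + B^T *m lam + eps *: u).
    by rewrite /Phi linearN linearD linearZ /= col_mxKu.
  have al : dsubmx (- Phi eps z) = - (bs - B *m u + eps *: lam).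
    by rewrite /Phi linearN linearD linearZ /= col_mxKd.
  rewrite au in hu; rewrite al in hl.
  have sub (v v' a : 'cV[R]_(blockdim d)) : subdiff_blocks g v a ->
      (forall i, edom (g i) (submxcol v' i)) -> G v + dot a (v' - v) <= G v'.
    move=> va gv; rewrite dot_blocks -big_split; apply: ler_sum => i _ /=.
    rewrite submxcolB'; apply: subdiff_fine => //; exact: va.
  have h1 := sub _ us _ hu gus.
  have h2 := sub _ u _ h0 (fun i => subdiff_edom (g_prop i) (hu i)).
  have eu := uE _ _ hu; have ey := uE _ _ h0.
  have h3 : - (enorm a0 * (2 * E)) <= dot a0 (u - y0).
    have := dot_le a0 (u - y0); rewrite ler_norml => /andP[h _].
    apply: le_trans h; rewrite lerN2 ler_wpM2l ?enorm_ge0//.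
    have := enormD u (- y0); rewrite enormN; lra.
  have h4 : dot (F u + eps *: u) (us - u) <=
      (enorm (F us) + ell * (E + enorm us) + E) * (enorm us + E).
    apply: le_trans (ler_norm _) _; apply: le_trans (dot_le _ _) _.
    apply: ler_pM; rewrite ?enorm_ge0//; last first.
      have := enormD us (- u); rewrite enormN; lra.
    apply: le_trans (enormD _ _) _; rewrite enormZ gtr0_norm//; apply: lerD.
      have -> : F u = F us + (F u - F us) by rewrite addrC subrK.
      apply: le_trans (enormD _ _) _; rewrite lerD2l.
      apply: le_trans (F_lip _ _) _; apply: ler_wpM2l => //.
      have := enormD u (- us); rewrite enormN; lra.
    have := enorm_ge0 u; nra.
  (* Testing the normal cone at 0 gives <lam, bs - B u> <= - eps |lam|^2 <= 0, so what remains of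
     <B^T lam, us - u> is the Slater slack paired with lam. *)
  have h5 : dot (- (bs - B *m u + eps *: lam)) (- lam) <= 0.
    have z0 : nonneg (0 : 'cV[R]_m) by move=> j; rewrite mxE.
    by have := hl _ z0; rewrite sub0r.
  have h6 : \sum_j s j * lam j 0 = - dot lam (B *m us - bs).
    by rewrite /dot -sumrN; apply: eq_bigr => j _; rewrite /s; ring.
  have h7 : dot (B^T *m lam) (us - u) = dot lam (B *m us - bs) + dot lam (bs - B *m u).
    rewrite (dot_mulmx B^T) trmxK -dotDr; congr dot.
    by rewrite mulmxBr addrA subrK.
  have h8 : 0 <= eps * dot lam lam by rewrite mulr_ge0 ?dot_ge0// ltW.
  move: h5; rewrite dotNl dotNr opprK dotDl dotZl (dotC _ lam) => h5.
  move: h1; rewrite dotNl (addrAC (F u)) dotDl h7 => h1.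
  rewrite h6 /C0; lra.
exists (M1 + \sum_j (s j)^-1 * C0) => eps z e01 hz i.
have C00 : 0 <= C0.
  apply: le_trans (key _ _ e01 hz); apply: sumr_ge0 => j _.
  by rewrite mulr_ge0// ?(ltW (s0 j))//; exact: hz.2.1.
have sC j : 0 <= (s j)^-1 * C0 by rewrite mulr_ge0// invr_ge0 ltW.
rewrite -(vsubmxK z) -(splitK i); case: (fintype.split i) => j /=.
  rewrite col_mxEu; apply: le_trans (uM _ _ hz.1 j) _.
  by rewrite lerDl sumr_ge0.
rewrite col_mxEd; have l0 : 0 <= dsubmx z j 0 by exact: hz.2.1.
rewrite ger0_norm//.
apply: (@le_trans _ _ ((s j)^-1 * C0)); last first.
  by rewrite (bigD1 j)//= addrA addrAC lerDr addr_ge0// sumr_ge0.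
rewrite ler_pdivlMl//; apply: le_trans (key _ _ e01 hz).
rewrite (bigD1 j)//= lerDl; apply: sumr_ge0 => k _.
by rewrite mulr_ge0// ?(ltW (s0 k))//; exact: hz.2.1.
Qed.

Lemma vGNE_exists : exists u, vGNE f g D b u.
Proof.
have [M zM] := multiplier_bound.
have e01 k : 0 < (k.+1%:R^-1 : R) <= 1 by rewrite invr_gt0 ltr0n invf_le1// ler1n.
have e0 k : 0 < k.+1%:R^-1 :> R by have /andP[] := e01 k.
have [z hz] := choice (fun k => regular (e0 k)).
have [l [h [hk zl]]] := bounded_cvg_subseq (fun k => zM _ _ (e01 k) (hz k)).
have cPhi : - Phi (h k).+1%:R^-1 (z (h k)) @[k --> \oo] --> - Phi 0 l.
  (* [Phi_lip] is stated for positive eps, so the passage to eps = 0 goes through Phi 1. *)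
  have E eps x : - Phi eps x = - Phi 1 x - (eps - 1) *: x.
    rewrite /Phi scale1r; move: (col_mx _ _) => w.
    by apply/colP => i; rewrite !mxE; ring.
  have c0 : 0 <= ell + 2 * spectral_norm B + 1.
    by rewrite !addr_ge0 ?mulr_ge0 ?spectral_norm_ge0.
  have c1 := lipschitz_cvg c0 (Phi_lip ltr01) zl.
  rewrite E; under eq_cvg do rewrite E.
  have ck : ((h k).+1%:R^-1 - 1 : R) @[k --> \oo] --> (0 - 1 : R).
    apply: cvgB; last exact: cvg_cst.
    exact: (cvg_subseq hk (@cvg_harmonic R)).
  by apply: cvgB; [exact: (cvgN (c1 _))|exact: (cvgZ ck zl)].
have T2l : T2 l (- Phi 0 l).
  split.
    apply: (subdiff_blocks_closed g_prop g_lsc (y := fun k => usubmx (z (h k)))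
      (a := fun k => usubmx (- Phi (h k).+1%:R^-1 (z (h k))))).
    - by move=> k; exact: (hz (h k)).1.
    - exact: usubmx_cvg.
    - exact: usubmx_cvg.
  apply: (normal_cone_nonneg_closed (y := fun k => dsubmx (z (h k)))
    (a := fun k => dsubmx (- Phi (h k).+1%:R^-1 (z (h k))))).
  - by move=> k; exact: (hz (h k)).2.
  - exact: dsubmx_cvg.
  - exact: dsubmx_cvg.
have [h1 h2] := T2l.
exists (usubmx l), (dsubmx l); split; first exact: h2.1.
- move=> i; exists (submxcol (usubmx (- Phi 0 l)) i); first exact: h1.
  rewrite /Phi scale0r addr0 opp_col_mx col_mxKu submxcolN' submxcolD' coupling_trmx.
  rewrite [in X in _ = X + _](_ : partial_grad i (f i) _ = submxcol (F (usubmx l)) i).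
    by apply/colP => j; rewrite !mxE; ring.
  by rewrite /F /pseudogradient mxcolK.
- exists (dsubmx (- Phi 0 l)); first exact: h2.
  by rewrite /Phi scale0r addr0 opp_col_mx col_mxKd opprB subrr.
Qed.

End Existence.

(** * The network and the zeros of V + T *)

Section DiagonalMatrices.
Context {R : realType}.

Lemma eq_mulmx_cV m n (A B : 'M[R]_(m, n)) :
  (forall x : 'cV[R]_n, A *m x = B *m x) -> A = B.
Proof.
move=> AB; apply/matrixP => i j.
have := congr1 (fun M : 'cV[R]_m => M i 0) (AB (delta_mx j 0)).
by rewrite -!colE !mxE.
Qed.

Lemma diag_mx_cV n (c : 'rV[R]_n) (x : 'cV[R]_n) i :
  (diag_mx c *m x) i 0 = c 0 i * x i 0.
Proof. by rewrite mul_diag_mx mxE. Qed.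

Lemma invmx_diag n (c : 'rV[R]_n) : (forall i, c 0 i != 0) ->
  invmx (diag_mx c) = diag_mx (\row_i (c 0 i)^-1).
Proof.
move=> c0.
have E : diag_mx c *m diag_mx (\row_i (c 0 i)^-1) = 1%:M.
  apply: eq_mulmx_cV => x; rewrite mul1mx -mulmxA; apply/colP => i.
  by rewrite !diag_mx_cV mxE mulrA mulfV// mul1r.
have [U _] := mulmx1_unit E.
by rewrite -[LHS]mulmx1 -E mulmxA mulVmx// mul1mx.
Qed.

(** Each entry is an eigenvalue, and positivity bounds all eigenvalues below, so the infimum is a
    genuine one. *)
Lemma min_eigenvalue_diag n (c : 'rV[R]_n) : (forall i, 0 < c 0 i) ->
  forall i, min_eigenvalue (diag_mx c) <= c 0 i.
Proof.
move=> c0 i; apply: ge_inf.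
  exists 0 => a /eigenvalueP[v vE v0].
  have [j vj] : exists j, v 0 j != 0.
    apply: contrapT => /forallNP h; move/eqP: v0; apply; apply/rowP => j.
    by rewrite mxE; apply/eqP/negPn/negP; exact: h.
  have := congr1 (fun M : 'rV[R]_n => M 0 j) vE.
  rewrite mul_mx_diag !mxE mulrC => /(mulIf vj).
  by move=> <-; rewrite ltW.
apply/eigenvalueP; exists (delta_mx 0 i).
  apply/rowP => j; rewrite mul_mx_diag !mxE eqxx /=.
  by case: eqP => [->|_]; rewrite ?mulr1n ?mul1r ?mulr1 // mul0r mulr0.
apply/eqP => /rowP/(_ i); rewrite !mxE !eqxx => /eqP.
by rewrite oner_eq0.
Qed.

Lemma stepsize_diag N (p : 'I_N -> nat) (c : 'I_N -> R) :
  stepsize_mx p c = diag_mx (\row_l c (tagnat.sig1 l)).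
Proof.
apply: eq_mulmx_cV => x; apply/colP => l; rewrite diag_mx_cV mxE.
rewrite -{1}(submxcolK x) mul_mxdiag_mxcol mxcolE mul_scalar_mx mxE.
by rewrite (blockE x).
Qed.

Definition Psi_row N m (d : 'I_N -> nat) (gam sig tau : 'I_N -> R) :
    'rV[R]_(blockdim d + (repdim N m + repdim N m)) :=
  row_mx (\row_l (gam (tagnat.sig1 l))^-1)
    (row_mx (\row_l (sig (tagnat.sig1 l))^-1) (\row_l (tau (tagnat.sig1 l))^-1)).

Lemma Psi_diag N m (d : 'I_N -> nat) (gam sig tau : 'I_N -> R) :
  (forall i, 0 < gam i) -> (forall i, 0 < sig i) -> (forall i, 0 < tau i) ->
  Psi (m := m) (d := d) gam sig tau = diag_mx (Psi_row m d gam sig tau).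
Proof.
move=> g0 s0 t0; rewrite /Psi /Psi_row !diag_mx_row !stepsize_diag.
rewrite !invmx_diag => [|i|i|i]; rewrite ?mxE ?gt_eqF//.
congr (block_mx (diag_mx _) _ _ (block_mx (diag_mx _) _ _ (diag_mx _)));
  by apply/rowP => l; rewrite !mxE.
Qed.

Lemma Psi_row_gt0 N m (d : 'I_N -> nat) (gam sig tau : 'I_N -> R) :
  (forall i, 0 < gam i) -> (forall i, 0 < sig i) -> (forall i, 0 < tau i) ->
  forall l, 0 < Psi_row m d gam sig tau 0 l.
Proof.
move=> g0 s0 t0 l; rewrite /Psi_row.
rewrite -(splitK l); case: (fintype.split l) => j /=;
  rewrite ?row_mxEl ?row_mxEr ?mxE ?invr_gt0//.
by case: (fintype.split j) => k; rewrite mxE invr_gt0.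
Qed.

End DiagonalMatrices.

(** * The graph Laplacian: kernel, range and Kronecker product *)

Section Laplacian.
Context {R : realType} {N : nat}.
Variable W : 'M[R]_N.
Hypotheses (W0 : forall i j, 0 <= W i j) (Wsym : W^T = W) (Wirr : ~ reducible W).
Let L := laplacian W.

Let WC i j : W i j = W j i.
Proof. by rewrite -{1}Wsym mxE. Qed.

Lemma laplacian_mul (z : 'cV[R]_N) i : (L *m z) i 0 = \sum_j W i j * (z i 0 - z j 0).
Proof.
rewrite /L /laplacian mulmxBl mxE diag_mx_cV !mxE big_distrl -sumrB /=.
by apply: eq_bigr => j _; rewrite mxE mulr1 mulrBr.
Qed.

Lemma laplacian_sym : L^T = L.
Proof. by rewrite /L /laplacian linearB /= tr_diag_mx Wsym. Qed.

(** Averages the double sum with its image under the exchange of i and j, which symmetry of W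
    permits. *)
Lemma laplacian_quad (z : 'cV[R]_N) :
  dot z (L *m z) = 2^-1 * \sum_i \sum_j W i j * (z i 0 - z j 0) ^+ 2.
Proof.
have E1 : dot z (L *m z) = \sum_i \sum_j W i j * (z i 0 * (z i 0 - z j 0)).
  rewrite /dot; apply: eq_bigr => i _; rewrite laplacian_mul big_distrr /=.
  by apply: eq_bigr => j _; ring.
have E2 : dot z (L *m z) = \sum_i \sum_j W i j * (z j 0 * (z j 0 - z i 0)).
  rewrite E1 exchange_big /=; apply: eq_bigr => i _; apply: eq_bigr => j _.
  by rewrite WC.
have E3 : \sum_i \sum_j W i j * (z i 0 - z j 0) ^+ 2 =
    dot z (L *m z) + dot z (L *m z).
  rewrite {1}E1 E2 -big_split; apply: eq_bigr => i _.
  by rewrite -big_split; apply: eq_bigr => j _ /=; ring.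
by rewrite E3; field.
Qed.

Lemma laplacian_psd (z : 'cV[R]_N) : 0 <= dot z (L *m z).
Proof.
rewrite laplacian_quad mulr_ge0 ?invr_ge0//.
by apply: sumr_ge0 => i _; apply: sumr_ge0 => j _; rewrite mulr_ge0 ?sqr_ge0.
Qed.

(* If z is not constant, its level set through i0 and the complement split the
   graph into two disconnected parts. *)
Lemma laplacian_kernel (z : 'cV[R]_N) : L *m z = 0 -> forall i j, z i 0 = z j 0.
Proof.
move=> Lz0 i0 j0; apply: contrapT => zij; apply: Wirr.
(* A vanishing sum of nonnegative terms: z agrees across every edge. *)
have W00 i j : W i j * (z i 0 - z j 0) ^+ 2 = 0.
  have q0 : \sum_i \sum_j W i j * (z i 0 - z j 0) ^+ 2 = 0.
    have := laplacian_quad z; rewrite Lz0 dot0r => /esym/eqP.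
    by rewrite mulf_eq0 invr_eq0 pnatr_eq0 /= => /eqP.
  have p k l : 0 <= W k l * (z k 0 - z l 0) ^+ 2 by rewrite mulr_ge0 ?sqr_ge0.
  have p' k : 0 <= \sum_l W k l * (z k 0 - z l 0) ^+ 2 by exact: sumr_ge0.
  apply/eqP; rewrite eq_le p andbT -q0 (bigD1 i)//= (bigD1 j)//= -addrA lerDl.
  by rewrite addr_ge0 ?sumr_ge0.
pose S := [set k | z k 0 == z i0 0]%SET.
(* Listing the level set before its complement defines the permutation; the rows from #|S| on then
   belong to the complement. *)
pose e := enum S ++ enum (~: S).
have se : size e = N by rewrite size_cat -!cardE cardsC card_ord.
have ue : uniq e.
  rewrite cat_uniq !enum_uniq andbT /=; apply/hasPn => k.
  by rewrite !mem_enum inE.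
pose s (i : 'I_N) := nth i0 e i.
have sinj : injective s.
  move=> i j /eqP; rewrite nth_uniq ?se// => /eqP; exact: val_inj.
have sS (i : 'I_N) : (i < #|S|)%N = (s i \in S).
  rewrite /s /e nth_cat -cardE; case: ltnP => h.
    by rewrite -mem_enum mem_nth// -cardE.
  have : nth i0 (enum (~: S)) (i - #|S|) \in enum (~: S).
    rewrite mem_nth// -(ltn_add2l #|S|) subnKC//.
    by rewrite [X in (_ < X + _)%N]cardE -size_cat se.
  by rewrite mem_enum inE => /negbTE.
exists (perm sinj), #|S|; split.
  apply/andP; split; first by apply/card_gt0P; exists i0; rewrite inE.
  rewrite -[X in (_ < X)%N](card_ord N); apply: proper_card; apply/properP; split.
    by apply/fintype.subsetP.
  by exists j0 => //; rewrite inE; apply/eqP => h; exact: zij.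
move=> i j Si Sj; rewrite !permE.
have hj : s j \in S by rewrite -sS.
have hi : s i \notin S by rewrite -sS -leqNgt.
have /eqP := W00 (s i) (s j); rewrite mulf_eq0 => /orP[/eqP//|].
rewrite sqrf_eq0 subr_eq0 => /eqP h; move: hi hj; rewrite !inE h => /negP h1 h2.
by [].
Qed.

(** The columns of [cokermx L] lie in the kernel of L, hence are constant, and a vector of zero sum
    annihilates them. So c^T is in the row space, and symmetry makes this the column space. *)
Lemma laplacian_range (c : 'cV[R]_N) : \sum_i c i 0 = 0 -> exists z, L *m z = c.
Proof.
move=> c0.
have : (c^T <= L)%MS.
  rewrite submxE; apply/eqP/rowP => k; rewrite !mxE.
  have K : L *m col k (cokermx L) = 0.
    by rewrite colE mulmxA mulmx_coker mul0mx.
  have [i0 _|N0] := pickP (fun _ : 'I_N => true); last by apply: big1 => i; have := N0 i.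
  have h := laplacian_kernel K.
  have -> : \sum_j c^T 0 j * cokermx L j k = \sum_j c j 0 * cokermx L i0 k.
    apply: eq_bigr => j _; rewrite mxE; congr (_ * _).
    by have := h j i0; rewrite !mxE.
  by rewrite -big_distrl /= c0 mul0r.
move=> /submxP[z zE]; exists z^T.
by rewrite -[L]laplacian_sym -trmx_mul -zE trmxK.
Qed.

Lemma laplacian_sum (z : 'cV[R]_N) : \sum_i (L *m z) i 0 = 0.
Proof.
have -> : \sum_i (L *m z) i 0 = dot (const_mx 1 : 'cV[R]_N) (L *m z).
  by apply: eq_bigr => i _; rewrite [const_mx _ _ _]mxE mul1r.
rewrite -{1}laplacian_sym -dot_mulmx.
have -> : L *m (const_mx 1 : 'cV[R]_N) = 0.
  apply/colP => i; rewrite laplacian_mul [RHS]mxE big1// => j _.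
  by rewrite !mxE subrr mulr0.
exact: dot0l.
Qed.

Section Kronecker.
Variable m : nat.
Let Lb := laplacian_bar m W.
Notation rep := 'cV[R]_(repdim N m).

(** Regroups by coordinate instead of by agent: on each component the Kronecker product acts as L
    itself. *)
Definition component (k : 'I_m) (x : rep) : 'cV[R]_N := \col_i submxcol x i k 0.

Lemma laplacian_bar_component k x : component k (Lb *m x) = L *m component k x.
Proof.
apply/colP => i; rewrite mxE -{1}(submxcolK x) /Lb /laplacian_bar.
rewrite mul_mxblock_mxrow mxcolK summxE mxE; apply: eq_bigr => j _.
by rewrite mul_scalar_mx !mxE.
Qed.

Lemma dot_component (x y : rep) : dot x y = \sum_k dot (component k x) (component k y).
Proof.
rewrite dot_blocks /dot exchange_big /=; apply: eq_bigr => k _.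
by apply: eq_bigr => i _; rewrite ![component _ _ _ _]mxE.
Qed.

Lemma component_inj (x y : rep) : (forall k, component k x = component k y) -> x = y.
Proof.
move=> xy; apply/colP => l; rewrite !blockE.
by have /colP/(_ (tagnat.sig1 l)) := xy (tagnat.sig2 l); rewrite !mxE.
Qed.

Lemma laplacian_bar_sym : Lb^T = Lb.
Proof.
rewrite /Lb /laplacian_bar tr_mxblock; apply/eq_mxblockP => i j.
by have /matrixP/(_ i j) := laplacian_sym; rewrite tr_scalar_mx mxE => ->.
Qed.

Lemma laplacian_bar_psd x : 0 <= dot x (Lb *m x).
Proof.
rewrite dot_component; apply: sumr_ge0 => k _.
by rewrite laplacian_bar_component laplacian_psd.
Qed.

Lemma laplacian_bar_norm x : enorm (Lb *m x) <= spectral_norm L * enorm x.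
Proof.
rewrite -(@ler_pXn2r _ 2)//= ?nnegrE ?mulr_ge0 ?enorm_ge0 ?spectral_norm_ge0//.
rewrite exprMn !sqr_enorm !dot_component mulr_sumr; apply: ler_sum => k _.
rewrite laplacian_bar_component -!sqr_enorm -exprMn.
by rewrite ler_pXn2r ?nnegrE ?mulr_ge0 ?enorm_ge0 ?spectral_norm_ge0// spectral_normP.
Qed.

Lemma laplacian_bar_kernel (x : rep) : Lb *m x = 0 ->
  forall i j, submxcol (p_ := fun=> m) x i = submxcol x j.
Proof.
move=> Lx i j; apply/colP => k.
have : L *m component k x = 0.
  by rewrite -laplacian_bar_component Lx; apply/colP => l; rewrite !mxE.
by move=> /laplacian_kernel/(_ i j); rewrite !mxE.
Qed.

Lemma laplacian_bar_sum (x : rep) : \sum_i submxcol (Lb *m x) i = 0.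
Proof.
apply/colP => k; rewrite summxE [RHS]mxE.
transitivity (\sum_i (L *m component k x) i 0); last exact: laplacian_sum.
by apply: eq_bigr => i _; rewrite -laplacian_bar_component [RHS]mxE.
Qed.

Lemma laplacian_bar_range (c : rep) : \sum_i submxcol c i = 0 -> exists x, Lb *m x = c.
Proof.
move=> c0.
have ex k : exists z, L *m z = component k c.
  apply: laplacian_range; transitivity ((\sum_i submxcol c i) k 0).
    by rewrite summxE; apply: eq_bigr => i _; rewrite [LHS]mxE.
  by rewrite c0 mxE.
have [z hz] := choice ex.
exists (\mxcol_i \col_k z k i 0); apply: component_inj => k.
rewrite laplacian_bar_component -hz; congr (_ *m _).
by apply/colP => i; rewrite mxE mxcolK mxE.
Qed.

Lemma laplacian_bar_const (lam : 'cV[R]_m) : Lb *m (\mxcol_(i < N) lam) = 0.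
Proof.
apply: component_inj => k; rewrite laplacian_bar_component.
apply/colP => i; rewrite laplacian_mul big1 => [|j _].
  by rewrite !mxE.
by rewrite ![component _ _ _ _]mxE !mxcolK subrr mulr0.
Qed.

End Kronecker.

End Laplacian.

Section PrimalDual.
Context {R : realType} {N m : nat} {d : 'I_N -> nat}.
Notation state := 'cV[R]_(blockdim d + (repdim N m + repdim N m)).
Variables (D : forall i, 'M[R]_(m, d i)) (b : 'I_N -> 'cV[R]_m) (W : 'M[R]_N).
Let Dg := coupling_diag D.
Let Lb := laplacian_bar m W.

Lemma coupling_diag_mul (u : 'cV[R]_(blockdim d)) i :
  submxcol (Dg *m u) i = D i *m submxcol u i.
Proof.
rewrite -{1}(submxcolK u) /Dg /coupling_diag mul_mxblock_mxrow mxcolK.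
rewrite [LHS](bigD1 i)//= eqxx [X in _ + X]big1 ?addr0// => j ji.
by rewrite eq_sym (negbTE ji) mul0mx.
Qed.

Lemma coupling_diag_trmx_mul (lam : 'cV[R]_(repdim N m)) i :
  submxcol (Dg^T *m lam) i = (D i)^T *m submxcol lam i.
Proof.
rewrite -{1}(submxcolK lam) /Dg /coupling_diag tr_mxblock mul_mxblock_mxrow mxcolK.
rewrite [LHS](bigD1 i)//= eqxx [X in _ + X]big1 ?addr0// => j ji.
by rewrite (negbTE ji) trmx0 mul0mx.
Qed.

Lemma coupling_mul (u : 'cV[R]_(blockdim d)) :
  coupling D *m u = \sum_i D i *m submxcol u i.
Proof. by rewrite -{1}(submxcolK u) mul_mxrow_mxcol. Qed.

Lemma dot_suml n (I : finType) (x : I -> 'cV[R]_n) y :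
  dot (\sum_i x i) y = \sum_i dot (x i) y.
Proof.
apply: (big_morph (fun a => dot a y)) => [a c|]; first exact: dotDl.
exact: dot0l.
Qed.

Lemma Vop_sub F (x y : state) : Vop F D b W x - Vop F D b W y =
  col_mx (F (actions x) - F (actions y) + Dg^T *m multipliers (x - y))
   (col_mx (Lb *m multipliers (x - y))
      (Lb *m (multipliers (x - y) - auxiliaries (x - y)) - Dg *m actions (x - y))).
Proof.
rewrite /Vop /actions /multipliers /auxiliaries !usubmxB !dsubmxB !usubmxB.
rewrite !opp_col_mx !add_col_mx -/Lb -/Dg !mulmxBr.
congr (col_mx _ (col_mx _ _)); rewrite ?mulmxBr //.
  by apply/colP => l; rewrite !mxE; ring.
by apply/colP => l; rewrite !mxE; ring.
Qed.

Hypotheses (W0 : forall i j, 0 <= W i j) (Wsym : W^T = W).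

(** The couplings of u with lam and of mu with lam cancel, the second by symmetry of the Laplacian.
    What remains is F and the quadratic form of the Laplacian in lam. *)
Lemma Vop_monotone F : monotone_map F -> monotone_map (Vop F D b W).
Proof.
move=> F_mono x y; rewrite Vop_sub dot_submx col_mxKu col_mxKd.
rewrite (dot_submx (col_mx _ _)) col_mxKu col_mxKd.
rewrite -/(actions (x - y)) -/(auxiliaries (x - y)) -/(multipliers (x - y)).
set u := actions (x - y); set mu := auxiliaries _; set lam := multipliers _.
have h1 := F_mono (actions x) (actions y).
have h2 := laplacian_bar_psd W0 Wsym lam.
have h3 : dot (Lb *m lam) mu = dot lam (Lb *m mu).
  by rewrite (dot_mulmx Lb) /Lb laplacian_bar_sym.
rewrite mulmxBr !dotDl !dotNl (dot_mulmx Dg^T) trmxK h3.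
rewrite (dotC (Lb *m lam)) (dotC (Lb *m mu)) (dotC (Dg *m u)).
have : actions x - actions y = u by rewrite /u /actions usubmxB.
move=> E; rewrite E dotDl dotNl in h1; rewrite -/Lb in h2; lra.
Qed.

Lemma enorm_le_dot n n' (a : 'cV[R]_n) (x : 'cV[R]_n') K : 0 <= K ->
  dot a a <= K ^+ 2 * dot x x -> enorm a <= K * enorm x.
Proof.
move=> K0 h; rewrite -(@ler_pXn2r _ 2)//= ?nnegrE ?mulr_ge0 ?enorm_ge0//.
by rewrite exprMn !sqr_enorm.
Qed.

Lemma dot_norm_le n n' (a : 'cV[R]_n) (x : 'cV[R]_n') K :
  enorm a <= K * enorm x -> dot a a <= K ^+ 2 * dot x x.
Proof.
move=> h; rewrite -!sqr_enorm -exprMn ler_pXn2r// ?nnegrE ?enorm_ge0//.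
by apply: le_trans h; exact: enorm_ge0.
Qed.

(** The difference is split into four vectors whose norms are at most ell, kappa, kappa and |D|
    times |x - y|; the constants add up by the triangle inequality. *)
Lemma Vop_lipschitz ell F : 0 <= ell -> lipschitz_with ell F ->
  lipschitz_with (ell + 2 * spectral_norm (laplacian W) + spectral_norm Dg)
    (Vop F D b W).
Proof.
move=> ell0 F_lip x y; rewrite Vop_sub.
have := F_lip (actions x) (actions y).
have -> : actions x - actions y = actions (x - y) by rewrite /actions usubmxB.
move: (F _ - F _) (x - y) => e z {x y F_lip}.
have zE : dot z z = dot (actions z) (actions z) +
    (dot (auxiliaries z) (auxiliaries z) + dot (multipliers z) (multipliers z)).
  by rewrite [LHS]dot_submx [in LHS](dot_submx (dsubmx z)).
move: (actions z) (auxiliaries z) (multipliers z) zE => u mu lam zE he.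
set k := spectral_norm _; set s := spectral_norm _.
have k0 : 0 <= k by exact: spectral_norm_ge0.
have s0 : 0 <= s by exact: spectral_norm_ge0.
have -> : col_mx (e + Dg^T *m lam) (col_mx (Lb *m lam) (Lb *m (lam - mu) - Dg *m u)) =
    col_mx e 0 + col_mx 0 (col_mx 0 (Lb *m lam))
    + col_mx 0 (col_mx (Lb *m lam) (- (Lb *m mu)))
    + col_mx (Dg^T *m lam) (col_mx 0 (- (Dg *m u))).
  by rewrite !add_col_mx !(addr0, add0r) !add_col_mx !(addr0, add0r) mulmxBr.
have hu : 0 <= dot u u by exact: dot_ge0.
have hm : 0 <= dot mu mu by exact: dot_ge0.
have hl : 0 <= dot lam lam by exact: dot_ge0.
have kl : dot (Lb *m lam) (Lb *m lam) <= k ^+ 2 * dot lam lam.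
  by apply: dot_norm_le; exact: laplacian_bar_norm.
have km : dot (Lb *m mu) (Lb *m mu) <= k ^+ 2 * dot mu mu.
  by apply: dot_norm_le; exact: laplacian_bar_norm.
have su : dot (Dg *m u) (Dg *m u) <= s ^+ 2 * dot u u.
  by apply: dot_norm_le; exact: spectral_normP.
have sl : dot (Dg^T *m lam) (Dg^T *m lam) <= s ^+ 2 * dot lam lam.
  by apply: dot_norm_le; exact: spectral_normP_trmx.
have eu : dot e e <= ell ^+ 2 * dot u u by exact: dot_norm_le.
have k2 := sqr_ge0 k; have s2 := sqr_ge0 s; have e2 := sqr_ge0 ell.
apply: le_trans (enormD _ _) _; rewrite mulrDl; apply: lerD; last first.
  apply: enorm_le_dot => //; rewrite !dot_col_mx dot0l dotNl dotNr zE; nra.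
apply: le_trans (enormD _ _) _; rewrite (mulrDl 1 1 k) mul1r addrA mulrDl.
apply: lerD; last first.
  apply: enorm_le_dot => //; rewrite !dot_col_mx dot0l dotNl dotNr zE; nra.
apply: le_trans (enormD _ _) _; rewrite mulrDl; apply: lerD; last first.
  apply: enorm_le_dot => //; rewrite !dot_col_mx !dot0l zE; nra.
apply: enorm_le_dot => //; rewrite !dot_col_mx !dot0l zE; nra.
Qed.

End PrimalDual.

(** * Zeros of V + T and v-GNEs *)

Section Zeros.
Context {R : realType} {N m : nat} {d : 'I_N -> nat}.
Notation state := 'cV[R]_(blockdim d + (repdim N m + repdim N m)).
Variables (f : 'I_N -> 'cV[R]_(blockdim d) -> R)
  (g : forall i, 'cV[R]_(d i) -> \bar R)
  (D : forall i, 'M[R]_(m, d i)) (b : 'I_N -> 'cV[R]_m) (W : 'M[R]_N).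
Arguments g : clear implicits.

Lemma Top_monotone (y y' : state) a a' : (forall i, proper_function (g i)) ->
  Top g y a -> Top g y' a' -> 0 <= dot (a - a') (y - y').
Proof.
move=> g_prop [h1 h2 h3] [h1' h2' h3'].
rewrite dot_submx (dot_submx (dsubmx _)) !(usubmxB, dsubmxB).
apply: addr_ge0; first exact: (subdiff_blocks_monotone g_prop h1 h1').
rewrite -/(auxiliaries a) -/(auxiliaries a') h2 h2' subrr dot0l add0r.
exact: normal_cone_monotone h3 h3'.
Qed.

Lemma Top_closed (y a : nat -> state) y0 a0 : (forall i, proper_function (g i)) ->
  (forall i, lower_semicontinuous (g i)) ->
  (forall k, Top g (y k) (a k)) -> y @ \oo --> y0 -> a @ \oo --> a0 -> Top g y0 a0.
Proof.
move=> g_prop g_lsc h yc ac; split.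
- apply: (subdiff_blocks_closed g_prop g_lsc (y := fun k => actions (y k))
    (a := fun k => actions (a k))); last 2 first.
  + exact: usubmx_cvg.
  + exact: usubmx_cvg.
  by move=> k; have [] := h k.
- have : auxiliaries (a k) @[k --> \oo] --> auxiliaries a0.
    by apply: usubmx_cvg; exact: dsubmx_cvg.
  have -> : (fun k => auxiliaries (a k)) = fun=> 0.
    by apply/funext => k; have [] := h k.
  by move=> /cvg_unique -/(_ (@norm_hausdorff _ _) _ (cvg_cst _)) <-.
- apply: (normal_cone_nonneg_closed (y := fun k => multipliers (y k))
    (a := fun k => multipliers (a k))).
  + by move=> k; have [] := h k.
  + by apply: dsubmx_cvg; exact: dsubmx_cvg.
  + by apply: dsubmx_cvg; exact: dsubmx_cvg.
Qed.

Hypotheses (N0 : (0 < N)%N) (W0 : forall i j, 0 <= W i j) (Wsym : W^T = W)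
  (Wirr : ~ reducible W).
Let V := Vop (pseudogradient f) D b W.

(** The mu-block forces the local multipliers to agree, and summing the lam-blocks over the agents
    removes the Laplacian term, which leaves the coupled constraint. *)
Lemma zero_vGNE (p : state) : zero_of V (Top g) p -> vGNE f g D b (actions p).
Proof.
rewrite /zero_of /V /Vop /Top /= => -[].
rewrite !opp_col_mx /actions /auxiliaries /multipliers.
rewrite !(col_mxKu, col_mxKd).
set u := usubmx p; set mu := usubmx (dsubmx p); set lam := dsubmx (dsubmx p).
move=> hu /eqP; rewrite oppr_eq0 => /eqP Llam [lam0 hlam].
have lamE := laplacian_bar_kernel W0 Wsym Wirr Llam.
pose i0 : 'I_N := Ordinal N0.
exists (submxcol (p_ := fun=> m) lam i0); split.
- by move=> j; rewrite submxcolE; exact: lam0.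
- move=> i; exists (submxcol (- (pseudogradient f u + (coupling_diag D)^T *m lam)) i).
    exact: hu.
  rewrite submxcolN' submxcolD' coupling_diag_trmx_mul (lamE i i0).
  rewrite {1}/pseudogradient mxcolK; apply/colP => j; rewrite !mxE; ring.
- exists (coupling D *m u - \sum_i b i); last by rewrite subrr.
  split=> [j|y y0]; first by rewrite submxcolE; exact: lam0.
  (* Tests the product normal cone at N copies of y, which turns the sum over agents into a pairing
     in R^m. *)
  have yb : nonneg (\mxcol_(i < N) y) by move=> l; rewrite mxE; exact: y0.
  have := hlam _ yb; rewrite dot_blocks.
  set c := - _; rewrite (_ : \sum_i _ = dot (\sum_i submxcol (p_ := fun=> m) c i)
      (y - submxcol (p_ := fun=> m) lam i0)); last first.
    by rewrite dot_suml; apply: eq_bigr => i _; rewrite submxcolB' mxcolK (lamE i i0).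
  congr (dot _ _ <= _).
  transitivity (\sum_i (D i *m submxcol u i - b i
     - submxcol (p_ := fun=> m) (laplacian_bar m W *m (lam - mu)) i)).
    apply: eq_bigr => i _; rewrite /c submxcolN' submxcolB' submxcolD' mxcolK.
    by rewrite coupling_diag_mul opprB opprD addrA.
  by rewrite !sumrB laplacian_bar_sum// subr0 coupling_mul.
Qed.

(** Every agent receives a copy of the common multiplier and an equal share p / N of the slack. The
    remaining imbalance between agents sums to zero, so some mu produces it through the
    Laplacian. *)
Lemma vGNE_zero u : vGNE f g D b u -> exists p : state, zero_of V (Top g) p.
Proof.
move=> [lam [lam0 hu [p [_ hp] pE]]].
have pE' : p = coupling D *m u - \sum_i b i by apply/eqP; rewrite -subr_eq0 -pE.
pose pb : 'cV[R]_(repdim N m) := \mxcol_(i < N) (N%:R^-1 *: p).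
pose lb : 'cV[R]_(repdim N m) := \mxcol_(i < N) lam.
have Nn : N%:R != 0 :> R by rewrite pnatr_eq0 -lt0n.
have [mu muE] : exists mu, laplacian_bar m W *m mu =
    (\mxcol_i b i) - coupling_diag D *m u + pb.
  apply: laplacian_bar_range => //.
  transitivity (\sum_i (b i - D i *m submxcol u i + N%:R^-1 *: p)).
    apply: eq_bigr => i _; rewrite submxcolD' submxcolB' !mxcolK.
    by rewrite coupling_diag_mul.
  rewrite big_split sumrB /= sumr_const card_ord -scaler_nat scalerA mulfV//.
  by rewrite scale1r pE' coupling_mul subrKA subrr.
exists (col_mx u (col_mx mu lb)).
rewrite /zero_of /V /Vop /Top /=.
rewrite !opp_col_mx /actions /auxiliaries /multipliers.
rewrite !(col_mxKu, col_mxKd) laplacian_bar_const// oppr0; split=> //.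
- move=> i; have [s hs E] := hu i.
  have -> : submxcol (- (pseudogradient f u + (coupling_diag D)^T *m lb)) i = s.
    rewrite submxcolN' submxcolD' coupling_diag_trmx_mul !mxcolK.
    have -> : s = 0 - partial_grad i (f i) u - (D i)^T *m lam.
      by rewrite E; apply/colP => j; rewrite !mxE; ring.
    by rewrite opprD sub0r.
  exact: hs.
- rewrite mulmxBr laplacian_bar_const// muE.
  have -> : - ((\mxcol_i b i) + (0 - ((\mxcol_i b i) - coupling_diag D *m u + pb))
      - coupling_diag D *m u) = pb.
    by move: (coupling_diag D *m u) (\mxcol_i b i) => c e;
      apply/colP => j; rewrite !mxE; ring.
  split=> [l|y y0]; first by rewrite mxE; exact: lam0.
  rewrite dot_blocks; apply: sumr_le0 => i _.
  rewrite submxcolB' !mxcolK dotZl mulr_ge0_le0 ?invr_ge0//.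
  by apply: hp => j; rewrite submxcolE; exact: y0.
Qed.

End Zeros.

(** * Almost sure convergence *)

Section SampledPseudogradients.
Context {dO : measure_display} {Omega : measurableType dO} {R : realType}.
Variable P : probability Omega R.
Context {N : nat} {d q : 'I_N -> nat} {batch : nat -> nat}.
Variables (Xi : forall i, set 'cV[R]_(q i))
  (fhat : forall i, 'cV[R]_(blockdim d) -> 'cV[R]_(q i) -> R)
  (smp : forall (n : nat) (i : 'I_N), 'I_(batch n) -> Omega -> 'cV[R]_(q i))
  (F : 'cV[R]_(blockdim d) -> 'cV[R]_(blockdim d)) (v : nat -> R).
Arguments Xi : clear implicits.
Arguments fhat : clear implicits.
Arguments smp : clear implicits.
Hypotheses (mXi : forall i, measurable (Xi i : set (borel_cV R (q i))))
  (mfhat : forall i, measurable_fun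
     (setT `*` Xi i : set (borel_cV R (blockdim d) * borel_cV R (q i))%type)
     (fun p : borel_cV R (blockdim d) * borel_cV R (q i) => fhat i p.1 p.2))
  (dfhat : forall i u s v, Xi i s ->
     differentiable (fun v' : 'cV[R]_(d i) => fhat i (replace_block u v') s) v)
  (smpXi : forall n i t w, Xi i (smp n i t w))
  (msmp : forall n i t, measurable_fun setT (smp n i t : Omega -> borel_cV R (q i)))
  (F_cont : forall l, continuous (fun u => F u l 0)).
Let H n := batch_sigma (smp n).
Hypothesis H_indep : mutually_independent P H.

Definition sampled_gradient n u w :=
  batch_pseudogradient fhat (fun i t => smp n i t w) u.
Definition sampling_error n u w := sampled_gradient n u w - F u.
Hypotheses
  (err0 : forall n u j, (\int[P]_w (sampling_error n u w j 0)%:E = 0)%E)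
  (err2 : forall n u,
    (\int[P]_w (dot (sampling_error n u w) (sampling_error n u w))%:E <= (v n)%:E)%E).

(** The batches of times 0, ..., n - 1; the batch of time n is still fresh. *)
Definition history n := past H (iota 0 n).
Notation TG n := (g_sigma_algebraType (history n)).
Notation TH n := (g_sigma_algebraType (H n)).

Let H_sigma n : sigma_algebra setT (H n).
Proof. exact: smallest_sigma_algebra. Qed.

Let H_meas n : H n `<=` measurable.
Proof.
apply: smallest_sub; first exact: sigma_algebra_measurable.
move=> A [i _ [t _ [B mB <-]]]; rewrite setTI -[_ @^-1` _]setTI.
exact: msmp.
Qed.

Lemma history_filtration : filtration history.
Proof.
split=> [k|j k jk]; first exact: past_measurable.
apply: past_sub => c; rewrite !mem_iota !add0n /= => cj.
exact: leq_trans jk.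
Qed.

Let msmpH n i t : measurable_fun setT (smp n i t : TH n -> borel_cV R (q i)).
Proof.
move=> _ B mB; rewrite setTI; apply: sub_sigma_algebra; apply: sub_sigma_algebra.
by exists i => //; exists t => //; exists B => //; rewrite setTI.
Qed.

Let msmpG n k i t : (n < k)%N ->
  measurable_fun setT (smp n i t : TG k -> borel_cV R (q i)).
Proof.
move=> nk _ B mB; rewrite setTI; apply: sub_sigma_algebra; exists n.
  by rewrite mem_iota.
apply: sub_sigma_algebra.
by exists i => //; exists t => //; exists B => //; rewrite setTI.
Qed.

Lemma sampled_gradient_adapted n k (u : TG k -> 'cV[R]_(blockdim d)) : (n < k)%N ->
  coord_measurable u -> coord_measurable (fun w : TG k => sampled_gradient n (u w) w).
Proof.
move=> nk mu.
apply: (batch_pseudogradient_measurable mXi mfhat dfhat mu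
  (s := fun (w : TG k) i t => smp n i t w)).
- by move=> i t; exact: msmpG.
- by move=> i t w; exact: smpXi.
Qed.

Lemma sampling_error_adapted n k (u : TG k -> 'cV[R]_(blockdim d)) : (n < k)%N ->
  coord_measurable u -> coord_measurable (fun w : TG k => sampling_error n (u w) w).
Proof.
move=> nk mu; apply: coord_measurableB; first exact: sampled_gradient_adapted.
by move=> l; exact: (continuous_coord_measurable (@F_cont l) mu).
Qed.

(** The point depends on the history and the sample on the current batch; freezing requires
    measurability for the product of the two sigma-algebras. *)
Let joint n (u : TG n -> 'cV[R]_(blockdim d)) : coord_measurable u ->
  coord_measurable (fun p : TG n * TH n => sampling_error n (u p.1) p.2).
Proof.
move=> mu; have mu1 : coord_measurable (fun p : TG n * TH n => u p.1).
  by move=> l; exact: (measurableT_comp (mu l) (@measurable_fst _ _ _ _)).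
apply: coord_measurableB; last first.
  by move=> l; exact: (continuous_coord_measurable (@F_cont l) mu1).
apply: (batch_pseudogradient_measurable mXi mfhat dfhat mu1
  (s := fun (p : TG n * TH n) i t => smp n i t p.2)).
- by move=> i t; exact: (measurableT_comp (msmpH t) (@measurable_snd _ _ _ _)).
- by move=> i t w; exact: smpXi.
Qed.

Let indep n A B : <<s history n >> A -> <<s H n >> B -> P (A `&` B) = (P A * P B)%E.
Proof.
rewrite (sigma_algebra_id (H_sigma n)).
apply: (indep_past H_indep H_sigma); rewrite ?iota_uniq//.
by rewrite mem_iota add0n ltnn andbF.
Qed.

Let mG n : <<s history n >> `<=` measurable.
Proof. by have [h _] := history_filtration; exact: h. Qed.

Let mH n : <<s H n >> `<=` measurable.
Proof. by rewrite (sigma_algebra_id (H_sigma n)); exact: H_meas. Qed.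

Lemma sampling_error_second_moment n (u : TG n -> 'cV[R]_(blockdim d)) :
  coord_measurable u ->
  (\int[P]_w (dot (sampling_error n (u w) w) (sampling_error n (u w) w))%:E
     <= (v n)%:E)%E.
Proof.
move=> mu.
exact: (noise_dot_le (@mG n) (@mH n) (@indep n)
  (err := fun w w' => sampling_error n (u w) w')
  (joint mu) (fun w => err2 n (u w))).
Qed.

(** The times h k are a parameter so that they can be the odd ones, at which Y_k is sampled; since h
    increases strictly, the error of time h j is known at time h k for j < k. *)
Lemma sampling_error_martingale (h : nat -> nat)
    (u c : nat -> Omega -> 'cV[R]_(blockdim d)) (M : R) :
  {homo h : i j / (i < j)%N} ->
  (forall k, coord_measurable (u k : TG (h k) -> _)) ->
  (forall k, coord_measurable (c k : TG (h k) -> _)) ->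
  (forall k w, dot (c k w) (c k w) <= M) ->
  martingale_difference P (fun k => history (h k))
    (fun k w => dot (sampling_error (h k) (u k w) w) (c k w))
    (fun k => M * v (h k)).
Proof.
move=> hh mu mc cM.
have homono : {homo h : i j / (i <= j)%N}.
  by move=> i j; rewrite leq_eqVlt => /predU1P[->//|/hh/ltnW].
have lift k n (x : Omega -> 'cV[R]_(blockdim d)) : (k <= n)%N ->
    coord_measurable (x : TG k -> _) -> coord_measurable (x : TG n -> _).
  by move=> kn mx l; exact: (adapted_le history_filtration kn (mx l)).
have aD j k : (h j < k)%N ->
    adapted (history k) (fun w => dot (sampling_error (h j) (u j w) w) (c j w)).
  move=> jk; apply: (measurable_dot (T := TG k)).
    by apply: sampling_error_adapted => //; apply: lift (ltnW jk) (mu j).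
  exact: lift (ltnW jk) (mc j).
have mc' k : coord_measurable (c k).
  by move=> l; exact: (adapted_measurable history_filtration (mc k l)).
split.
- by move=> k; exact: (adapted_measurable history_filtration (aD k _ (ltnSn _))).
- move=> k; exact: (noise_sqr_le (@mG _) (@mH _) (@indep _)
    (err := fun w w' => sampling_error (h k) (u k w) w')
    (joint (mu k)) (fun w => err2 (h k) (u k w)) (mc' k) (cM k)).
- by move=> j k jk; apply: aD; exact: hh.
- move=> k psi apsi ipsi.
  exact: (noise_orth (@mG _) (@mH _) (@indep _)
    (err := fun w w' => sampling_error (h k) (u k w) w')
    (joint (mu k)) (fun w => err0 (h k) (u k w)) (fun w => err2 (h k) (u k w))
    (mc k) apsi ipsi).
Qed.

Section Iteration.
Context {m : nat}.
Notation state := 'cV[R]_(blockdim d + (repdim N m + repdim N m)).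
Variables (D : forall i, 'M[R]_(m, d i)) (b : 'I_N -> 'cV[R]_m) (W : 'M[R]_N)
  (T : state -> set state) (wt : 'I_(blockdim d + (repdim N m + repdim N m)) -> R)
  (al rho : nat -> R) (x0 : state) (X Y Z : nat -> Omega -> state).
Variable lmin : R.
Hypotheses (lmin0 : 0 < lmin) (lminw : forall i, lmin <= wt i)
  (T_mono : forall y y' a a', T y a -> T y' a' -> 0 <= dot (a - a') (y - y')).
(* Time 2k draws the batch xi_k and time 2k + 1 the batch eta_k. *)
Let Vs n w := Vop (fun u => sampled_gradient n u w) D b W.
Hypotheses (X0 : forall w, X 0%N w = x0)
  (Zk : forall k w, Z k w = X k w + al k *: (X k w - X k.-1 w))
  (Yk : forall k w, exists2 t, T (Y k w) t &
     Z k w - unweight wt (Vs k.*2 w (Z k w)) = Y k w + unweight wt t)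
  (Xk : forall k w, X k.+1 w = (1 - rho k) *: Z k w + rho k *: (Y k w -
     unweight wt (Vs k.*2.+1 w (Y k w) - Vs k.*2 w (Z k w)))).

Let wt0 i : 0 < wt i. Proof. exact: lt_le_trans (lminw i). Qed.

Let coord_measurable_unweight dT (TT : measurableType dT) (x : TT -> state) :
  coord_measurable x -> coord_measurable (fun t => unweight wt (x t)).
Proof. by move=> mx i; under eq_fun do rewrite mxE; exact: measurable_funM. Qed.

Let Vs_adapted n k (x : Omega -> state) : (n < k)%N ->
  coord_measurable (x : TG k -> _) -> coord_measurable (fun w : TG k => Vs n w (x w)).
Proof.
move=> nk mx.
apply: (Vop_measurable (T := TG k) (F := fun w u => sampled_gradient n u w)) => //.
by apply: sampled_gradient_adapted => //; exact: coord_measurable_usubmx.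
Qed.

Let lift k n (p : nat) (x : Omega -> 'cV[R]_p) : (k <= n)%N ->
  coord_measurable (x : TG k -> _) -> coord_measurable (x : TG n -> _).
Proof. by move=> kn mx l; exact: (adapted_le history_filtration kn (mx l)). Qed.

(** The resolvent is only a relation here. Monotonicity makes it nonexpansive in the weighted norm,
    which [lipschitz_graph_measurable] turns into measurability of Y_k. *)
Let resolvent_lipschitz y y' t t' i : T y t -> T y' t' ->
  `|y i 0 - y' i 0| <= (\sum_j Num.sqrt (wt j)^-1) *
     wnorm wt ((y + unweight wt t) - (y' + unweight wt t')).
Proof.
move=> Tt Tt'; have w0 j : 0 <= wt j by exact: ltW.
set a := y + _ - _.
have aE : a = (y - y') + unweight wt (t - t').
  by rewrite /a unweightD unweightN opprD addrACA.
have h : wdot wt (y - y') (y - y') <= wdot wt a a.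
  have gen e s : 0 <= wdot wt s e -> wdot wt e e <= wdot wt (e + s) (e + s).
    by move=> h; have := wdot_ge0 wt0 s; rewrite !wdotE (wdotC wt e s); lra.
  by rewrite aE; apply: gen; rewrite (wdot_unweight lmin0 lminw); exact: T_mono.
have -> : y i 0 - y' i 0 = (y - y') i 0 by rewrite !mxE.
apply: (@le_trans _ _ (Num.sqrt (wt i)^-1 * wnorm wt a)); last first.
  rewrite ler_wpM2r ?sqrtr_ge0// (bigD1 i)//= lerDl.
  by apply: sumr_ge0 => j _; exact: sqrtr_ge0.
rewrite -sqrtrM ?invr_ge0// -sqrtr_sqr; apply: ler_wsqrtr.
apply: le_trans (wdot_coord wt0 _ _) _.
by rewrite ler_wpM2l// invr_ge0.
Qed.

Let Y_adapted_of k : coord_measurable (Z k : TG k.*2 -> _) ->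
  coord_measurable (Y k : TG k.*2.+1 -> _).
Proof.
move=> mZ.
have mZ' : coord_measurable (Z k : TG k.*2.+1 -> _) by exact: (lift (leqnSn _) mZ).
apply: (lipschitz_graph_measurable wt0
  (K := \sum_j Num.sqrt (wt j)^-1)
  (Gr := fun a y => exists2 t, T y t & a = y + unweight wt t)
  (z := fun w : TG k.*2.+1 => Z k w - unweight wt (Vs k.*2 w (Z k w)))) => //.
- by apply: sumr_ge0 => j _; exact: sqrtr_ge0.
- by move=> a a' y y' i [t Tt ->] [t' Tt' ->]; exact: resolvent_lipschitz.
- apply: coord_measurableB => //; apply: coord_measurable_unweight.
  exact: Vs_adapted.
Qed.

Let Z_adapted_of k : coord_measurable (X k : TG k.*2 -> _) ->
  coord_measurable (X k.-1 : TG k.*2 -> _) -> coord_measurable (Z k : TG k.*2 -> _).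
Proof.
move=> mX mX'; have -> : Z k = fun w => X k w + al k *: (X k w - X k.-1 w).
  by apply/funext => w; exact: Zk.
apply: coord_measurableD => //; apply: coord_measurableZ; exact: coord_measurableB.
Qed.

(** The inertial step uses two consecutive iterates, so both are carried through the induction. *)
Let X_adapted k : coord_measurable (X k : TG k.*2 -> _) /\
  coord_measurable (X k.-1 : TG k.*2 -> _).
Proof.
elim: k => [|k [ih ih']].
  have -> : X 0%N = fun=> x0 by apply/funext => w; exact: X0.
  by split; exact: coord_measurable_cst.
rewrite doubleS /=; have mZ := Z_adapted_of ih ih'.
have mY := Y_adapted_of mZ.
have mZ' : coord_measurable (Z k : TG k.*2.+2 -> _) by exact: (lift (leqW (leqnSn _)) mZ).
have mY' : coord_measurable (Y k : TG k.*2.+2 -> _) by exact: (lift (leqnSn _) mY).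
split; last exact: (lift (leqW (leqnSn _)) ih).
have -> : X k.+1 = fun w => (1 - rho k) *: Z k w + rho k *: (Y k w -
     unweight wt (Vs k.*2.+1 w (Y k w) - Vs k.*2 w (Z k w))).
  by apply/funext => w; exact: Xk.
apply: coord_measurableD; apply: coord_measurableZ => //.
apply: coord_measurableB => //; apply: coord_measurable_unweight.
by apply: coord_measurableB; apply: Vs_adapted; rewrite ?ltnS ?leqnSn.
Qed.

Lemma Z_adapted k : coord_measurable (Z k : TG k.*2 -> _).
Proof. by have [] := X_adapted k; exact: Z_adapted_of. Qed.

Lemma Y_adapted k : coord_measurable (Y k : TG k.*2.+1 -> _).
Proof. exact: (Y_adapted_of (@Z_adapted k)). Qed.

Variables (coef : nat -> R) (C M : R).
Hypotheses (v_even : cvgn (series (fun k => v k.*2)))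
  (v_odd : cvgn (series (fun k => v k.*2.+1)))
  (coef_le : forall k, `|coef k| <= C)
  (Y_le : forall k w, dot (actions (Y k w)) (actions (Y k w)) <= M).

Let errY k w := sampling_error k.*2.+1 (actions (Y k w)) w.

(** The deterministic factor [coef] is absorbed into c, so its bound merely rescales the
    variances. *)
Let martingale_cvg (c : nat -> Omega -> 'cV[R]_(blockdim d)) B :
  (forall k, coord_measurable (c k : TG k.*2.+1 -> _)) ->
  (forall k w, dot (c k w) (c k w) <= B) ->
  {ae P, forall w, cvgn (series (fun k => coef k * dot (errY k w) (c k w)))}.
Proof.
move=> mc cB.
have hinc : {homo (fun k => k.*2.+1) : i j / (i < j)%N}.
  by move=> i j ij; rewrite ltnS ltn_double.
have mY k : coord_measurable (fun w : TG k.*2.+1 => actions (Y k w)).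
  by apply: coord_measurable_usubmx; exact: Y_adapted.
have md := @sampling_error_martingale (fun k => k.*2.+1) (fun k w => actions (Y k w))
  (fun k w => coef k *: c k w) (C ^+ 2 * B) hinc mY.
have fG : filtration (fun k => history k.*2.+1).
  split=> [k|j k jk]; first exact: mG.
  by have [_ h] := history_filtration; apply: h; rewrite ltnS leq_double.
apply: filterS (martingale_difference_cvg fG (md _ _) _).
- move=> w; under eq_fun do rewrite dotZr; exact.
- by move=> k; apply: coord_measurableZ.
- move=> k w; rewrite dotZl dotZr mulrA -expr2; apply: ler_pM => //.
  + exact: sqr_ge0.
  + exact: dot_ge0.
  by rewrite -real_normK ?num_real// ler_pXn2r ?nnegrE//; exact: le_trans (coef_le k).
- exact: is_cvg_seriesZ.
Qed.

Lemma sampling_errors_cvg : {ae P, forall w,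
  [/\ cvgn (series (fun k => dot (sampling_error k.*2 (actions (Z k w)) w)
                                 (sampling_error k.*2 (actions (Z k w)) w))),
      cvgn (series (fun k => dot (errY k w) (errY k w)))
    & forall p, cvgn (series (fun k => coef k * dot (errY k w) (actions (Y k w) - p)))]}.
Proof.
have mZ k : coord_measurable (fun w : TG k.*2 => actions (Z k w)).
  by apply: coord_measurable_usubmx; exact: Z_adapted.
have mY k : coord_measurable (fun w : TG k.*2.+1 => actions (Y k w)).
  by apply: coord_measurable_usubmx; exact: Y_adapted.
have meas n k (x : Omega -> 'cV[R]_(blockdim d)) : (n <= k)%N ->
    coord_measurable (x : TG n -> _) ->
    measurable_fun setT
      (fun w => dot (sampling_error k (x w) w) (sampling_error k (x w) w)).
  move=> nk mx; apply: (adapted_measurable history_filtration (k := k.+1)).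
  apply: (measurable_dot (T := TG k.+1));
    by apply: sampling_error_adapted => //; apply: lift mx; exact: leqW.
have aeU := ae_cvg_series (fun k => meas _ _ _ (leqnn _) (mZ k)) (fun k w => dot_ge0 _)
  (fun k => sampling_error_second_moment (mZ k)) v_even.
have aeW := ae_cvg_series (fun k => meas _ _ _ (leqnn _) (mY k)) (fun k w => dot_ge0 _)
  (fun k => sampling_error_second_moment (mY k)) v_odd.
have ae0 := martingale_cvg mY Y_le.
have ae1 l := @martingale_cvg (fun _ _ => delta_mx l 0) _
  (fun k => coord_measurable_cst _) (fun k w => lexx _).
have ae1' : {ae P, forall w, forall l : 'I_(blockdim d),
    cvgn (series (fun k => coef k * dot (errY k w) (delta_mx l 0)))}.
  apply: filter_forall => l; exact: ae1.
apply: filterS2 aeU (filterI aeW (filterI ae0 ae1')) => w cU [cW [c0 c1]].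
split=> // p.
(* The path w is fixed by now, so p may depend on it. *)
have -> : (fun k => coef k * dot (errY k w) (actions (Y k w) - p)) =
    (fun k => coef k * dot (errY k w) (actions (Y k w)) -
       \sum_(l < blockdim d) p l 0 * (coef k * dot (errY k w) (delta_mx l 0))).
  apply/funext => k; rewrite dotDr dotNr mulrBr; congr (_ - _).
  rewrite /dot mulr_sumr; apply: eq_bigr => l _.
  by rewrite -/(dot _ _) dot_delta; ring.
suff gen (s : seq 'I_(blockdim d)) : cvgn (series (fun k =>
    \sum_(l <- s) p l 0 * (coef k * dot (errY k w) (delta_mx l 0)))).
  by apply: is_cvg_seriesB => //; exact: gen.
elim: s => [|l s ih].
  have -> : (fun k => \sum_(l <- [::]) p l 0 * (coef k * dot (errY k w) (delta_mx l 0)))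
      = fun=> 0.
    by apply/funext => k; rewrite big_nil.
  have -> : series (fun=> 0 : R) = fun=> 0 by apply/funext => k; rewrite /series /= big1.
  exact: is_cvg_cst.
have -> : (fun k => \sum_(j <- l :: s) p j 0 * (coef k * dot (errY k w) (delta_mx j 0))) =
   (p l 0 *: (fun k => coef k * dot (errY k w) (delta_mx l 0))) +
   (fun k => \sum_(j <- s) p j 0 * (coef k * dot (errY k w) (delta_mx j 0))).
  by apply/funext => k; rewrite big_cons.
by apply: is_cvg_seriesD => //; exact: is_cvg_seriesZ.
Qed.

End Iteration.

End SampledPseudogradients.

(** * Parameters, and reduction to the pathwise theorem *)

Section StepSizes.
Context {R : realType}.
Implicit Types nu ell lmin kap a L : R.

Lemma stepsize_bound nu ell lmin : 0 < nu < 1 -> 0 <= ell ->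
  0 < lmin^-1 < (1 - nu) / (2 * ell) -> ell / lmin <= 1 / 2.
Proof.
move=> /andP[n0 n1] ell0 /andP[l1 l2].
(* For ell = 0 the upper bound is a division by zero, which evaluates to 0 and contradicts 0 <
   lmin^-1. *)
have elln0 : ell != 0.
  apply/eqP => h; move: (lt_trans l1 l2).
  by rewrite h mulr0 invr0 mulr0 ltxx.
have ellp : 0 < ell by rewrite lt_neqAle eq_sym elln0.
by move: l2; rewrite ltr_pdivlMr ?mulr_gt0// => l2; lra.
Qed.

Lemma relaxation_constant nu : 0 < nu < 1 -> 0 < (3 - nu) / 2 <= 3 / 2.
Proof. by move=> /andP[n0 n1]; apply/andP; split; lra. Qed.

Lemma relaxation_bound kap a L al : 0 < kap <= 3 / 2 -> 0 < a < 1 -> 0 <= L ->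
  0 <= kap * (1 - a) ^+ 2 / relax_den al / (1 + L) <= 3.
Proof.
move=> /andP[k0 k1] /andP[a0 a1] L0.
have den0 : 1 / 2 <= relax_den al.
  by rewrite /relax_den; have := sqr_ge0 (al - 1 / 4); lra.
have denp : 0 < relax_den al by lra.
have Lp : 0 < 1 + L by lra.
apply/andP; split.
  apply: divr_ge0 (ltW Lp); apply: divr_ge0 (ltW denp).
  exact: mulr_ge0 (ltW k0) (sqr_ge0 _).
rewrite ler_pdivrMr// ler_pdivrMr//.
have a2 : (1 - a) ^+ 2 <= 1 by rewrite expr_le1//; lra.
have h1 : kap * (1 - a) ^+ 2 <= 3 / 2.
  by rewrite -[leRHS]mulr1; apply: ler_pM => //; rewrite ?sqr_ge0// ltW.
have h2 := mulr_ge0 L0 (ltW denp).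
lra.
Qed.

End StepSizes.

Lemma mutually_independent_comp dO (Omega : measurableType dO) (R : realType)
    (P : probability Omega R) (I J : eqType) (h : J -> I) (h' : I -> J)
    (G : I -> set (set Omega)) : cancel h h' ->
  mutually_independent P G -> mutually_independent P (G \o h).
Proof.
move=> hK ind s A us sA.
have AE : A \o h' \o h = A by apply/funext => i /=; rewrite hK.
have := ind (map h s) (A \o h'); rewrite !big_map (map_inj_uniq (can_inj hK)).
rewrite -[in X in _ -> X]AE; apply => // i /mapP[j js ->] /=.
by rewrite hK; exact: sA.
Qed.

Lemma Vop_noise (R : realType) N m (d : 'I_N -> nat)
    (F F' : 'cV[R]_(blockdim d) -> 'cV[R]_(blockdim d))
    (D : forall i, 'M[R]_(m, d i)) b (W : 'M[R]_N) x :
  Vop F' D b W x - Vop F D b W x = col_mx (F' (actions x) - F (actions x)) 0.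
Proof.
rewrite /Vop !opp_col_mx !add_col_mx !subrr col_mx0; congr col_mx.
by rewrite opprD addrACA subrr addr0.
Qed.

(** Only F is sampled, so the error has zero dual blocks; the assumption at the state (u, 0) is one
    on the actions u. *)
Lemma unbiased_actions dO (Omega : measurableType dO) (R : realType)
    (P : probability Omega R) N m (d : 'I_N -> nat)
    (F : 'cV[R]_(blockdim d) -> 'cV[R]_(blockdim d))
    (F' : Omega -> 'cV[R]_(blockdim d) -> 'cV[R]_(blockdim d))
    (D : forall i, 'M[R]_(m, d i)) b (W : 'M[R]_N) v :
  unbiased_with_variance P (fun x w => Vop (F' w) D b W x - Vop F D b W x) v ->
  forall u, (forall j, (\int[P]_w ((F' w u - F u) j 0)%:E = 0)%E) /\
    (\int[P]_w (dot (F' w u - F u) (F' w u - F u))%:E <= v%:E)%E.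
Proof.
move=> h u; have [h1 h2] := h (col_mx u 0); split => [j|].
  rewrite -(h1 (lshift _ j)) expectation.unlock; apply: eq_integral => w _ /=.
  by rewrite Vop_noise col_mxEu /actions col_mxKu.
apply: le_trans h2; rewrite expectation.unlock le_eqVlt; apply/orP; left; apply/eqP.
apply: eq_integral => w _ /=.
by rewrite Vop_noise sqr_enorm dot_col_mx dot0l addr0 /actions col_mxKu.
Qed.

Theorem theorem1 (R : realType)
    (dO : measure_display) (Omega : measurableType dO) (P : probability Omega R)
    (* the game *)
    (N m : nat) (d q : 'I_N -> nat)
    (f : 'I_N -> 'cV[R]_(blockdim d) -> R)
    (g : forall i : 'I_N, 'cV[R]_(d i) -> \bar R)
    (D : forall i : 'I_N, 'M[R]_(m, d i)) (b : 'I_N -> 'cV[R]_m)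
    (Xi : forall i : 'I_N, set 'cV[R]_(q i))
    (fhat : forall i : 'I_N, 'cV[R]_(blockdim d) -> 'cV[R]_(q i) -> R)
    (noise : forall i : 'I_N, Omega -> 'cV[R]_(q i))
    (W : 'M[R]_N) (ell : R)
    (* the samples *)
    (batch : nat -> nat)
    (xi eta : forall (k : nat) (i : 'I_N), 'I_(batch k) -> Omega -> 'cV[R]_(q i))
    (sdev : R)
    (* the algorithm *)
    (gam sig tau : 'I_N -> R) (nu abar : R) (alpha : nat -> R)
    (x0 : 'cV[R]_(blockdim d + (repdim N m + repdim N m)))
    (X Y Z : nat -> Omega -> 'cV[R]_(blockdim d + (repdim N m + repdim N m))) :
  (0 < N)%N ->
  (* f_i is the expectation of fhat_i(., xi_i), xi_i with values in Xi_i *)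
  (forall i, measurable (Xi i : set (borel_cV R (q i)))) ->
  (forall i, measurable_fun setT (noise i : Omega -> borel_cV R (q i))) ->
  (forall i w, Xi i (noise i w)) ->
  (forall i, measurable_fun
     (setT `*` Xi i : set (borel_cV R (blockdim d) * borel_cV R (q i))%type)
     (fun p : borel_cV R (blockdim d) * borel_cV R (q i) => fhat i p.1 p.2)) ->
  (forall i u s v, Xi i s ->
     differentiable (fun v' : 'cV[R]_(d i) => fhat i (replace_block u v') s) v) ->
  (forall i u, P.-integrable setT (EFin \o (fun w => fhat i u (noise i w)))) ->
  (forall i u, ('E_P[fun w => fhat i u (noise i w)] = (f i u)%:E)%E) ->
  (* the costs and the constraints *)
  (forall i, proper_function (g i)) ->
  (forall i, econvex_function (g i)) ->
  (forall i, lower_semicontinuous (g i)) ->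
  (forall i, compact (edom (g i))) ->
  (forall i, convex_set (edom (g i))) ->
  (forall i u, convex_function setT
     (fun v : 'cV[R]_(d i) => f i (replace_block u v))) ->
  (forall i u, continuously_differentiable
     (fun v : 'cV[R]_(d i) => f i (replace_block u v))) ->
  Slater g D b ->
  monotone_map (pseudogradient f) ->
  0 <= ell -> lipschitz_with ell (pseudogradient f) ->
  (* the network *)
  (forall i j, 0 <= W i j) -> W^T = W -> ~ reducible W ->
  (* the sampling *)
  (forall k, (1 <= batch k)%N) -> {homo batch : k l / (k <= l)%N} ->
  cvgn (series (fun k => (batch k)%:R^-1 : R)) ->
  (forall k i t w, Xi i (xi k i t w)) -> (forall k i t w, Xi i (eta k i t w)) ->
  (forall k i, iid_copies P (noise i) (xi k i)) ->
  (forall k i, iid_copies P (noise i) (eta k i)) ->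
  mutually_independent P (fun c : bool * nat =>
    if c.1 then batch_sigma (xi c.2) else batch_sigma (eta c.2)) ->
  let V := Vop (pseudogradient f) D b W in
  let Vhat k (s : forall i : 'I_N, 'I_(batch k) -> 'cV[R]_(q i)) :=
    Vop (batch_pseudogradient fhat s) D b W in
  let xi_ k w := fun i t => xi k i t w in
  let eta_ k w := fun i t => eta k i t w in
  0 < sdev ->
  (forall k, unbiased_with_variance P
     (fun x w => Vhat k (xi_ k w) x - V x) (sdev ^+ 2 / (batch k)%:R)) ->
  (forall k, unbiased_with_variance P
     (fun x w => Vhat k (eta_ k w) x - V x) (sdev ^+ 2 / (batch k)%:R)) ->
  (* the parameters *)
  (forall i, 0 < gam i) -> (forall i, 0 < sig i) -> (forall i, 0 < tau i) ->
  let Ps := @Psi R N m d gam sig tau in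
  let lmin := min_eigenvalue Ps in
  let ellV := ell + 2 * spectral_norm (laplacian W)
              + spectral_norm (coupling_diag D) in
  let ellVPsi := ellV / lmin in
  0 < nu < 1 ->
  0 < lmin^-1 < (1 - nu) / (2 * ellV) ->
  (forall k, 0 < alpha k <= abar) -> abar < 1 ->
  let rho k := (3 - nu) * (1 - abar) ^+ 2
    / (2 * (2 * alpha k ^+ 2 - alpha k + 1) * (1 + ellVPsi)) in
  (* the iteration; X k.-1 at k = 0 is the convention X_{-1} = X_0 *)
  nonneg (multipliers x0) ->
  (forall w, X 0%N w = x0) ->
  (forall k w, Z k w = X k w + alpha k *: (X k w - X k.-1 w)) ->
  (forall k w, resolvent (mxcomp (invmx Ps) (Top g))
     (Z k w - invmx Ps *m Vhat k (xi_ k w) (Z k w)) (Y k w)) ->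
  (forall k w, X k.+1 w = (1 - rho k) *: Z k w
     + rho k *: (Y k w - invmx Ps *m
         (Vhat k (eta_ k w) (Y k w) - Vhat k (xi_ k w) (Z k w)))) ->
  {ae P, forall w, exists2 ustar,
     vGNE f g D b ustar & (fun k => actions (X k w)) @ \oo --> ustar}.

Proof.
move=> N0 mXi _ _ mfhat dfhat _ _ g_prop g_conv g_lsc g_comp _ _ _ slater F_mono
  ell0 F_lip W0 Wsym Wirr batch1 _ batch_cvg xiXi etaXi xi_iid eta_iid indep V Vhat xi_ eta_
  sdev0 xi_var eta_var gam0 sig0 tau0 Ps lmin ellV ellVPsi nu01 lmin_bnd ala abar1 rho
  _ X0 Zk Yk Xk.
pose F := pseudogradient f.
pose wt i := Psi_row m d gam sig tau 0 i.
have wt0 i : 0 < wt i by exact: Psi_row_gt0.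
have PsE : Ps = diag_mx (Psi_row m d gam sig tau) by exact: Psi_diag.
have unwE x : invmx Ps *m x = unweight wt x.
  rewrite PsE invmx_diag => [|i]; last by rewrite gt_eqF// wt0.
  by apply/colP => i; rewrite diag_mx_cV [RHS]mxE; congr (_ * _); rewrite mxE.
have lmin0 : 0 < lmin by move: lmin_bnd => /andP[]; rewrite invr_gt0.
have lminw i : lmin <= wt i by rewrite /lmin PsE; exact: min_eigenvalue_diag.
have ellV0 : 0 <= ellV.
  by rewrite /ellV !addr_ge0 ?mulr_ge0 ?spectral_norm_ge0.
have L0 : 0 <= ellVPsi by rewrite divr_ge0// ltW.
have Lhalf : ellVPsi <= 1 / 2 by exact: (stepsize_bound nu01 ellV0 lmin_bnd).
have alpha0 := ala 0%N.
have abar0 : 0 < abar by move: alpha0 => /andP[]; exact: lt_le_trans.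
have a01 : 0 < abar < 1 by rewrite abar0.
(* nu enters through kap <= 3/2 here and through L <= 1/2 in [Lhalf]. *)
pose kap := (3 - nu) / 2.
have kap01 : 0 < kap <= 3 / 2 by exact: relaxation_constant.
have rhoE k : rho k = kap * (1 - abar) ^+ 2 / relax_den (alpha k) / (1 + ellVPsi).
  by rewrite /rho /kap /relax_den !invfM; ring.
have [s [s_bnd s_rec]] := inertia_weights a01 ala.
have rho_bnd k : 0 <= rho k <= 3.
  by rewrite rhoE relaxation_bound.
pose coef k := 2 * (1 + s k.+1) * rho k.
have coef_le k : `|coef k| <= 2 * (1 + abar / (1 - abar)) * 3.
  have /andP[s0 s1] := s_bnd k.+1; have /andP[r0 r1] := rho_bnd k.
  have c0 : 0 <= 2 * (1 + s k.+1) by exact: mulr_ge0 (ler0n _ 2) (addr_ge0 ler01 s0).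
  rewrite ger0_norm; last exact: mulr_ge0 c0 r0.
  apply: ler_pM => //.
  by rewrite ler_pM2l// lerD2l.
pose sel n : forall i : 'I_N, 'I_(batch n./2) -> Omega -> 'cV[R]_(q i) :=
  if odd n then eta n./2 else xi n./2.
have sel_even k u w : sampled_gradient fhat sel k.*2 u w =
    batch_pseudogradient fhat (xi_ k w) u.
  by rewrite /sampled_gradient /sel odd_double doubleK.
have sel_odd k u w : sampled_gradient fhat sel k.*2.+1 u w =
    batch_pseudogradient fhat (eta_ k w) u.
  by rewrite /sampled_gradient /sel /= odd_double /= uphalf_double.
have fun_even k w : (fun u => sampled_gradient fhat sel k.*2 u w) =
    batch_pseudogradient fhat (xi_ k w) by apply/funext => u; exact: sel_even.
have fun_odd k w : (fun u => sampled_gradient fhat sel k.*2.+1 u w) =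
    batch_pseudogradient fhat (eta_ k w) by apply/funext => u; exact: sel_odd.
have selXi n i t w : Xi i (sel n i t w).
  by move: t; rewrite /sel; case: (odd n) => t; [exact: etaXi|exact: xiXi].
have msel n i t : measurable_fun setT (sel n i t : Omega -> borel_cV R (q i)).
  move: t; rewrite /sel; case: (odd n) => t.
    by have [h _ _] := eta_iid n./2 i; exact: h.
  by have [h _ _] := xi_iid n./2 i; exact: h.
have sel_indep : mutually_independent P (fun n => batch_sigma (sel n)).
  (* Interleaves the two families: [true], the tag of xi, goes to even times and [false], the tag of
     eta, to odd ones. *)
  pose h n := (~~ odd n, n./2); pose h' (c : bool * nat) := (c.2.*2 + ~~ c.1)%N.
  have hK : cancel h h'.
    by move=> n; rewrite /h /h' /= negbK addnC odd_double_half.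
  have := mutually_independent_comp hK indep.
  congr (mutually_independent P _); apply/funext => n.
  by rewrite /h /sel /=; case: (odd n).
pose v n : R := sdev ^+ 2 / (batch n./2)%:R.
have selP n u : (forall j, (\int[P]_w (sampling_error fhat sel F n u w j 0)%:E = 0)%E) /\
    (\int[P]_w (dot (sampling_error fhat sel F n u w) (sampling_error fhat sel F n u w))%:E
      <= (v n)%:E)%E.
  rewrite /sampling_error /sampled_gradient /sel /v; case: (odd n).
    exact: (unbiased_actions (F := F)
      (F' := fun w => batch_pseudogradient fhat (eta_ n./2 w))
      (D := D) (b := b) (W := W) (eta_var n./2) u).
  exact: (unbiased_actions (F := F)
      (F' := fun w => batch_pseudogradient fhat (xi_ n./2 w))
      (D := D) (b := b) (W := W) (xi_var n./2) u).
have F_cont l : continuous (fun u => F u l 0).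
  move=> u; have : F u' @[u' --> u] --> F u.
    exact: (lipschitz_cvg ell0 F_lip (@cvg_id _ (nbhs u))).
  by move=> /cvg_colP; exact.
have T_mono (y y' a a' : 'cV[R]_(blockdim d + (repdim N m + repdim N m))) :
    Top g y a -> Top g y' a' -> 0 <= dot (a - a') (y - y').
  exact: Top_monotone.
have Yk' k w : exists2 t, Top g (Y k w) t & Z k w - unweight wt
    (Vop (fun u => sampled_gradient fhat sel k.*2 u w) D b W (Z k w)) = Y k w + unweight wt t.
  rewrite fun_even; have [_ [t Tt <-]] := Yk k w.
  by rewrite unwE unwE => E; exists t.
have Xk' k w : X k.+1 w = (1 - rho k) *: Z k w + rho k *: (Y k w - unweight wt
    (Vop (fun u => sampled_gradient fhat sel k.*2.+1 u w) D b W (Y k w)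
     - Vop (fun u => sampled_gradient fhat sel k.*2 u w) D b W (Z k w))).
  by rewrite fun_even fun_odd Xk unwE.
have [M M0 YM] := subdiff_blocks_bounded g_prop g_comp.
(* A nonempty subdifferential places Y in the domains of the g_i, so the bound holds on every
   path. *)
have Y_le k w : dot (actions (Y k w)) (actions (Y k w)) <= \sum_(l < blockdim d) M ^+ 2.
  have [t [ht _ _] _] := Yk' k w; apply: ler_sum => l _.
  rewrite -expr2 -real_normK ?num_real// ler_pXn2r ?nnegrE//.
  exact: (YM _ (actions t)).
have v_even : cvgn (series (fun k => v k.*2)).
  have -> : (fun k => v k.*2) = sdev ^+ 2 *: (fun k => (batch k)%:R^-1).
    by apply/funext => k; rewrite /v doubleK.
  exact: is_cvg_seriesZ.
have v_odd : cvgn (series (fun k => v k.*2.+1)).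
  have -> : (fun k => v k.*2.+1) = sdev ^+ 2 *: (fun k => (batch k)%:R^-1).
    by apply/funext => k; rewrite /v /= uphalf_double.
  exact: is_cvg_seriesZ.
have := sampling_errors_cvg mXi mfhat dfhat selXi msel F_cont sel_indep
  (fun n u => (selP n u).1) (fun n u => (selP n u).2) lmin0 lminw T_mono X0 Zk Yk' Xk'
  v_even v_odd coef_le Y_le.
apply: filterS => w [cU cW cM].
have [x zx Xx] : exists2 x, zero_of V (Top g) x & (fun k => X k w) @ \oo --> x.
  pose A k := Vop (fun u => sampled_gradient fhat sel k.*2 u w) D b W (Z k w).
  pose B k := Vop (fun u => sampled_gradient fhat sel k.*2.+1 u w) D b W (Y k w).
  have cvgnE (u u' : nat -> R) : u = u' -> cvgn (series u) -> cvgn (series u').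
    by move=> ->.
  have V_mono : monotone_map V by exact: Vop_monotone.
  have V_lip : lipschitz_with ellV V by exact: Vop_lipschitz.
  have h := @fbf_converges R _ wt lmin ellV V (Top g) lmin0 lminw V_mono ellV0 V_lip T_mono
    _ Lhalf kap abar alpha s (X^~ w) (Y^~ w) (Z^~ w) A B a01 ala kap01 s_bnd s_rec
    (Zk^~ w) (Yk'^~ w).
  apply: h.
  - by move=> y a y0 a0; exact: Top_closed.
  - by move=> k; rewrite Xk' rhoE.
  - apply: cvgnE cU; apply/funext => k.
    by rewrite /A Vop_noise dot_col_mx dot0l addr0.
  - apply: cvgnE cW; apply/funext => k.
    by rewrite /B Vop_noise dot_col_mx dot0l addr0.
  - have [u hu] := vGNE_exists g_prop g_conv g_lsc g_comp slater F_mono ell0 F_lip.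
    exact: (vGNE_zero N0 W0 Wsym Wirr hu).
  - move=> p _; apply: cvgnE (cM (actions p)); apply/funext => k.
    rewrite /coef rhoE /B Vop_noise.
    by rewrite dot_submx col_mxKu col_mxKd dot0l addr0 usubmxB.
exists (actions x); first exact: (zero_vGNE N0 W0 Wsym Wirr zx).
exact: usubmx_cvg.
Qed.
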